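(* Let $m\ge 1$, let $A=\mathbb{C}[z_1,\dots,z_m]$, and let $I$ be an ideal of $A$ generated by monomials $z^{\alpha_1},\dots,z^{\alpha_l}$ ($l\ge 1$, $\alpha_i\in\mathbb{N}^m$). Let $\overline{I}$ be the closure of $I$ in the Bergman space $L^2_a(\mathbb{B}^m)$. Then there exist an integer $k\geq 1$, Hilbert $A$-modules $\mathcal{A}_0=L^2_a(\mathbb{B}^m),\mathcal{A}_1,\dots,\mathcal{A}_k$ such that $\mathcal{A}_1,\dots,\mathcal{A}_k$ are Bergman space like (each is a finite, possibly empty, direct sum of box modules $\mathcal{H}^{\mathfrak{b}}_{\mathfrak{j}}$), and bounded $A$-module morphisms $\Psi_i:\mathcal{A}_i\to\mathcal{A}_{i+1}$, $i=0,\dots,k-1$, such that the sequence of Hilbert $A$-modules $$0\longrightarrow \overline{I}\hookrightarrow L^2_a(\mathbb{B}^m)\stackrel{\Psi_0}{\longrightarrow}\mathcal{A}_1\stackrel{\Psi_1}{\longrightarrow}\cdots\stackrel{\Psi_{k-1}}{\longrightarrow}\mathcal{A}_k\longrightarrow 0$$ is exact.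
   Context: $\mathbb{N}=\{0,1,2,\dots\}$. $\mathbb{B}^m$ is the open unit ball of $\mathbb{C}^m$, and $L^2_a(\mathbb{B}^m)$ is the Hilbert space of holomorphic functions on $\mathbb{B}^m$ square integrable with respect to normalized Lebesgue measure. It has orthonormal basis $e_{\mathfrak{n}}=z_1^{n^1}\cdots z_m^{n^m}/\sqrt{\omega_0(\mathfrak{n})}$, $\mathfrak{n}=(n^1,\dots,n^m)\in\mathbb{N}^m$, where $\omega_0(\mathfrak{n})=\frac{n^1!\cdots n^m!\,m!}{(n^1+\cdots+n^m+m)!}$. A Hilbert $A$-module is a Hilbert space with a representation of $A$ by bounded operators; $L^2_a(\mathbb{B}^m)$ is one via multiplication operators $T_{z_p}$, and $\overline{I}$ is a submodule. Module morphisms are linear maps commuting with the actions of $z_1,\dots,z_m$. Exactness is algebraic: at each place the image equals the kernel. Boxes: for $1\le q\le m$, $\mathfrak{j}=(j^1<\cdots<j^q)$ with $1\le j^1$, $j^q\le m$, and $\mathfrak{b}=(b^1,\dots,b^q)\in\mathbb{N}^q$, the box $\mathcal{B}^{\mathfrak{b}}_{\mathfrak{j}}\subseteq\mathbb{N}^m$ is $\{(n^1,\dots,n^m)\in\mathbb{N}^m : n^{j^r}\le b^r \text{ for } r=1,\dots,q\}$. Box modules: $\mathcal{H}^{\mathfrak{b}}_{\mathfrak{j}}$ is the closed subspace of $L^2_a(\mathbb{B}^m)$ spanned by $\{e_{\mathfrak{n}}:\mathfrak{n}\in\mathcal{B}^{\mathfrak{b}}_{\mathfrak{j}}\}$, with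 $z_p$ acting by the operator $T^{\mathfrak{j},\mathfrak{b}}_{z_p}$ with $T^{\mathfrak{j},\mathfrak{b}}_{z_p}(e_{\mathfrak{n}})=z_pe_{\mathfrak{n}}$ if $(n^1,\dots,n^p+1,\dots,n^m)\in\mathcal{B}^{\mathfrak{b}}_{\mathfrak{j}}$, and $T^{\mathfrak{j},\mathfrak{b}}_{z_p}(e_{\mathfrak{n}})=0$ otherwise. Direct sums carry the componentwise action. *)

(* Defs.v *)
From HB Require Import structures.
From mathcomp Require Import all_boot all_order all_algebra.
From mathcomp Require Import all_classical all_reals all_analysis.
From mathcomp Require Import complex.
(* The notations of mpoly clash with those of mathcomp-analysis. *)
From mathcomp Require Import (coercions, canonicals) mpoly.

Set Implicit Arguments.
Unset Strict Implicit.
Unset Printing Implicit Defensive.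

Import Order.TTheory GRing.Theory Num.Theory.
Import numFieldNormedType.Exports.

Local Open Scope classical_set_scope.
Local Open Scope ring_scope.
Local Open Scope complex_scope.

(** * Hilbert modules *)

(* A subset of an ambient complex vector space together with a candidate inner
   product; is_hilbert says that the subset is a Hilbert space. *)
Record ispace (R : realType) := ISpace {
  is_sort :> lmodType R[i];
  is_dom : set is_sort;
  inner : is_sort -> is_sort -> R[i] }.

Definition inorm (R : realType) (H : ispace R) (x : H) : R :=
  Num.sqrt (complex.Re (inner x x)).

Definition is_cauchy (R : realType) (H : ispace R) (u : nat -> H) : Prop :=
  forall e : R, 0 < e -> exists N, forall p q, (N <= p)%N -> (N <= q)%N ->
    inorm (u p - u q) < e.

Definition converges_to (R : realType) (H : ispace R) (u : nat -> H) (x : H) :=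
  forall e : R, 0 < e -> exists N, forall n, (N <= n)%N -> inorm (u n - x) < e.

Definition is_hilbert (R : realType) (H : ispace R) : Prop :=
  [/\ is_dom (0 : H) /\
        (forall (a : R[i]) (x y : H), is_dom x -> is_dom y -> is_dom (a *: x + y)),
      (forall (a : R[i]) (x y z : H), is_dom x -> is_dom y -> is_dom z ->
        inner (a *: x + y) z = a * inner x z + inner y z),
      (forall x y : H, is_dom x -> is_dom y -> inner y x = conjc (inner x y)),
      (forall x : H, is_dom x -> x != 0 -> 0 < inner x x) &
      (forall u : nat -> H, (forall n, is_dom (u n)) -> is_cauchy u ->
        exists2 x : H, is_dom x & converges_to u x)].

Definition bounded_linear (R : realType) (H K : ispace R) (f : H -> K) : Prop :=
  [/\ (forall x : H, is_dom x -> is_dom (f x)),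
      (forall (a : R[i]) (x y : H), is_dom x -> is_dom y ->
        f (a *: x + y) = a *: f x + f y) &
      (exists M : R, forall x : H, is_dom x -> inorm (f x) <= M * inorm x)].

Definition lin_span (R : realType) (V : lmodType R[i]) (S : set V) : set V :=
  [set x | exists (n : nat) (c : 'I_n -> R[i]) (v : 'I_n -> V),
     (forall i, S (v i)) /\ x = \sum_(i < n) c i *: v i].

Definition closure_in (R : realType) (H : ispace R) (S : set H) : set H :=
  [set x | is_dom x /\
     forall e : R, 0 < e -> exists y : H, S y /\ inorm (x - y) < e].

Definition subspace (R : realType) (H : ispace R) (S : set H) : ispace R :=
  ISpace S (@inner R H).

(* A representation of C[z_1, ..., z_m] amounts to the m commuting operators
   by which the variables act. *)
Record hmodule (R : realType) (m : nat) := HModule {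
  hm_space :> ispace R;
  hm_act : 'I_m -> hm_space -> hm_space }.

Definition is_hilbert_module (R : realType) (m : nat) (M : hmodule R m) : Prop :=
  [/\ is_hilbert M,
      (forall p : 'I_m, @bounded_linear R M M (hm_act p)) &
      (forall (p q : 'I_m) (x : M), is_dom x ->
        hm_act p (hm_act q x) = hm_act q (hm_act p x))].

Definition module_morphism (R : realType) (m : nat) (M N : hmodule R m)
    (f : M -> N) : Prop :=
  forall (p : 'I_m) (x : M), is_dom x -> f (hm_act p x) = hm_act p (f x).

Definition bounded_morphism (R : realType) (m : nat) (M N : hmodule R m)
    (f : M -> N) : Prop :=
  bounded_linear f /\ module_morphism f.

Definition mor_ker (R : realType) (m : nat) (M N : hmodule R m) (f : M -> N) :
  set M := [set x | is_dom x /\ f x = 0].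

Definition mor_im (R : realType) (m : nat) (M N : hmodule R m) (f : M -> N) :
  set N := f @` [set x | is_dom x].

Definition submodule (R : realType) (m : nat) (M : hmodule R m) (S : set M) :
  hmodule R m := @HModule R m (subspace S) (@hm_act R m M).

(** * The Bergman space of the unit ball of C^m *)

Notation Cn R m := ('rV[(R[i])^o]_m).

Definition in_ball (R : realType) (m : nat) (z : Cn R m) : bool :=
  \sum_(i < m) ComplexField.Normc.normc (z 0 i) ^+ 2 < 1.

Record mspace (R : realType) := MSpace {
  ms_disp : measure_display;
  ms_type : measurableType ms_disp;
  ms_meas : {sigma_finite_measure set ms_type -> \bar R} }.

(* A copy of m1 \x m2 that carries the sigma-finite structure: the library's
   canonical instances only infer it for subprobabilities. *)
Section sigma_finite_product.
Local Open Scope ereal_scope.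
Context (R : realType) (d1 d2 : measure_display).
Context (T1 : measurableType d1) (T2 : measurableType d2).
Variable m1 : {sigma_finite_measure set T1 -> \bar R}.
Variable m2 : {sigma_finite_measure set T2 -> \bar R}.

Definition sfprod : set (T1 * T2)%type -> \bar R := m1 \x m2.

HB.instance Definition _ := Measure.on sfprod.

Lemma sfprod_sigma_finite : sigma_finite setT sfprod.
Proof.
have /sigma_finiteP[F [TF ndF Foo]] := sigma_finiteT m1.
have /sigma_finiteP[G [TG ndG Goo]] := sigma_finiteT m2.
exists (fun n => F n `*` G n).
  rewrite -setXTT TF TG predeqE => -[x y]; split.
    move=> [/= [n _ Fnx] [k _ Gky]]; exists (maxn n k) => //; split.
    - by move: x Fnx; exact/subsetPset/ndF/leq_maxl.
    - by move: y Gky; exact/subsetPset/ndG/leq_maxr.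
  by move=> [n _ []/= ? ?]; split; exists n.
move=> k; have [? ?] := Foo k; have [? ?] := Goo k.
split; first exact: measurableX.
by rewrite /sfprod product_measure1E// lte_mul_pinfty// ge0_fin_numE.
Qed.

HB.instance Definition _ :=
  Measure_isSigmaFinite.Build _ _ _ sfprod sfprod_sigma_finite.

End sigma_finite_product.

Definition mspace_prod (R : realType) (E F : mspace R) : mspace R :=
  @MSpace R _ (ms_type E * ms_type F)%type (sfprod (ms_meas E) (ms_meas F)).

Definition lebesgueR (R : realType) : mspace R :=
  @MSpace R _ (measurableTypeR R) (@lebesgue_measure R).

(* Lebesgue measure on C^m, carried by (R * R) * ( ... * ((R * R) * unit)). *)
Fixpoint lebesgueCn (R : realType) (m : nat) : mspace R :=
  if m is n.+1 then
    mspace_prod (mspace_prod (lebesgueR R) (lebesgueR R)) (lebesgueCn R n)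
  else @MSpace R _ unit (@dirac _ unit tt R).

Fixpoint coordinates (R : realType) (m : nat) :
    ms_type (lebesgueCn R m) -> Cn R m :=
  match m return ms_type (lebesgueCn R m) -> Cn R m with
  | n.+1 => fun t => \row_(i < n.+1)
      (if unlift ord0 i is Some j then coordinates t.2 0 j
       else t.1.1 +i* t.1.2)
  | 0 => fun=> 0
  end.

Definition coord_ball (R : realType) (m : nat) : set (ms_type (lebesgueCn R m)) :=
  [set t | in_ball (coordinates t)].

Definition ball_volume (R : realType) (m : nat) : R :=
  fine (ms_meas (lebesgueCn R m) (@coord_ball R m)).

(* Elements of the Bergman space are extended by 0 outside the ball, so that
   functions that agree on the ball are equal. *)
Definition bergman_set (R : realType) (m : nat) : set (Cn R m -> (R[i])^o) :=
  [set f : Cn R m -> (R[i])^o |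
    [/\ (forall z : Cn R m, in_ball z -> differentiable f z),
        (forall z : Cn R m, ~~ in_ball z -> f z = 0) &
        (\int[ms_meas (lebesgueCn R m)]_(t in @coord_ball R m)
           (ComplexField.Normc.normc (f (coordinates t)) ^+ 2)%:E < +oo)%E]].

Definition bergman_inner (R : realType) (m : nat) (f g : Cn R m -> (R[i])^o) :
    R[i] :=
  let h := fun t : ms_type (lebesgueCn R m) =>
    (f (coordinates t) : R[i]) * conjc (g (coordinates t)) in
  (((ball_volume R m)^-1)%:C)%C *
  (Rintegral (ms_meas (lebesgueCn R m)) (@coord_ball R m)
     (fun t => complex.Re (h t)) +i*
   Rintegral (ms_meas (lebesgueCn R m)) (@coord_ball R m)
     (fun t => complex.Im (h t)))%C.

Definition bergman_space (R : realType) (m : nat) : ispace R :=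
  ISpace (@bergman_set R m) (@bergman_inner R m).

Definition coord_mul (R : realType) (m : nat) (p : 'I_m)
    (f : Cn R m -> (R[i])^o) : Cn R m -> (R[i])^o :=
  fun z => z 0 p * f z.

Definition bergman_module (R : realType) (m : nat) : hmodule R m :=
  @HModule R m (bergman_space R m) (@coord_mul R m).

Definition on_ball (R : realType) (m : nat) (f : Cn R m -> (R[i])^o) :
    Cn R m -> (R[i])^o :=
  fun z => if in_ball z then f z else 0.

Definition omega0 (R : realType) (m : nat) (n : mpoly.multinom m) : R :=
  ((\prod_(i < m) (n i)`!) * m`!)%N%:R / (((\sum_(i < m) n i) + m)`!)%N%:R.

Definition e_ (R : realType) (m : nat) (n : mpoly.multinom m) :
    Cn R m -> (R[i])^o :=
  on_ball (fun z =>
    (\prod_(i < m) z 0 i ^+ n i) / ((Num.sqrt (omega0 R n))%:C)%C).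

Arguments e_ R {m} n.

(** * Ideals generated by monomials *)

Definition monomial_ideal (R : realType) (m l : nat)
    (alpha : 'I_l -> mpoly.multinom m) : set (mpoly.mpoly m R[i]) :=
  [set f | exists g : 'I_l -> mpoly.mpoly m R[i],
     f = \sum_(i < l) g i * mpoly.mpolyX R[i] (alpha i)].

Definition poly_on_ball (R : realType) (m : nat) (f : mpoly.mpoly m R[i]) :
    Cn R m -> (R[i])^o :=
  on_ball (fun z => mpoly.meval (fun i => z 0 i : R[i]) f).

Definition ideal_closure (R : realType) (m : nat) (I : set (mpoly.mpoly m R[i])) :
    hmodule R m :=
  submodule (M := bergman_module R m)
    (closure_in (H := bergman_space R m) (@poly_on_ball R m @` I)).

Arguments monomial_ideal R {m l} alpha.

(** * Boxes and box modules *)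

(* The indices j^1 < ... < j^q are shifted so that they start at 0. *)
Record box (m : nat) := Box {
  box_q : nat;
  box_j : 'I_box_q -> 'I_m;
  box_b : 'I_box_q -> nat;
  box_q_gt0 : (0 < box_q)%N;
  box_j_incr : forall r s : 'I_box_q, (r < s)%N -> (box_j r < box_j s)%N }.

Definition in_box (m : nat) (B : box m) (n : mpoly.multinom m) : bool :=
  [forall r : 'I_(box_q B), (n (box_j r) <= box_b r)%N].

Definition box_space (R : realType) (m : nat) (B : box m) : ispace R :=
  subspace (H := bergman_space R m)
    (closure_in (H := bergman_space R m)
      (lin_span [set e_ R n | n in [set n | in_box B n]])).

(* A bounded operator is determined on the box space by its values on the e_n,
   so this specifies the operator T^{j,b}_{z_p}. *)
Definition is_box_shift (R : realType) (m : nat) (B : box m) (p : 'I_m)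
    (T : box_space R B -> box_space R B) : Prop :=
  bounded_linear T /\
  forall n : mpoly.multinom m, in_box B n ->
    T (e_ R n) =
      if in_box B (mpoly.mnm_add n (mpoly.mnm1 p)) then coord_mul p (e_ R n)
      else 0.

Definition box_module (R : realType) (m : nat) (B : box m)
    (T : 'I_m -> box_space R B -> box_space R B) : hmodule R m :=
  HModule T.

(* Finite direct sums of box modules; all summands live in the same ambient
   function space, and s = 0 gives the zero module. *)
Definition box_sum (R : realType) (m s : nat) (B : 'I_s -> box m)
    (T : forall i, 'I_m -> box_space R (B i) -> box_space R (B i)) :
    hmodule R m :=
  @HModule R m
    (@ISpace R ('I_s -> (Cn R m -> (R[i])^o) : lmodType R[i])
      [set x | forall i, @is_dom R (box_module (T i)) (x i)]
      (fun x y => \sum_(i < s) @inner R (box_module (T i)) (x i) (y i)))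
    (fun p x i => @hm_act R m (box_module (T i)) p (x i)).

Definition bergman_like (R : realType) (m : nat) (M : hmodule R m) : Prop :=
  exists (s : nat) (B : 'I_s -> box m)
         (T : forall i, 'I_m -> box_space R (B i) -> box_space R (B i)),
    (forall i p, is_box_shift p (T i p)) /\ M = box_sum T.

(** * Resolutions *)

(* The modules A_0 = L^2_a(B^m), A_1, A_2, ...; the value A 0 is not used. *)
Definition modules (R : realType) (m : nat) (A : nat -> hmodule R m) (i : nat) :
    hmodule R m :=
  if i is _.+1 then A i else bergman_module R m.

(* Main.v *)
Require Import Defs.
From HB Require Import structures.
From mathcomp Require Import all_boot all_order all_algebra.
From mathcomp Require Import all_classical all_reals all_analysis.
From mathcomp Require Import measurable_realfun.
From mathcomp Require Import complex ring lra zify.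
From mathcomp Require Import (coercions, canonicals) mpoly.

(* A monomial z^n lies outside I exactly when for every generator alpha_i some
   coordinate phi(i) satisfies n^(phi(i)) < alpha_i^(phi(i)). The maps phi thus
   cover the exponents outside I by finitely many boxes, and an intersection of
   boxes is a box. The resolution is the Cech complex of this covering: its
   i-th term is the sum over all sets of i boxes of the module of their
   intersection, and its maps are alternating sums of truncations of power
   series. On the coefficient of z^n it is the cochain complex of the full
   simplex on the boxes that contain n, which is contracted by the least of
   these boxes. Since that box depends on n only, the contraction is again a
   finite sum of truncations, hence bounded.

   For this one needs that an element of the Bergman space is determined by its
   coefficients, i.e. that the monomials form a total orthogonal family of a
   complete space. Orthogonality comes from the rotations of one coordinate;
   averaging f over the rotations by the 2^n-th roots of unity, twisted by a
   character, gives a decreasing sequence of orthogonal projections of f, whose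
   limit is the part of f that is homogeneous in that coordinate. Averages over
   the 2^n-th roots of unity also replace contour integrals in the Taylor
   expansion of functions of one variable. *)

Set Implicit Arguments.
Unset Strict Implicit.
Unset Printing Implicit Defensive.

Import Order.TTheory GRing.Theory Num.Theory.
Import numFieldNormedType.Exports.
Import ComplexField.Normc.

Local Open Scope classical_set_scope.
Local Open Scope ring_scope.
Local Open Scope complex_scope.

(** * Complex functions of one variable *)

Section normc_theory.
Variable R : realType.
Local Notation C := (R[i]).
Implicit Types x y z : C.

(** Membership in the Bergman space asks only for complex differentiability at each point of the
    ball, not for a continuous derivative, so power series must come from a Goursat argument. It is
    run on trapezoidal sums with 2^n nodes: halving a segment then halves its number of nodes, and
    the subdivision identities are exact.

    Exactness is algebraic: an element of a kernel needs a true preimage, not an approximate one.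
    The contraction must therefore be bounded, and truncation to an arbitrary set of exponents must
    be defined on the whole space.

    The analysis rests on one estimate, |f(z)|^2 times a positive constant is at most the integral
    of |f|^2. It makes the inner product definite, turns norm limits into pointwise limits and so
    gives completeness. It comes from rotations about z and Fatou's lemma; rotations preserve the
    measure because they are products of shears.

    The maps are module morphisms because boxes are closed under lowering exponents. The complex is
    augmented by the empty set of boxes, whose term is the Bergman space itself, so the first map
    obeys the same formulas as the others. *)

Lemma normcE x : `|x| = (normc x)%:C :> C.
Proof. by []. Qed.

Lemma normc_ge0 x : 0 <= normc x.
Proof. by case: x => a b /=; apply: sqrtr_ge0. Qed.

Lemma normcD x y : normc (x + y) <= normc x + normc y.
Proof. by rewrite -lecR rmorphD -!normcE ler_normD. Qed.

Lemma normcN x : normc (- x) = normc x.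
Proof. by apply: complexI; rewrite -!normcE normrN. Qed.

Lemma normcB x y : normc (x - y) = normc (y - x).
Proof. by rewrite -normcN opprB. Qed.

Lemma normcX x n : normc (x ^+ n) = normc x ^+ n.
Proof. by elim: n => [|n IH]; rewrite ?expr0 ?normc1 // !exprS normcM IH. Qed.

Lemma normc_real (a : R) : normc a%:C = `|a|.
Proof. by rewrite /normc /= expr0n addr0 sqrtr_sqr. Qed.

Lemma normc_nat n : normc (n%:R : C) = n%:R.
Proof. by apply: complexI; rewrite -normcE normr_nat rmorph_nat. Qed.

Lemma normc_eq0 x : (normc x == 0) = (x == 0).
Proof.
apply/eqP/eqP => [/eq0_normc //|->]; exact: normc0.
Qed.

Lemma normc_gt0 x : (0 < normc x) = (x != 0).
Proof. by rewrite lt_def normc_ge0 andbT normc_eq0. Qed.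

Lemma normc_sum (I : Type) (r : seq I) (P : pred I) (F : I -> C) :
  normc (\sum_(i <- r | P i) F i) <= \sum_(i <- r | P i) normc (F i).
Proof.
elim/big_rec2: _ => [|i a b _ ab]; first by rewrite normc0.
by apply: (le_trans (normcD _ _)); rewrite lerD2l.
Qed.

Lemma normc_conj x : normc (conjc x) = normc x.
Proof. by case: x => a b /=; rewrite sqrrN. Qed.

Lemma normc_Re x : `|complex.Re x| <= normc x.
Proof.
case: x => a b /=; rewrite -sqrtr_sqr ler_sqrt ?addr_ge0 ?sqr_ge0 //.
by rewrite lerDl sqr_ge0.
Qed.

Lemma normc_Im x : `|complex.Im x| <= normc x.
Proof.
case: x => a b /=; rewrite -sqrtr_sqr ler_sqrt ?addr_ge0 ?sqr_ge0 //.
by rewrite lerDr sqr_ge0.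
Qed.

Lemma normc_le_ReIm x : normc x <= `|complex.Re x| + `|complex.Im x|.
Proof.
case: x => a b /=; rewrite -(@ler_pXn2r _ 2) ?nnegrE ?addr_ge0 ?sqrtr_ge0 //.
rewrite sqr_sqrtr ?addr_ge0 ?sqr_ge0 // sqrrD !real_normK ?num_real //.
by rewrite addrAC lerDl mulrn_wge0 // mulr_ge0.
Qed.

(** The order of [R[i]] compares only numbers with equal imaginary parts, so a positive e is real.
    This turns the epsilons of normed modules over [R[i]] into real ones. *)
Lemma lt0c_real (e : C) : 0 < e -> 0 < complex.Re e /\ e = (complex.Re e)%:C.
Proof. by case: e => a b; rewrite ltcE /= => /andP[/eqP -> ->]. Qed.

End normc_theory.

(** * Trapezoidal sums along segments and parallelograms *)

Section trapezoid.
Variable R : realType.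
Local Notation C := (R[i]).
Implicit Types (F G : C -> C) (w v a b : C) (M : nat).

(* The trapezoidal approximation of the integral of [F] over the segment
   from [w] to [w + v]. *)
Definition edge F M w v : C :=
  v / M%:R * \sum_(i < M) (F (w + v * (i%:R / M%:R)) +
                           F (w + v * (i.+1%:R / M%:R))) / 2.

(** The contour sum around the parallelogram with vertices w, w + a, w + a + b, w + b. *)
Definition bdry F M w a b : C :=
  edge F M w a + edge F M (w + a) b - edge F M (w + b) a - edge F M w b.

Lemma edgeB F G M w v :
  edge (fun z => F z - G z) M w v = edge F M w v - edge G M w v.
Proof.
rewrite /edge -mulrBr -sumrB; congr (_ * _); apply: eq_bigr => i _.
by rewrite -mulrBl; congr (_ / _); ring.
Qed.

(** The trapezoidal rule is exact on affine functions. Their contour sums therefore vanish for every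
    M, before any limit is taken. *)
Lemma edge_affine (A B : C) M w v : (0 < M)%N ->
  edge (fun z => A + B * z) M w v = v * (A + B * (w + v / 2)).
Proof.
move=> M0; have M0' : (M%:R : C) != 0 by rewrite pnatr_eq0 -lt0n.
rewrite /edge (eq_bigr (fun i : 'I_M =>
    (A + B * w) + B * v / (2 * M%:R) * (i.*2.+1)%:R)); last first.
  move=> i _; rewrite -(addn1 i.*2) -muln2 natrD natrM -(addn1 i) natrD.
  by field.
rewrite big_split /= sumr_const card_ord -mulr_sumr -natr_sum.
have -> : (\sum_(i < M) i.*2.+1 = M * M)%N.
  elim: {M0 M0'} M => [|M IH]; first by rewrite big_ord0.
  by rewrite big_ord_recr /= IH; lia.
rewrite natrM -[_ *+ M]mulr_natr; by field.
Qed.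

Lemma le_edge F M w v c : (0 < M)%N ->
  (forall t : R, 0 <= t <= 1 -> normc (F (w + v * t%:C)) <= c) ->
  normc (edge F M w v) <= normc v * c.
Proof.
move=> M0 Fc; have M0' : (M%:R : R) != 0 by rewrite pnatr_eq0 -lt0n.
rewrite /edge !normcM normcV normc_nat -mulrA ler_wpM2l ?normc_ge0 //.
rewrite ler_pdivrMl ?ltr0n //; apply: (le_trans (normc_sum _ _ _)).
apply: (@le_trans _ _ (\sum_(i < M) c)); last first.
  by rewrite sumr_const card_ord mulr_natl.
apply: ler_sum => i _.
have Fi (k : nat) : (k <= M)%N -> normc (F (w + v * (k%:R / M%:R))) <= c.
  move=> kM; rewrite -[k%:R / _](_ : (k%:R / M%:R)%:C = _); last first.
    by rewrite rmorphM fmorphV !rmorph_nat.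
  by apply: Fc; rewrite divr_ge0 //= ler_pdivrMr ?ltr0n // mul1r ler_nat.
rewrite normcM normcV normc_nat ler_pdivrMr //.
apply: (le_trans (normcD _ _)); rewrite mulr_natr mulr2n lerD // Fi //.
exact: ltnW.
Qed.

(** Doubling the nodes while halving the segment keeps all nodes in place, so the identity is exact.
    This is the reason for working with 2^n nodes. *)
Lemma edge_split F M w v : (0 < M)%N ->
  edge F (M + M) w v = edge F M w (v / 2) + edge F M (w + v / 2) (v / 2).
Proof.
move=> M0; have M0' : (M%:R : C) != 0 by rewrite pnatr_eq0 -lt0n.
have MM0 : (M%:R + M%:R : C) != 0.
  by rewrite -natrD pnatr_eq0 addn_eq0 negb_and -lt0n M0.
have -> : edge F (M + M) w v = v / 2 / M%:R *
    \sum_(i < M + M) (F (w + v * (i%:R / (M + M)%:R)) +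
                           F (w + v * (i.+1%:R / (M + M)%:R))) / 2.
  by rewrite /edge; congr (_ * _); rewrite natrD; field; rewrite ?M0' ?MM0.
rewrite /edge big_split_ord /= mulrDr.
congr (_ * _ + _ * _); apply: eq_bigr => i _; congr ((F _ + F _) / _).
- by rewrite natrD; field; rewrite ?M0' ?MM0.
- by rewrite natrD; field; rewrite ?M0' ?MM0.
- by rewrite !natrD; field; rewrite ?M0' ?MM0.
- by rewrite -addnS !natrD; field; rewrite ?M0' ?MM0.
Qed.

(** The sides interior to the large parallelogram are run through twice in opposite directions and
    cancel. *)
Lemma bdry_split F M w a b : (0 < M)%N ->
  bdry F (M + M) w a b =
    bdry F M w (a / 2) (b / 2) + bdry F M (w + a / 2) (a / 2) (b / 2) +
    bdry F M (w + b / 2) (a / 2) (b / 2) +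
    bdry F M (w + a / 2 + b / 2) (a / 2) (b / 2).
Proof.
move=> M0; rewrite /bdry !edge_split //.
have -> : w + a / 2 + a / 2 = w + a by field.
have -> : w + b / 2 + b / 2 = w + b by field.
have -> : w + a / 2 + b / 2 + a / 2 = w + a + b / 2 by field.
have -> : w + a / 2 + b / 2 + b / 2 = w + b + a / 2 by field.
have -> : w + b / 2 + a / 2 = w + a / 2 + b / 2 by field.
ring.
Qed.

End trapezoid.

(** * Complex differentiability in terms of real-valued norms *)

Section complex_differentiability.
Variables (R : realType).
Local Notation C := (R[i]).

(** Norms of modules over [R[i]] take values in [R[i]]; this is the same number as an element of
    R. *)
Definition rnorm (V : normedModType C) (x : V) : R := complex.Re `|x|.

Lemma rnormE (V : normedModType C) (x : V) : `|x| = (rnorm x)%:C.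
Proof.
rewrite /rnorm; have := normr_ge0 x; case: `|x| => a b.
by rewrite lecE /= => /andP[/eqP -> _].
Qed.

Lemma rnorm_ge0 (V : normedModType C) (x : V) : 0 <= rnorm x.
Proof. by rewrite -lecR -rnormE normr_ge0. Qed.

Lemma nbhs_rnormP (V : normedModType C) (x : V) (P : set V) :
  nbhs x P <-> exists2 d : R, 0 < d & forall h, rnorm h < d -> P (x + h).
Proof.
split=> [/nbhs_ballP[e /= e0 xe]|[d d0 xd]].
  have [e0' ee] := lt0c_real e0; exists (complex.Re e) => // h hd.
  apply: xe; rewrite -ball_normE /ball_ /= opprD addrA subrr sub0r normrN.
  by rewrite rnormE ee ltcR.
apply/nbhs_ballP; exists d%:C => /=; first by rewrite ltcR.
move=> y; rewrite -ball_normE /ball_ /= => xy.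
rewrite -[y](subrKC x); apply: xd.
by rewrite -ltcR -rnormE distrC.
Qed.

Lemma differentiable_rnorm (V W : normedModType C) (f : V -> W) z :
  differentiable f z -> forall e : R, 0 < e ->
  exists2 d : R, 0 < d & forall h, rnorm h < d ->
    rnorm (f (z + h) - f z - 'd f z h) <= e * rnorm h.
Proof.
move=> /diff_locally/eqaddoP fz e e0.
have /nbhs_rnormP[d d0 fd] := fz e%:C ltac:(by rewrite ltcR).
exists d => // h /fd; rewrite add0r /= !fctE /= !rnormE -rmorphM lecR.
by rewrite [h + z]addrC opprD addrA.
Qed.

Lemma rnorm_differentiable (V W : normedModType C) (f : V -> W)
    (L : {linear V -> W}) z : continuous L ->
  (forall e : R, 0 < e ->
    exists2 d : R, 0 < d & forall h, rnorm h < d ->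
    rnorm (f (z + h) - f z - L h) <= e * rnorm h) ->
  differentiable f z.
Proof.
move=> Lc fL; have fE : f \o shift z = cst (f z) + L +o_ 0 id.
  apply/eqaddoP => eps /lt0c_real[e0 ->]; have [d d0 fd] := fL _ e0.
  apply/nbhs_rnormP; exists d => // h /fd; rewrite add0r /= !fctE /=.
  by rewrite !rnormE -rmorphM lecR [h + z]addrC opprD addrA.
by apply/diff_locallyP; rewrite (diff_unique Lc fE); split.
Qed.

Lemma rnormc (x : C^o) : rnorm x = normc (x : C).
Proof. by []. Qed.

Definition cderivable (g : C -> C) (z : C) : Prop :=
  differentiable (g : C^o -> C^o) (z : C^o).

(** A linear endomorphism of [C^o] is multiplication by its value at 1, which is the B given
    here. *)
Lemma cderivable_normc (g : C -> C) z : cderivable g z ->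
  exists B, forall e : R, 0 < e ->
  exists2 d : R, 0 < d & forall h : C, normc h < d ->
    normc (g (z + h) - g z - B * h) <= e * normc h.
Proof.
move=> gz; exists ('d (g : C^o -> C^o) (z : C^o) 1) => e e0.
have [d d0 gd] := differentiable_rnorm gz e0; exists d => // h /gd.
have : 'd (g : C^o -> C^o) (z : C^o) (h *: (1 : C^o)) =
  h *: 'd (g : C^o -> C^o) (z : C^o) 1 by rewrite linearZ.
by rewrite -[h *: 1]/(h * 1) mulr1 => ->; rewrite -[h *: _]/(h * _) mulrC.
Qed.

Lemma normc_cderivable (g : C -> C) (z B : C) :
  (forall e : R, 0 < e ->
  exists2 d : R, 0 < d & forall h : C, normc h < d ->
    normc (g (z + h) - g z - B * h) <= e * normc h) ->
  cderivable g z.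
Proof.
move=> gB; apply: (@rnorm_differentiable C^o C^o g ( *:%R B) z).
  exact: scaler_continuous.
by move=> e /gB.
Qed.

Lemma cderivable_normc_continuous (g : C -> C) z : cderivable g z ->
  forall e : R, 0 < e -> exists2 d : R, 0 < d & forall h : C, normc h < d ->
    normc (g (z + h) - g z) < e.
Proof.
move=> /differentiable_continuous gz e e0.
have e0' : 0 < e%:C by rewrite ltcR.
have /cvgrPdist_lt/(_ _ e0')/nbhs_rnormP[d d0 gd] := gz.
by exists d => // h /gd; rewrite distrC normcE ltcR.
Qed.

End complex_differentiability.

(** * Goursat's theorem *)

Section goursat.
Variable R : realType.
Local Notation C := (R[i]).

(** The right ends s j + 2^-j decrease, so each of them bounds the whole sequence from above and the
    supremum lies in every interval. *)
Lemma nested_dyadic (s : nat -> R) :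
  (forall j, s j <= s j.+1 <= s j + (2 ^+ j.+1)^-1) ->
  exists x, forall j, s j <= x <= s j + (2 ^+ j)^-1.
Proof.
move=> sP.
have smono j k : s j <= s (j + k)%N.
  elim: k => [|k IH]; first by rewrite addn0.
  by rewrite addnS (le_trans IH) //; have /andP[] := sP (j + k)%N.
have sub j k : s (j + k)%N + (2 ^+ (j + k))^-1 <= s j + (2 ^+ j)^-1.
  elim: k => [|k]; first by rewrite addn0.
  apply: le_trans; rewrite addnS; have /andP[_] := sP (j + k)%N.
  have : 0 < (2 ^+ (j + k) : R)^-1 by rewrite invr_gt0 exprn_gt0.
  rewrite exprS invfM; lra.
have sle j k : s k <= s j + (2 ^+ j)^-1.
  have [jk|/ltnW kj] := leqP j k.
    rewrite -(subnKC jk); apply: le_trans (sub j (k - j)%N).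
    by rewrite lerDl invr_ge0 exprn_ge0.
  apply: (@le_trans _ _ (s j)); first by rewrite -(subnKC kj).
  by rewrite lerDl invr_ge0 exprn_ge0.
have supS : has_sup (range s).
  split; first by exists (s 0%N); exists 0%N.
  by exists (s 0%N + (2 ^+ 0)^-1) => _ [k _ <-].
exists (sup (range s)) => j; apply/andP; split.
  by apply: ub_le_sup; [case: supS | exists j].
by apply: ge_sup => [|_ [k _ <-]]; [case: supS | exact: sle].
Qed.

(** Subtract the affine part of F at w0, whose contour sum is 0. The remainder is at most eta times
    the distance to w0, hence at most eta P l with P = |a| + |b|, on a contour of length 2 P l. *)
Lemma bdry_cderivable (F : C -> C) (w0 a b : C) :
  cderivable F w0 -> forall e : R, 0 < e ->
  exists2 d : R, 0 < d & forall (M : nat) w l, (0 < M)%N -> 0 < l < d ->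
    (forall s t : R, 0 <= s <= 1 -> 0 <= t <= 1 ->
      normc (w + a * (l * s)%:C + b * (l * t)%:C - w0) <= (normc a + normc b) * l) ->
    normc (bdry F M w (a * l%:C) (b * l%:C)) <= e * l ^+ 2.
Proof.
move=> /cderivable_normc[B FB] e e0.
pose P := normc a + normc b; have P0 : 0 <= P by rewrite addr_ge0 ?normc_ge0.
have den0 : 0 < 2 * P ^+ 2 + 1 by rewrite ltr_wpDl // mulr_ge0 ?sqr_ge0.
(* Length times remainder is 2 P^2 eta l^2, which this choice keeps below e l^2; the summand 1
   covers P = 0. *)
pose eta := e / (2 * P ^+ 2 + 1); have eta0 : 0 < eta by rewrite divr_gt0.
have [d d0 Fd] := FB _ eta0.
have P1 : 0 < P + 1 by rewrite ltr_wpDl.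
exists (d / (P + 1)) => [|M w l M0 /andP[l0 ld] near_w0]; first by rewrite divr_gt0.
have Pl : P * l < d.
  move: ld; rewrite ltr_pdivlMr // => ld; apply: le_lt_trans ld.
  by rewrite mulrC ler_wpM2l ?(ltW l0) // lerDl.
pose A0 := F w0 - B * w0.
pose G z := F z - (A0 + B * z).
have Gz z : normc (z - w0) <= P * l -> normc (G z) <= eta * (P * l).
  move=> zl; have := Fd _ (le_lt_trans zl Pl); rewrite subrKC.
  have -> : F z - F w0 - B * (z - w0) = G z by rewrite /G /A0; ring.
  by move=> /le_trans; apply; rewrite ler_wpM2l // ltW.
have -> : bdry F M w (a * l%:C) (b * l%:C) = bdry G M w (a * l%:C) (b * l%:C).
  by rewrite /bdry !(edgeB F (fun z => A0 + B * z)) !edge_affine //; field.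
have I01 : (0 <= (0 : R) <= 1) /\ (0 <= (1 : R) <= 1) by rewrite !lexx !ler01.
have hor w' : (forall s, 0 <= s <= 1 -> normc (w' + a * (l * s)%:C - w0) <= P * l) ->
    normc (edge G M w' (a * l%:C)) <= normc a * l * (eta * (P * l)).
  move=> near_w'; apply: (le_trans (le_edge (c := eta * (P * l)) M0 _)).
    by move=> t t01; rewrite -mulrA -rmorphM; apply/Gz/near_w'.
  by rewrite normcM normc_real (gtr0_norm l0).
have ver w' : (forall s, 0 <= s <= 1 -> normc (w' + b * (l * s)%:C - w0) <= P * l) ->
    normc (edge G M w' (b * l%:C)) <= normc b * l * (eta * (P * l)).
  move=> near_w'; apply: (le_trans (le_edge (c := eta * (P * l)) M0 _)).
    by move=> t t01; rewrite -mulrA -rmorphM; apply/Gz/near_w'.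
  by rewrite normcM normc_real (gtr0_norm l0).
have le_normc_bdry : normc (bdry G M w (a * l%:C) (b * l%:C)) <=
    normc (edge G M w (a * l%:C)) + normc (edge G M (w + a * l%:C) (b * l%:C)) +
    normc (edge G M (w + b * l%:C) (a * l%:C)) + normc (edge G M w (b * l%:C)).
  rewrite /bdry; apply: (le_trans (normcD _ _)); rewrite normcN lerD2r.
  apply: (le_trans (normcD _ _)); rewrite normcN lerD2r; exact: normcD.
apply: (le_trans le_normc_bdry); apply: (@le_trans _ _ (2 * P * l * (eta * (P * l)))).
  have h1 : normc (edge G M w (a * l%:C)) <= normc a * l * (eta * (P * l)).
    apply: hor => s s01; have := near_w0 s 0 s01 I01.1.
    by rewrite !mulr0 addr0.
  have h2 : normc (edge G M (w + a * l%:C) (b * l%:C)) <= normc b * l * (eta * (P * l)).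
    apply: ver => s s01; have := near_w0 1 s I01.2 s01.
    by rewrite !mulr1.
  have h3 : normc (edge G M (w + b * l%:C) (a * l%:C)) <= normc a * l * (eta * (P * l)).
    apply: hor => s s01; have := near_w0 s 1 s01 I01.2.
    by rewrite !mulr1 (addrAC w).
  have h4 : normc (edge G M w (b * l%:C)) <= normc b * l * (eta * (P * l)).
    apply: ver => s s01; have := near_w0 0 s I01.1 s01.
    by rewrite !mulr0 addr0.
  rewrite /P in h1 h2 h3 h4 *; lra.
have -> : 2 * P * l * (eta * (P * l)) = eta * (2 * P ^+ 2) * l ^+ 2 by ring.
rewrite ler_wpM2r ?sqr_ge0 // /eta -mulrA ler_piMr ?(ltW e0) // ler_pdivrMl //.
by rewrite mulr1 lerDl.
Qed.

(** Bisection by contradiction: a contour sum that is too large relative to the area passes this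
    defect to one of the four quarters. The quarters shrink to a point, where differentiability
    forbids it. *)
Lemma goursat (F : C -> C) (w a b : C) :
  (forall s t : R, 0 <= s <= 1 -> 0 <= t <= 1 ->
     cderivable F (w + a * s%:C + b * t%:C)) ->
  forall e : R, 0 < e -> \forall n \near \oo, normc (bdry F (2 ^ n) w a b) <= e.
Proof.
move=> Fdiff e e0; apply: contrapT => nnear.
pose pt (p : R * R) : C := w + a * p.1%:C + b * p.2%:C.
pose l j : R := (2 ^+ j)^-1.
have l0 j : 0 < l j by rewrite invr_gt0 exprn_gt0.
have lS j : l j = 2 * l j.+1 by rewrite /l exprS invfM; field.
(* The excess is required for arbitrarily large n, since each subdivision uses up one factor 2 of
   the nodes. *)
pose bad j p := forall N, exists2 n, (N <= n)%N &
  e * l j ^+ 2 < normc (bdry F (2 ^ n) (pt p) (a * (l j)%:C) (b * (l j)%:C)).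
have bad0 : bad 0%N (0, 0).
  move=> N; apply: contrapT => badN; apply: nnear; exists N => // n /= Nn.
  rewrite leNgt; apply/negP => en; apply: badN; exists n => //.
  rewrite /l expr0 invr1 expr1n mulr1 /pt /= !mulr0 !addr0 !mulr1; exact: en.
have badS j p : bad j p -> exists p', bad j.+1 p' /\
    (p.1 <= p'.1 <= p.1 + l j.+1 /\ p.2 <= p'.2 <= p.2 + l j.+1).
  move=> badjp; apply: contrapT => nobad.
  have good u v : u \in [:: 0; l j.+1] -> v \in [:: 0; l j.+1] -> exists N,
      forall n, (N <= n)%N -> normc (bdry F (2 ^ n) (pt (p.1 + u, p.2 + v))
        (a * (l j.+1)%:C) (b * (l j.+1)%:C)) <= e * l j.+1 ^+ 2.
    move=> uP vP; apply: contrapT => nogood; apply: nobad.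
    exists (p.1 + u, p.2 + v); split; last first.
      by split => /=; [move: uP|move: vP]; rewrite !inE => /orP[]/eqP ->;
        rewrite ?addr0 ?lerDl ?lexx ?(ltW (l0 _)).
    move=> N; apply: contrapT => nN; apply: nogood; exists N => n Nn.
    by rewrite leNgt; apply/negP => en; apply: nN; exists n.
  have in0 : 0 \in [:: 0; l j.+1] by rewrite !inE eqxx.
  have in1 : l j.+1 \in [:: 0; l j.+1] by rewrite !inE eqxx orbT.
  have [N1 N1P] := good _ _ in0 in0; have [N2 N2P] := good _ _ in1 in0.
  have [N3 N3P] := good _ _ in0 in1; have [N4 N4P] := good _ _ in1 in1.
  (* The sum dominates the four thresholds at once, and the successor leaves an n that is still
     above them after one halving of the nodes. *)
  have [[|n]] := badjp (N1 + N2 + N3 + N4).+1 => // Nn.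
  apply/negP; rewrite -leNgt expnS mul2n -addnn bdry_split ?expn_gt0 //.
  have half c : c * (l j)%:C / 2 = c * (l j.+1)%:C.
    by rewrite lS rmorphM /= rmorph_nat; field.
  rewrite !half.
  have -> : e * l j ^+ 2 = e * l j.+1 ^+ 2 + e * l j.+1 ^+ 2 + e * l j.+1 ^+ 2
      + e * l j.+1 ^+ 2 by rewrite (lS j); ring.
  apply: (le_trans (normcD _ _)); apply: lerD; last first.
    have -> : pt p + a * (l j.+1)%:C + b * (l j.+1)%:C =
      pt (p.1 + l j.+1, p.2 + l j.+1) by rewrite /pt /= !rmorphD; ring.
    apply: N4P; lia.
  apply: (le_trans (normcD _ _)); apply: lerD; last first.
    have -> : pt p + b * (l j.+1)%:C =
      pt (p.1 + 0, p.2 + l j.+1) by rewrite /pt /= addr0 !rmorphD; ring.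
    apply: N3P; lia.
  apply: (le_trans (normcD _ _)); apply: lerD; last first.
    have -> : pt p + a * (l j.+1)%:C =
      pt (p.1 + l j.+1, p.2 + 0) by rewrite /pt /= addr0 !rmorphD; ring.
    apply: N2P; lia.
  have -> : pt p = pt (p.1 + 0, p.2 + 0) by rewrite !addr0; case: p {badjp nobad good N1P N2P N3P N4P}.
  apply: N1P; lia.
pose next j p := xget p [set p' | bad j.+1 p' /\
    (p.1 <= p'.1 <= p.1 + l j.+1 /\ p.2 <= p'.2 <= p.2 + l j.+1)].
pose pts := fix pts j := if j is k.+1 then next k (pts k) else (0, 0).
have ptsP j : bad j (pts j).
  elim: j => [//|j /badS[p' p'P]] /=; rewrite /next.
  by case: xgetP => [_ _ []//|/(_ p')].
have ptsS j : (pts j).1 <= (pts j.+1).1 <= (pts j).1 + l j.+1 /\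
    (pts j).2 <= (pts j.+1).2 <= (pts j).2 + l j.+1.
  rewrite /= /next; have /badS[p' p'P] := ptsP j.
  by case: xgetP => [_ _ []//|/(_ p')].
have [x xP] := nested_dyadic (fun j => (ptsS j).1).
have [y yP] := nested_dyadic (fun j => (ptsS j).2).
have x01 : 0 <= x <= 1 by have := xP 0%N; rewrite /= expr0 invr1 add0r.
have y01 : 0 <= y <= 1 by have := yP 0%N; rewrite /= expr0 invr1 add0r.
have [d d0 Fd] := bdry_cderivable a b (Fdiff x y x01 y01) e0.
have [j jd] : exists j, l j < d.
  have /archi_boundP := ltW (divr_gt0 ltr01 d0).
  set j := Num.bound _ => jd; exists j.
  rewrite /l -[d]invrK ltf_pV2 ?posrE ?invr_gt0 ?exprn_gt0 //.
  rewrite -[d^-1]mul1r (lt_le_trans jd) // -natrX ler_nat ltnW // ltn_expl //.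
have [n _] := ptsP j 0%N; apply/negP; rewrite -leNgt.
apply: Fd; rewrite ?expn_gt0 ?l0 ?jd // => s t /andP[s0 s1] /andP[t0 t1].
have -> : pt (pts j) + a * (l j * s)%:C + b * (l j * t)%:C -
    (w + a * x%:C + b * y%:C) =
    a * ((pts j).1 + l j * s - x)%:C + b * ((pts j).2 + l j * t - y)%:C.
  by rewrite /pt !(rmorphD, rmorphM, rmorphN) /=; ring.
have unit_l u v (r : R) : 0 <= r <= 1 -> u <= v <= u + l j -> `|u + l j * r - v| <= l j.
  move=> /andP[r0 r1] /andP[uv vu]; rewrite ler_norml.
  have := l0 j; have : l j * r <= l j by rewrite ler_piMr // ltW.
  have : 0 <= l j * r by rewrite mulr_ge0 // ltW.
  by move=> *; apply/andP; split; lra.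
rewrite mulrDl (le_trans (normcD _ _)) // !normcM !normc_real.
by apply: lerD; rewrite ler_wpM2l ?normc_ge0 // unit_l ?s0 ?t0.
Qed.

End goursat.

Arguments normc : simpl never.

Section cderivable_theory.
Variable R : realType.
Local Notation C := (R[i]).
Implicit Types (f g : C -> C) (z : C).

Lemma cderivable_cst (c : C) z : cderivable (fun=> c) z.
Proof. exact: differentiable_cst. Qed.

Lemma cderivable_id z : cderivable id z.
Proof. by rewrite /cderivable; apply: ex_diff. Qed.

Lemma cderivableB f g z : cderivable f z -> cderivable g z ->
  cderivable (fun x => f x - g x) z.
Proof. exact: differentiableB. Qed.

Lemma cderivableM f g z : cderivable f z -> cderivable g z ->
  cderivable (fun x => f x * g x) z.
Proof. exact: differentiableM. Qed.

Lemma cderivableX f n z : cderivable f z -> cderivable (fun x => f x ^+ n) z.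
Proof.
move=> fz; elim: n => [|n IH]; first exact: cderivable_cst.
have -> : (fun x => f x ^+ n.+1) = (fun x => f x * f x ^+ n).
  by apply/funext => x; rewrite exprS.
exact: cderivableM.
Qed.

Lemma cderivableV f z : f z != 0 -> cderivable f z ->
  cderivable (fun x => (f x)^-1) z.
Proof. by move=> fz0 fz; apply: differentiableV. Qed.

Lemma cderivable_comp f g z : cderivable f z -> cderivable g (f z) ->
  cderivable (fun x => g (f x)) z.
Proof. exact: differentiable_comp. Qed.

Lemma cderivable_near f g z (d : R) : 0 < d ->
  (forall h, normc h < d -> f (z + h) = g (z + h)) ->
  cderivable f z -> cderivable g z.
Proof.
move=> d0 fg /cderivable_normc[B fB]; apply: (@normc_cderivable _ _ _ B) => e /fB[d' d'0 fd'].
exists (Num.min d d') => [|h]; first by rewrite lt_min d0.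
rewrite lt_min => /andP[hd hd']; rewrite -fg // -(addr0 z) -fg ?normc0 // addr0.
exact: fd'.
Qed.

End cderivable_theory.

(** * The complex exponential *)

Section cexp.
Variable R : realType.
Local Notation C := (R[i]).

Definition cis (t : R) : C := cos t +i* sin t.

Definition cexp (w : C) : C := (expR (complex.Re w))%:C * cis (complex.Im w).

Lemma cis0 : cis 0 = 1.
Proof. by rewrite /cis cos0 sin0. Qed.

Lemma cisD s t : cis (s + t) = cis s * cis t.
Proof.
rewrite /cis cosD sinD; apply/eqP; rewrite eq_complex /= eqxx /=.
by apply/eqP; ring.
Qed.

Lemma cis2pi : cis (pi *+ 2) = 1.
Proof. by rewrite /cis cos2pi sin2pi. Qed.

Lemma normc_cis t : normc (cis t) = 1.
Proof. by rewrite /normc /= cos2Dsin2 sqrtr1. Qed.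

Lemma cexpD v w : cexp (v + w) = cexp v * cexp w.
Proof.
by case: v w => [a b] [c d]; rewrite /cexp /= expRD cisD rmorphM /=; ring.
Qed.

Lemma cexp_real (x : R) : cexp x%:C = (expR x)%:C.
Proof. by rewrite /cexp /= cis0 mulr1. Qed.

Lemma cexp_imag (t : R) : cexp (0 +i* t) = cis t.
Proof. by rewrite /cexp /= expR0 mul1r. Qed.

Lemma normc_cexp w : normc (cexp w) = expR (complex.Re w).
Proof. by rewrite normcM normc_cis mulr1 normc_real ger0_norm ?expR_ge0. Qed.

Lemma is_derive_expansion (f : R -> R) (x d : R) : is_derive x 1 f d ->
  forall e : R, 0 < e -> exists2 r : R, 0 < r & forall h, `|h| < r ->
    `|f (x + h) - f x - d * h| <= e * `|h|.
Proof.
move=> fx e e0.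
have fdrv : derivable f x 1 by case: fx.
have dE : 'D_1 f x = d by case: fx.
have /derivable_nbhs/eqaddoP/(_ _ e0)/nbhs_ballP[r /= r0 fr] := fdrv.
exists r => // h hr; have := fr h; rewrite -ball_normE /ball_ /= sub0r normrN => /(_ hr).
by rewrite !fctE /= -[h *: 1]/(h * 1) mulr1 dE -[h *: d]/(h * d) (addrC h) opprD addrA (mulrC h).
Qed.

Lemma cexp_expansion0 (e : R) : 0 < e -> exists2 d : R, 0 < d &
  forall h : C, normc h < d -> normc (cexp h - 1 - h) <= e * normc h.
Proof.
(* With r = |h|, the real and imaginary parts contribute 6 eta r in total. The bound eta <= 1
   together with r < eta / 2 gives expR x <= 2 and |expR x - 1| <= eta. *)
move=> e0; have eta0 : 0 < Num.min (e / 6) 1 by rewrite lt_min ltr01 divr_gt0.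
set eta := Num.min _ _ in eta0.
have [r1 r10 E1] := is_derive_expansion (is_derive_expR (0 : R)) eta0.
have [r2 r20 E2] := is_derive_expansion (is_derive_cos (0 : R)) eta0.
have [r3 r30 E3] := is_derive_expansion (is_derive_sin (0 : R)) eta0.
exists (Num.min (Num.min r1 r2) (Num.min r3 (eta / 2))) => [|h].
  by rewrite !lt_min r10 r20 r30 divr_gt0.
rewrite !lt_min => /andP[/andP[h1 h2] /andP[h3 h4]].
have hx := normc_Re h; have hy := normc_Im h.
have {E1} := E1 _ (le_lt_trans hx h1).
have {E2} := E2 _ (le_lt_trans hy h2); have {E3} := E3 _ (le_lt_trans hy h3).
case: h h1 h2 h3 h4 hx hy => x y; set r := normc (x +i* y) => h1 h2 h3 h4 /= hx hy.
rewrite !add0r sin0 cos0 expR0 ?oppr0 ?mulNr ?mul0r ?oppr0 ?addr0 ?mul1r => E3 E2 E1.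
apply: (le_trans (normc_le_ReIm _)) => /=; rewrite subr0.
have eta1 : eta <= 1 by rewrite ge_min lexx orbT.
have eta6 : 6 * eta <= e.
  have : eta <= e / 6 by rewrite ge_min lexx.
  lra.
have r0 : 0 <= r := normc_ge0 _.
have etar (u : R) : `|u| <= r -> eta * `|u| <= eta * r.
  by move=> ur; rewrite ler_wpM2l // ltW.
have E1' := le_trans E1 (etar _ hx); have E2' := le_trans E2 (etar _ hy).
have E3' := le_trans E3 (etar _ hy).
have ex2 : expR x <= 2.
  have : eta * r <= 1 * (1 / 2) by apply: ler_pM => //; [exact: ltW|lra].
  move: E1' hx; rewrite !ler_norml => /andP[_ ?] /andP[_ ?]; lra.
have ex1 : `|expR x - 1| <= eta.
  have : eta * r <= 1 * r by rewrite ler_wpM2r.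
  move: E1' hx; rewrite !ler_norml => /andP[? ?] /andP[? ?] ?.
  by apply/andP; split; lra.
have ex0 : 0 <= expR x := expR_ge0 x.
have reE : `|expR x * cos y - 0 * sin y - 1 - x| <= eta * r + 2 * (eta * r).
  have -> : expR x * cos y - 0 * sin y - 1 - x =
    (expR x - 1 - x) + expR x * (cos y - 1) by ring.
  rewrite (le_trans (ler_normD _ _)) // lerD // normrM.
  by apply: ler_pM => //; rewrite ger0_norm.
have imE : `|expR x * sin y + 0 * cos y - y| <= 2 * (eta * r) + eta * r.
  have -> : expR x * sin y + 0 * cos y - y =
    expR x * (sin y - y) + (expR x - 1) * y by ring.
  rewrite (le_trans (ler_normD _ _)) // lerD // normrM.
    by apply: ler_pM => //; rewrite ger0_norm.
  by apply: ler_pM.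
apply: (le_trans (lerD reE imE)).
have -> : eta * r + 2 * (eta * r) + (2 * (eta * r) + eta * r) = 6 * eta * r by ring.
by rewrite ler_wpM2r.
Qed.

Lemma cexp_cderivable w : cderivable cexp w.
Proof.
apply: (@normc_cderivable _ _ _ (cexp w)) => e e0.
have n0 : 0 < normc (cexp w) by rewrite normc_cexp expR_gt0.
have [d d0 expd] := cexp_expansion0 (divr_gt0 e0 n0).
exists d => // h /expd hd; rewrite cexpD.
have -> : cexp w * cexp h - cexp w - cexp w * h = cexp w * (cexp h - 1 - h) by ring.
by rewrite normcM mulrC -ler_pdivlMr // mulrAC.
Qed.

End cexp.

(** * Limits of complex sequences *)

Section ctends.
Variable R : realType.
Local Notation C := (R[i]).
Implicit Types (u v : nat -> C) (l : C).

Definition ctends u l := forall e : R, 0 < e ->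
  \forall n \near \oo, normc (u n - l) <= e.

Lemma ctends_cst l : ctends (fun=> l) l.
Proof. by move=> e e0; near=> n; rewrite subrr normc0 ltW. Unshelve. all: by end_near. Qed.

Lemma ctendsD u v l l' : ctends u l -> ctends v l' ->
  ctends (fun n => u n + v n) (l + l').
Proof.
move=> ul vl' e e0; have e2 : 0 < e / 2 by rewrite divr_gt0.
near=> n; rewrite opprD addrACA (le_trans (normcD _ _)) //.
by rewrite (splitr e) lerD //; near: n; [exact: ul|exact: vl'].
Unshelve. all: by end_near. Qed.

Lemma ctendsZ c u l : ctends u l -> ctends (fun n => c * u n) (c * l).
Proof.
move=> ul e e0; have c1 : 0 < normc c + 1 by rewrite ltr_wpDl ?normc_ge0.
near=> n; rewrite -mulrBr normcM.
apply: (@le_trans _ _ ((normc c + 1) * (e / (normc c + 1)))); last first.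
  by rewrite mulrC divfK // gt_eqF.
apply: ler_pM; rewrite ?normc_ge0 ?lerDl //.
by near: n; apply: ul; rewrite divr_gt0.
Unshelve. all: by end_near. Qed.

Lemma ctendsB u v l l' : ctends u l -> ctends v l' ->
  ctends (fun n => u n - v n) (l - l').
Proof.
move=> ul vl'; have := ctendsD ul (ctendsZ (-1) vl'); rewrite mulN1r.
by under eq_fun do rewrite mulN1r.
Qed.

Lemma ctends_sum I (r : seq I) (u : I -> nat -> C) (l : I -> C) :
  (forall i, ctends (u i) (l i)) ->
  ctends (fun n => \sum_(i <- r) u i n) (\sum_(i <- r) l i).
Proof.
move=> ul; elim: r => [|i r IH].
  by rewrite big_nil; under eq_fun do rewrite big_nil; exact: ctends_cst.
by rewrite big_cons; under eq_fun do rewrite big_cons; exact: ctendsD.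
Qed.

Lemma ctends_le u l c : ctends u l -> (\forall n \near \oo, normc (u n) <= c) ->
  normc l <= c.
Proof.
move=> ul uc; apply/ler_addgt0Pr => e e0.
have [n [h1 h2]] : exists n, normc (u n - l) <= e /\ normc (u n) <= c.
  near \oo => n; exists n; split; near: n => //; exact: ul.
rewrite -[l](subKr (u n)) (le_trans (normcD _ _)) // normcN lerD //.
Unshelve. all: by end_near. Qed.

Lemma ctends_unique u l l' : ctends u l -> ctends u l' -> l = l'.
Proof.
move=> ul ul'; apply/eqP; rewrite -subr_eq0 -normc_eq0 eq_le normc_ge0 andbT.
apply: (ctends_le (ctendsB ul ul')); near=> n.
by rewrite subrr normc0.
Unshelve. all: by end_near. Qed.

Lemma ctends_normc u l : ctends u l -> (fun n => normc (u n)) @ \oo --> normc l.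
Proof.
move=> ul; apply/cvgrPdist_le => e e0; near=> n.
have ne : normc (u n - l) <= e by near: n; exact: ul.
rewrite ler_norml; apply/andP; split.
  rewrite lerNl opprB lerBlDr (le_trans _ (lerD ne (lexx _))) //.
  by rewrite -[in leLHS](subrK l (u n)) normcD.
rewrite lerBlDr (le_trans _ (lerD ne (lexx _))) //.
by rewrite normcB -[in leLHS](subrK (u n) l) normcD.
Unshelve. all: by end_near. Qed.

Lemma ctends_cauchy u :
  (forall e : R, 0 < e -> exists N, forall p q, (N <= p)%N -> (N <= q)%N ->
    normc (u p - u q) <= e) -> exists l, ctends u l.
Proof.
move=> uc.
have cvgR (f : C -> R) : (forall x y, `|f x - f y| <= normc (x - y)) ->
    exists l : R, (f \o u) @ \oo --> l.
  move=> f1; apply/cvg_ex/cauchy_cvgP/cauchy_exP => e e0.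
  have [N uN] := uc _ (divr_gt0 e0 (ltr0n R 2)); exists (f (u N)); exists N => // n /= Nn.
  rewrite -ball_normE /ball_ /= (le_lt_trans (f1 _ _)) //.
  by rewrite (le_lt_trans (uN _ _ _ _)) // ltr_pdivrMr // ltr_pMr // ltr1n.
have [a ua] := cvgR (@complex.Re R) ltac:(by move=> [x y] [z t]; exact: (normc_Re ((x +i* y) - (z +i* t)))).
have [b ub] := cvgR (@complex.Im R) ltac:(by move=> [x y] [z t]; exact: (normc_Im ((x +i* y) - (z +i* t)))).
exists (a +i* b) => e e0; have e2 : 0 < e / 2 by rewrite divr_gt0.
near=> n; rewrite normcB (le_trans (normc_le_ReIm _)) // (splitr e) lerD //.
  have -> : complex.Re (a +i* b - u n) = a - complex.Re (u n) by case: (u n).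
  by near: n; move/cvgrPdist_le : ua; apply.
have -> : complex.Im (a +i* b - u n) = b - complex.Im (u n) by case: (u n).
by near: n; move/cvgrPdist_le : ub; apply.
Unshelve. all: by end_near. Qed.

(** For sequences whose limit is not known in advance: approximation within every e by some
    convergent sequence already makes u Cauchy. *)
Lemma ctends_approx u :
  (forall e : R, 0 < e -> exists v l, ctends v l /\
    \forall n \near \oo, normc (u n - v n) <= e) -> exists l, ctends u l.
Proof.
move=> uv; apply: ctends_cauchy => e e0.
have e4 : 0 < e / 4 by rewrite divr_gt0.
have [v [l [vl uv4]]] := uv _ e4.
have [N _ NP] : \forall n \near \oo, normc (u n - l) <= e / 2.
  near=> n; rewrite -[u n](subrK (v n)) -addrA (le_trans (normcD _ _)) //.
  have -> : e / 2 = e / 4 + e / 4 by field.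
  by rewrite lerD //; near: n => //; exact: vl.
exists N => p q /NP /= up /NP /= uq.
rewrite -[u p](subrK l) -addrA (le_trans (normcD _ _)) //.
by rewrite (splitr e) lerD // normcB.
Unshelve. all: by end_near. Qed.

End ctends.

Section uniform_on_square.
Variable R : realType.
Local Notation C := (R[i]).

(** Compactness of the square with half-side rho, in the form used throughout: what holds locally in
    z for all small t holds for all small t uniformly on the disc. *)
Lemma uniform_on_disc (P : R -> C -> Prop) (rho : R) :
  (forall z, exists2 d : R, 0 < d & forall z' t, normc (z' - z) < d -> 0 < t < d ->
     P t z') ->
  exists2 d : R, 0 < d & forall t z, 0 < t < d -> normc z <= rho -> P t z.
Proof.
move=> Ploc.
have cpt : compact (`[- rho, rho]%classic `*` `[- rho, rho]%classic : set (R * R)).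
  by apply: compact_setX; exact: segment_compact.
have /compact_near_coveringP/(_ _ (0 : R)^'+ (fun t p => P t (p.1 +i* p.2))) := cpt.
case => [[x y] _|d /= d0 dP].
  have [d d0 dP] := Ploc (x +i* y).
  exists (ball (x, y) (d / 2), [set t | 0 < t < d]) => /=.
    split; first by apply: nbhsx_ballx; rewrite divr_gt0.
    by near=> t; apply/andP; split.
  move=> [[x' y'] t] /= [[/= xx' yy'] td]; apply: dP => //.
  rewrite (le_lt_trans (normc_le_ReIm _)) //=.
  move: xx' yy'; rewrite -!ball_normE /ball_ /= distrC [`|y - y'|]distrC => ? ?.
  by rewrite (splitr d) ltrD.
exists d => // t z /andP[t0 td] zr.
have := dP t; rewrite /= sub0r normrN gtr0_norm // => /(_ td t0).
move=> /(_ (complex.Re z, complex.Im z)) /=; case: z zr => x y zr; apply.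
have := normc_Re (x +i* y); have := normc_Im (x +i* y).
by split; rewrite /= in_itv /= -ler_norml (le_trans _ zr).
Unshelve. all: by end_near. Qed.

End uniform_on_square.

(** * Means over the roots of unity *)

Section circle_mean.
Variable R : realType.
Local Notation C := (R[i]).
Implicit Types (F G g : C -> C) (z a : C).

Definition uroot (n k : nat) : C := cis (pi *+ 2 * (k%:R / (2 ^ n)%:R)).

(** Discrete form of the contour integral of F(w) dw / (2 pi i w) over the circle through z. *)
Definition circ n F z : C := (2 ^ n)%:R^-1 * \sum_(k < 2 ^ n) F (z * uroot n k).

Lemma normc_uroot n k : normc (uroot n k) = 1.
Proof. exact: normc_cis. Qed.

Lemma uroot0 n : uroot n 0 = 1.
Proof. by rewrite /uroot mul0r mulr0 cis0. Qed.

Lemma pow2_neq0 (K : numDomainType) n : (2 ^ n)%:R != 0 :> K.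
Proof. by rewrite pnatr_eq0 expn_eq0. Qed.

Lemma uroot_period n : uroot n (2 ^ n) = 1.
Proof. by rewrite /uroot divff ?pow2_neq0 // mulr1 cis2pi. Qed.

Lemma circD n F G z : circ n (fun x => F x + G x) z = circ n F z + circ n G z.
Proof. by rewrite /circ big_split mulrDr. Qed.

Lemma circZ n c F z : circ n (fun x => c * F x) z = c * circ n F z.
Proof. by rewrite /circ -mulr_sumr mulrCA. Qed.

Lemma circB n F G z : circ n (fun x => F x - G x) z = circ n F z - circ n G z.
Proof. by rewrite /circ sumrB mulrBr. Qed.

Lemma circ_cst n c z : circ n (fun=> c) z = c.
Proof. by rewrite /circ sumr_const card_ord -[c *+ _]mulr_natl mulKf // pow2_neq0. Qed.

Lemma circ_sum I (r : seq I) n (F : I -> C -> C) z :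
  circ n (fun x => \sum_(i <- r) F i x) z = \sum_(i <- r) circ n (F i) z.
Proof.
elim: r => [|i r IH]; first by under [in LHS]eq_fun do rewrite big_nil; rewrite circ_cst big_nil.
by rewrite big_cons -IH -circD; congr (circ n _ z); apply/funext => x; rewrite big_cons.
Qed.

Lemma eq_circ n F G z : (forall w, normc w = normc z -> F w = G w) ->
  circ n F z = circ n G z.
Proof.
move=> FG; rewrite /circ; congr (_ * _); apply: eq_bigr => k _.
by rewrite FG // normcM normc_uroot mulr1.
Qed.

Lemma le_circ n F z c : (forall w, normc w = normc z -> normc (F w) <= c) ->
  normc (circ n F z) <= c.
Proof.
move=> Fc; rewrite /circ normcM normcV normc_nat ler_pdivrMl ?ltr0n ?expn_gt0 //.
apply: (le_trans (normc_sum _ _ _)).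
apply: (@le_trans _ _ (\sum_(k < 2 ^ n) c)).
  by apply: ler_sum => k _; rewrite Fc // normcM normc_uroot mulr1.
by rewrite sumr_const card_ord mulr_natl.
Qed.

Lemma circ_scale n F z c : circ n F (c * z) = circ n (fun x => F (c * x)) z.
Proof. by rewrite /circ; congr (_ * _); apply: eq_bigr => k _; rewrite mulrA. Qed.

(** In the logarithmic coordinate v the circle is a vertical segment of length 2 pi. Both endpoint
    sums of the trapezoidal rule run over all the roots of unity, by periodicity, so they
    coincide. *)
Lemma edge_circ n F z w :
  edge (fun v => F (z * cexp v)) (2 ^ n) w (0 +i* (pi *+ 2)) =
  (0 +i* (pi *+ 2)) * circ n F (z * cexp w).
Proof.
have uE k : F (z * cexp (w + (0 +i* (pi *+ 2)) * (k%:R / (2 ^ n)%:R))) =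
    F (z * cexp w * uroot n k).
  rewrite cexpD mulrA; congr (F (_ * _)).
  have -> : (0 +i* (pi *+ 2)) * (k%:R / (2 ^ n)%:R) =
      0 +i* (pi *+ 2 * (k%:R / (2 ^ n)%:R)) :> C.
    have -> : k%:R / (2 ^ n)%:R = (k%:R / (2 ^ n)%:R)%:C :> C.
      by rewrite rmorphM fmorphV !rmorph_nat.
    by apply/eqP; rewrite eq_complex /= ?mul0r ?mulr0 ?subr0 ?addr0 ?add0r !eqxx.
  by rewrite cexp_imag.
rewrite /edge /circ -mulrA; congr (_ * (_ * _)).
under eq_bigr do rewrite !uE; rewrite -mulr_suml big_split /=.
set S := \sum_(k < 2 ^ n) F (z * cexp w * uroot n k).
suff -> : \sum_(k < 2 ^ n) F (z * cexp w * uroot n k.+1) = S by field.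
have H m (G : nat -> C) : G m = G 0%N -> \sum_(k < m) G k.+1 = \sum_(k < m) G k.
  move=> Gm; have := big_ord_recl m (fun k => G k) (op := +%R) (idx := 0).
  by rewrite big_ord_recr /= Gm addrC => /addrI <-.
by apply: (H _ (fun k => F (z * cexp w * uroot n k))); rewrite uroot_period uroot0.
Qed.

(* Goursat's theorem for [F (z exp v)] on the rectangle [ln s, 0] x [0, 2 pi];
   the horizontal sides cancel by periodicity. *)
Lemma circ_invariant F z (s : R) : 0 < s <= 1 ->
  (forall w, s * normc z <= normc w <= normc z -> cderivable F w) ->
  ctends (fun n => circ n F z - circ n F (s%:C * z)) 0.
Proof.
move=> /andP[s0 s1] Fz e e0; pose x := ln s.
have x0 : x <= 0 by rewrite /x -ln1 ler_ln ?posrE.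
pose h v := F (z * cexp v); pose b : C := 0 +i* (pi *+ 2).
have hdiff (u v : R) : 0 <= u <= 1 -> 0 <= v <= 1 ->
    cderivable h (x%:C + (- x)%:C * u%:C + b * v%:C).
  move=> /andP[u0 u1] _.
  apply: (@cderivable_comp _ (fun v => z * cexp v)).
    by apply: cderivableM; [exact: cderivable_cst|exact: cexp_cderivable].
  apply: Fz; rewrite normcM normc_cexp.
  have -> : complex.Re (x%:C + (- x)%:C * u%:C + b * v%:C) = x * (1 - u).
    by rewrite /=; ring.
  have xu0 : x * (1 - u) <= 0 by rewrite mulr_le0_ge0 // subr_ge0.
  have xux : x <= x * (1 - u).
    by rewrite mulrBr mulr1 lerDl -mulrN mulr_le0 // oppr_le0.
  rewrite mulrC ler_wpM2l ?normc_ge0 ?ler_piMr ?normc_ge0 ?andbT //=.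
    by rewrite expR_le1.
  by rewrite -[s]lnK ?posrE // ler_expR.
have bE : normc b = pi *+ 2.
  by rewrite /normc /b expr0n add0r sqrtr_sqr ger0_norm // mulrn_wge0 // pi_ge0.
have b1 : 1 <= normc b by rewrite bE mulr2n; have := @pi_ge2 R; lra.
near=> n; rewrite subr0.
have : normc (bdry h (2 ^ n) x%:C (- x)%:C b) <= e by near: n; exact: goursat hdiff _ e0.
rewrite /bdry.
have -> : x%:C + (- x)%:C = 0 by rewrite rmorphN subrr.
have -> : edge h (2 ^ n) (x%:C + b) (- x)%:C = edge h (2 ^ n) x%:C (- x)%:C.
  rewrite /edge; congr (_ * _); apply: eq_bigr => k _; congr (_ / _).
  have hb v : h (v + b) = h v by rewrite /h cexpD (cexp_imag (pi *+ 2)) cis2pi mulr1.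
  by rewrite ![x%:C + b + _]addrAC !hb.
rewrite !edge_circ cexp_real lnK ?posrE //.
have -> : cexp 0 = 1 :> C by rewrite (cexp_real 0) expR0.
set A := edge _ _ _ _; rewrite mulr1 [z * _]mulrC [A + _]addrC addrK -mulrBr normcM.
by apply: le_trans; rewrite ler_peMl ?normc_ge0.
Unshelve. all: by end_near. Qed.

End circle_mean.

(** * The mean value property and Cauchy's formula *)

Section cauchy.
Variable R : realType.
Local Notation C := (R[i]).
Implicit Types (F G g : C -> C) (z a : C).

Definition ccontinuous F z := forall e : R, 0 < e ->
  exists2 d : R, 0 < d & forall h, normc h < d -> normc (F (z + h) - F z) < e.

(** By [circ_invariant] the circle may be shrunk until continuity at 0 makes every value on it close
    to F 0. *)
Lemma ctends_circ_inner F z (rho : R) :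
  normc z < rho -> ccontinuous F 0 ->
  (forall w, 0 < normc w <= normc z -> cderivable F w) ->
  ctends (fun n => circ n F z) (F 0).
Proof.
move=> zrho F0 Fz; have [->|z0] := eqVneq z 0.
  have -> : (fun n => circ n F 0) = (fun=> F 0); last exact: ctends_cst.
  apply/funext => n; rewrite (@eq_circ _ n _ (fun=> F 0)) ?circ_cst // => w.
  by rewrite normc0 => /eq0_normc ->.
have nz0 : 0 < normc z by rewrite normc_gt0.
move=> e e0; have e2 : 0 < e / 2 by rewrite divr_gt0.
have [d d0 Fd] := F0 _ e2.
pose s := Num.min 1 (d / (2 * normc z)).
have s0 : 0 < s by rewrite lt_min ltr01 divr_gt0 // mulr_gt0.
have s1 : s <= 1 by rewrite ge_min lexx.
have sz : s * normc z < d.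
  have : s <= d / (2 * normc z) by rewrite ge_min lexx orbT.
  rewrite ler_pdivlMr ?mulr_gt0 // => h; apply: (@le_lt_trans _ _ (d / 2)).
    by rewrite ler_pdivlMr // -mulrA [normc z * 2]mulrC.
  by rewrite ltr_pdivrMr // ltr_pMr // ltr1n.
have inv := @circ_invariant R F z s; rewrite s0 s1 in inv.
have {}inv := inv isT (fun w hw => Fz w ltac:(by move: hw => /andP[h1 ->];
  rewrite (lt_le_trans _ h1) // mulr_gt0)).
near=> n; have h1 : normc (circ n F z - circ n F (s%:C * z) - 0) <= e / 2.
  by near: n; exact: inv.
rewrite -[circ n F z](subrK (circ n F (s%:C * z))) -addrA.
rewrite (le_trans (normcD _ _)) // (splitr e) lerD //; first by rewrite -[X in normc X]subr0.
rewrite -(circ_cst n (F 0) (s%:C * z)) -circB; apply: le_circ => w ws.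
have := Fd w; rewrite add0r ws normcM normc_real gtr0_norm // => /(_ sz).
exact: ltW.
Unshelve. all: by end_near. Qed.

(** Compactness through [uniform_on_disc], which concerns a disc and not a circle: the premise on
    |z| inside [P] makes the claim vacuous near every point off the circle. *)
Lemma uniform_on_circle F a (e : R) : 0 < e ->
  (forall z, normc z = normc a -> ccontinuous F z) ->
  exists2 d : R, 0 < d & forall t z, 0 < t < d -> normc z = normc a ->
    normc (F ((1 - t)%:C * z) - F ((1 + t)%:C * z)) <= e.
Proof.
move=> e0 Fa; pose P t z := normc z = normc a ->
  normc (F ((1 - t)%:C * z) - F ((1 + t)%:C * z)) <= e.
have [|d d0 dP] := @uniform_on_disc R P (normc a); last first.
  by exists d => // t z td za; apply: dP => //; rewrite za.
move=> z; have [za|za] := eqVneq (normc z) (normc a); last first.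
  exists `|normc z - normc a| => [|z' t z'z _ z'a]; first by rewrite normr_gt0 subr_eq0.
  exfalso; move: z'z; apply/negP; rewrite -leNgt -z'a ler_norml.
  have := normcD (z' - z) z; have := normcD (z - z') z'; rewrite !subrK normcB.
  by move=> ? ?; apply/andP; split; lra.
have e2 : 0 < e / 2 by rewrite divr_gt0.
have [d d0 Fd] := Fa _ za _ e2.
have a1 : 0 < 1 + normc a by rewrite ltr_wpDr ?normc_ge0.
exists (d / (1 + normc a)) => [|z' t z'z /andP[t0 td] z'a]; first exact: divr_gt0.
have near_z (s : R) : `|s| < d / (1 + normc a) ->
    normc (F ((1 + s)%:C * z') - F z) < e / 2.
  move=> sd; have := Fd ((1 + s)%:C * z' - z); rewrite subrKC; apply.
  have -> : (1 + s)%:C * z' - z = (z' - z) + s%:C * z'.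
    by rewrite rmorphD rmorph1; ring.
  rewrite (le_lt_trans (normcD _ _)) // normcM normc_real z'a.
  have -> : d = d / (1 + normc a) + d / (1 + normc a) * normc a.
    by field; rewrite gt_eqF.
  by rewrite ltr_leD // ler_wpM2r ?normc_ge0 // ltW.
rewrite -(subrKA (F z)) (le_trans (normcD _ _)) // (splitr e) lerD //.
  by rewrite ltW // near_z // normrN gtr0_norm.
by rewrite normcB ltW // near_z // gtr0_norm.
Qed.

(* The circular means of [F] do not jump across the exceptional point [a]
   because [F] is uniformly continuous near the circle through [a]. *)
Lemma circ_mean_value F (rho : R) a z :
  (forall w, normc w < rho -> w != a -> cderivable F w) ->
  (forall w, normc w < rho -> ccontinuous F w) ->
  normc a < normc z < rho -> ctends (fun n => circ n F z) (F 0).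
Proof.
move=> Fd Fc /andP[az zrho]; have arho := lt_trans az zrho.
have F0 : ccontinuous F 0.
  by apply: Fc; rewrite normc0 (le_lt_trans (normc_ge0 z)).
have [a0|a0] := eqVneq a 0.
  apply: (ctends_circ_inner zrho) => // w /andP[w0 wz]; apply: Fd.
    exact: le_lt_trans wz zrho.
  by rewrite a0 -normc_gt0.
have na0 : 0 < normc a by rewrite normc_gt0.
have nz0 := lt_trans na0 az.
move=> e e0; have e3 : 0 < e / 3 by rewrite divr_gt0.
have [|d d0 dP] := @uniform_on_circle F a _ e3.
  by move=> w wa; apply: Fc; rewrite wa.
pose t := Num.min (d / 2) (Num.min (1 / 2) ((normc z / normc a - 1) / 2)).
have t0 : 0 < t.
  rewrite !lt_min !divr_gt0 //= subr_gt0 ltr_pdivlMr ?mul1r //.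
have td : t < d.
  by rewrite gt_min ltr_pdivrMr // ltr_pMr // ltr1n.
have t1 : t < 1.
  have : t <= 1 / 2 by rewrite !ge_min lexx !orbT.
  lra.
have tz : (1 + t) * normc a < normc z.
  have : t <= (normc z / normc a - 1) / 2 by rewrite !ge_min lexx !orbT.
  have h : 0 < normc z / normc a - 1 by rewrite subr_gt0 ltr_pdivlMr ?mul1r.
  by move=> ?; rewrite -ltr_pdivlMr //; lra.
pose sp := (1 + t) * normc a / normc z; pose sm := (1 - t) * normc a / normc z.
have sp0 : 0 < sp by rewrite divr_gt0 // mulr_gt0 // addr_gt0.
have sm0 : 0 < sm by rewrite divr_gt0 // mulr_gt0 // subr_gt0.
have sp1 : sp <= 1 by rewrite ler_pdivrMr // mul1r ltW.
have spz : sp * normc z = (1 + t) * normc a by rewrite divfK // gt_eqF.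
have smz : sm * normc z = (1 - t) * normc a by rewrite divfK // gt_eqF.
have out : ctends (fun n => circ n F z - circ n F (sp%:C * z)) 0.
  apply: circ_invariant; rewrite ?sp0 // spz => w /andP[w1 w2]; apply: Fd.
    exact: le_lt_trans w2 zrho.
  apply/eqP => wa; move: w1; apply/negP; rewrite -ltNge wa.
  by rewrite ltr_pMl // ltrDl.
have inn : ctends (fun n => circ n F (sm%:C * z)) (F 0).
  have smE : normc (sm%:C * z) = (1 - t) * normc a.
    by rewrite normcM normc_real gtr0_norm.
  have sma : (1 - t) * normc a < normc a by rewrite gtr_pMl // gtrDl oppr_lt0.
  apply: (@ctends_circ_inner F _ rho) => //; rewrite smE; first exact: lt_trans arho.
  move=> w /andP[_ w2]; have wa := le_lt_trans w2 sma.
  apply: Fd; first exact: lt_trans arho.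
  by apply: contraTneq wa => ->; rewrite ltxx.
near=> n.
have h1 : normc (circ n F z - circ n F (sp%:C * z) - 0) <= e / 3.
  by near: n; exact: out.
have h2 : normc (circ n F (sm%:C * z) - F 0) <= e / 3 by near: n; exact: inn.
have h3 : normc (circ n F (sm%:C * z) - circ n F (sp%:C * z)) <= e / 3.
  have scE (s : R) : circ n F ((s * normc a / normc z)%:C * z) =
      circ n (fun w => F (s%:C * w)) ((normc a / normc z)%:C * z).
    by rewrite -circ_scale mulrA -rmorphM mulrA.
  rewrite /sp /sm !scE -circB; apply: le_circ => w.
  rewrite normcM normc_real ger0_norm ?divr_ge0 ?normc_ge0 // divfK ?gt_eqF // => wa.
  by apply: dP => //; rewrite t0.
have -> : circ n F z - F 0 = (circ n F z - circ n F (sp%:C * z) - 0) -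
  (circ n F (sm%:C * z) - circ n F (sp%:C * z)) + (circ n F (sm%:C * z) - F 0) by ring.
have -> : e = e / 3 + e / 3 + e / 3 by field.
rewrite (le_trans (normcD _ _)) // lerD // (le_trans (normcD _ _)) // lerD //.
by rewrite normcN.
Unshelve. all: by end_near. Qed.

(** Since w / (w - a) = 1 + a / (w - a), it suffices that the mean of a / (w - a) tends to 0; it may
    be moved to a circle as large as desired, where the integrand is small. *)
Lemma circ_kernel a z : normc a < normc z ->
  ctends (fun n => circ n (fun w => w / (w - a)) z) 1.
Proof.
move=> az; have nz0 : 0 < normc z := le_lt_trans (normc_ge0 _) az.
suff : ctends (fun n => circ n (fun w => a / (w - a)) z) 0.
  move=> /(ctendsD (ctends_cst 1)); rewrite addr0; congr ctends.
  apply/funext => n; rewrite -{1}(circ_cst n 1 z) -circD; apply: eq_circ => w wz.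
  have wa : w - a != 0.
    by rewrite subr_eq0; apply: contraTneq az => <-; rewrite wz ltxx.
  by field.
move=> e e0; have e2 : 0 < e / 2 by rewrite divr_gt0.
(* On |w| = r this gives |w - a| > |a| / (e / 2), because |a| < |z|. *)
pose r := normc z + normc a / (e / 2).
have rz : normc z <= r by rewrite lerDl divr_ge0 ?normc_ge0 // ltW.
have r0 : 0 < r := lt_le_trans nz0 rz.
pose s := normc z / r.
have s0 : 0 < s by rewrite divr_gt0.
have s1 : s <= 1 by rewrite ler_pdivrMr // mul1r.
pose z' := (s^-1)%:C * z.
have z'E : normc z' = r.
  by rewrite normcM normc_real gtr0_norm ?invr_gt0 // invf_div divfK // gt_eqF.
have inv : ctends (fun n => circ n (fun w => a / (w - a)) z' -
    circ n (fun w => a / (w - a)) (s%:C * z')) 0.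
  apply: circ_invariant; first by rewrite s0.
  move=> w /andP[w1 w2]; apply: cderivableM; first exact: cderivable_cst.
  apply: cderivableV.
    rewrite subr_eq0; apply: contraTneq w1 => ->; rewrite -ltNge z'E divfK // gt_eqF //.
  by apply: cderivableB; [exact: cderivable_id|exact: cderivable_cst].
have sz' : s%:C * z' = z.
  by rewrite mulrA -rmorphM mulfV ?mul1r // gt_eqF.
rewrite sz' in inv; near=> n; rewrite subr0.
have h1 : normc (circ n (fun w => a / (w - a)) z' -
    circ n (fun w => a / (w - a)) z - 0) <= e / 2 by near: n; exact: inv.
rewrite -(subKr (circ n (fun w => a / (w - a)) z') (circ n _ z)).
rewrite (le_trans (normcD _ _)) // normcN (splitr e) lerD //; last first.
  by rewrite -[X in normc X]subr0.
apply: le_circ => w; rewrite z'E => wr.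
have := normcD (w - a) a; rewrite subrK wr => h.
have wa : normc a / (e / 2) < normc (w - a).
  by move: h; rewrite /r => h; move: az h; lra.
rewrite normcM normcV ler_pdivrMr.
  by rewrite mulrC -ler_pdivrMr // ltW.
by apply: le_lt_trans wa; rewrite divr_ge0 ?normc_ge0 // ltW.
Unshelve. all: by end_near. Qed.

(** Cauchy's formula. Write g(w) w / (w - a) as F(w) + g(a) w / (w - a): F has a removable
    singularity at a and F(0) = 0, so its means tend to 0, while those of the kernel tend to 1. *)
Lemma circ_cauchy g (rho : R) a z :
  (forall w, normc w < rho -> cderivable g w) -> normc a < normc z < rho ->
  ctends (fun n => circ n (fun w => g w * (w / (w - a))) z) (g a).
Proof.
move=> gd /andP[az zrho]; have arho := lt_trans az zrho.
have [B gB] := cderivable_normc (gd a arho).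
(* The value a B, with B the derivative of g at a, makes F continuous at a. Differentiability there
   is not yet available, which is why [circ_mean_value] admits an exceptional point. *)
pose F w := if w == a then a * B else (g w - g a) * (w / (w - a)).
have Fd w : normc w < rho -> w != a -> cderivable F w.
  move=> wrho wa; have wa0 : 0 < normc (w - a) by rewrite normc_gt0 subr_eq0.
  apply: (@cderivable_near _ (fun w => (g w - g a) * (w / (w - a))) _ _ (normc (w - a))) => //.
    move=> h hwa; rewrite /F ifF //; apply/eqP => /(congr1 (fun x => x - h)).
    by rewrite addrK => wE; move: hwa; rewrite wE addrC addKr normcN ltxx.
  apply: cderivableM; first by apply: cderivableB; [exact: gd|exact: cderivable_cst].
  apply: cderivableM; first exact: cderivable_id.
  apply: cderivableV; first by rewrite subr_eq0.
  by apply: cderivableB; [exact: cderivable_id|exact: cderivable_cst].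
have Fc w : normc w < rho -> ccontinuous F w.
  move=> wrho; have [->|wa] := eqVneq w a; last first.
    by move=> e; apply: cderivable_normc_continuous; exact: Fd.
  move=> e e0; pose K := normc a + normc B + 1.
  have K0 : 0 < K by rewrite ltr_wpDl // addr_ge0 ?normc_ge0.
  have eta0 : 0 < e / (2 * K) by rewrite divr_gt0 // mulr_gt0.
  have [d d0 gdd] := gB _ eta0.
  exists (Num.min d (Num.min 1 (e / (2 * K)))) => [|h].
    by rewrite !lt_min d0 ltr01.
  rewrite !lt_min => /and3P[hd h1 he]; rewrite /F eqxx.
  have [->|h0] := eqVneq h 0; first by rewrite addr0 eqxx subrr normc0.
  have -> : (a + h == a) = false by rewrite -subr_eq0 addrC addKr (negbTE h0).
  have -> : (g (a + h) - g a) * ((a + h) / (a + h - a)) - a * B =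
      (a + h) * ((g (a + h) - g a - B * h) / h) + h * B.
    by rewrite [a + h - a]addrC addKr; field.
  rewrite (le_lt_trans (normcD _ _)) // !normcM normcV.
  have gh : normc (g (a + h) - g a - B * h) / normc h <= e / (2 * K).
    by rewrite ler_pdivrMr ?normc_gt0 // gdd.
  have ah : normc (a + h) <= normc a + 1.
    by rewrite (le_trans (normcD _ _)) // lerD // ltW.
  apply: (@le_lt_trans _ _ ((normc a + 1) * (e / (2 * K)) + e / (2 * K) * normc B)).
    apply: lerD; last by rewrite ler_wpM2r ?normc_ge0 // ltW.
    by apply: ler_pM => //; rewrite ?normc_ge0 // divr_ge0 ?normc_ge0.
  rewrite [_ * (e / _)]mulrC -mulrDr.
  have -> : normc a + 1 + normc B = K by rewrite /K addrAC.
  have -> : e / (2 * K) * K = e / 2 by field; rewrite gt_eqF.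
  by rewrite ltr_pdivrMr // ltr_pMr // ltr1n.
have F0 : F 0 = 0.
  by rewrite /F; case: eqP => [<-|_]; rewrite ?mul0r ?mulr0.
have := @circ_mean_value F rho a z Fd Fc; rewrite az zrho F0 => /(_ isT) H.
have := ctendsD H (ctendsZ (g a) (circ_kernel az)); rewrite add0r mulr1.
congr ctends; apply/funext => n; rewrite -circZ -circD; apply: eq_circ => w wz.
have -> : F w = (g w - g a) * (w / (w - a)).
  by rewrite /F ifF //; apply: contraTF az => /eqP <-; rewrite wz ltxx.
ring.
Qed.

End cauchy.

(** * Taylor expansion with remainder *)

Section taylor.
Variable R : realType.
Local Notation C := (R[i]).
Variables (g : C -> C) (rho : R).
Hypothesis gd : forall w, normc w < rho -> cderivable g w.
Implicit Types (a w z : C).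

(** Looking for the bound in the form t^-1 with t small puts boundedness into the shape of
    [uniform_on_disc]. *)
Lemma bounded_on_circle r : r < rho ->
  exists M, forall w, normc w = r -> normc (g w) <= M.
Proof.
move=> rrho; pose P t w := normc w = r -> normc (g w) <= t^-1.
have [|d d0 dP] := @uniform_on_disc R P r; last first.
  exists (d / 2)^-1 => w wr; apply: dP => //; last by rewrite wr.
  by rewrite divr_gt0 //= ltr_pdivrMr // ltr_pMr // ltr1n.
move=> z; have [zr|zr] := eqVneq (normc z) r; last first.
  exists `|normc z - r| => [|z' t z'z _ z'r]; first by rewrite normr_gt0 subr_eq0.
  exfalso; move: z'z; apply/negP; rewrite -leNgt -z'r ler_norml.
  have := normcD (z' - z) z; have := normcD (z - z') z'; rewrite !subrK normcB.
  by move=> ? ?; apply/andP; split; lra.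
have [|d d0 gz] := @cderivable_normc_continuous _ g z (gd _) _ ltr01; first by rewrite zr.
have gz1 : 0 < normc (g z) + 1 by rewrite ltr_wpDl ?normc_ge0.
exists (Num.min d (normc (g z) + 1)^-1) => [|z' t].
  by rewrite lt_min d0 invr_gt0.
rewrite !lt_min => /andP[z'd _] /and3P[t0 td tg] _.
have := gz _ z'd; rewrite subrKC => h.
apply: (@le_trans _ _ (normc (g z) + 1)); last first.
  by rewrite -[leLHS]invrK lef_pV2 ?posrE ?invr_gt0 // ltW.
by rewrite -[g z'](subrK (g z)) (le_trans (normcD _ _)) // addrC lerD2l ltW.
Qed.

Lemma geometric_kernel a w K : w != 0 -> w != a ->
  w / (w - a) = \sum_(k < K) (a / w) ^+ k + (a / w) ^+ K * (w / (w - a)).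
Proof.
move=> w0 wa; have wa0 : w - a != 0 by rewrite subr_eq0.
elim: K => [|K IH]; first by rewrite big_ord0 expr0 mul1r add0r.
rewrite big_ord_recr /= [LHS]IH -addrA; congr (_ + _).
by rewrite exprS; field; rewrite wa0.
Qed.

Lemma circ_expansion n a z K : normc a < normc z ->
  circ n (fun w => g w * (w / (w - a))) z =
  \sum_(k < K) a ^+ k * circ n (fun w => g w / w ^+ k) z +
  a ^+ K * circ n (fun w => g w / w ^+ K * (w / (w - a))) z.
Proof.
move=> az; rewrite -[in RHS]circZ.
under eq_bigr do rewrite -circZ; rewrite -circ_sum -circD.
apply: eq_circ => w wz.
have w0 : w != 0 by rewrite -normc_gt0 wz (le_lt_trans (normc_ge0 a)).
have wa : w != a by apply: contraTneq az => <-; rewrite wz ltxx.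
rewrite [in LHS](geometric_kernel K w0 wa) mulrDr mulr_sumr; congr (_ + _).
  by apply: eq_bigr => k _; rewrite expr_div_n; ring.
by rewrite expr_div_n; ring.
Qed.

Lemma le_kernel a w : normc a < normc w ->
  normc (w / (w - a)) <= normc w / (normc w - normc a).
Proof.
move=> aw; have d0 : 0 < normc w - normc a by rewrite subr_gt0.
have wa : normc w - normc a <= normc (w - a).
  by rewrite lerBlDr -[in leLHS](subrK a w) normcD.
rewrite normcM normcV ler_wpM2l ?normc_ge0 // lef_pV2 ?posrE //.
exact: lt_le_trans wa.
Qed.

Lemma le_circ_remainder n a z K M : normc a < normc z ->
  (forall w, normc w = normc z -> normc (g w) <= M) ->
  normc (a ^+ K * circ n (fun w => g w / w ^+ K * (w / (w - a))) z) <=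
  M * (normc a / normc z) ^+ K * (normc z / (normc z - normc a)).
Proof.
move=> az gM; have z0 := le_lt_trans (normc_ge0 a) az.
rewrite -circZ; apply: le_circ => w wz.
have -> : a ^+ K * (g w / w ^+ K * (w / (w - a))) = g w * (a / w) ^+ K * (w / (w - a)).
  by rewrite expr_div_n; ring.
rewrite (normcM _ (w / (w - a))) (normcM (g w)) normcX (normcM a) normcV.
apply: ler_pM; rewrite ?mulr_ge0 ?exprn_ge0 ?divr_ge0 ?invr_ge0 ?normc_ge0 //.
  by rewrite wz ler_wpM2r ?gM ?exprn_ge0 ?divr_ge0 ?normc_ge0.
by have := @le_kernel a w; rewrite wz; apply.
Qed.

(** Strong induction on k. Cauchy's formula at a point a near 0, minus the lower terms and divided
    by a^k, converges; it differs from the k-th mean by O(|a|) uniformly in n, so [ctends_approx]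
    applies. *)
Lemma circ_coefficient_cvg z k : 0 < normc z < rho ->
  exists c, ctends (fun n => circ n (fun w => g w / w ^+ k) z) c.
Proof.
move=> /andP[z0 zrho]; have [M gM] := bounded_on_circle zrho.
have M0 : 0 <= M by rewrite (le_trans (normc_ge0 (g z))) // gM.
elim/ltn_ind: k => k IH.
have {IH} cvg_lt : forall i, exists c, (i < k)%N ->
    ctends (fun n => circ n (fun w => g w / w ^+ i) z) c.
  move=> i; have [ik|ik] := boolP (i < k)%N; last by exists 0.
  by have [c ci] := IH i ik; exists c.
have [c cP] := choice cvg_lt.
apply: ctends_approx => e e0; set r := normc z.
pose eta := e / (M / r ^+ k + 1).
have D0 : 0 < M / r ^+ k + 1 by rewrite ltr_wpDl // divr_ge0 // exprn_ge0 // ltW.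
have eta0 : 0 < eta by rewrite divr_gt0.
have eta1 : 0 < 1 + eta by rewrite addr_gt0.
(* Chosen so that |a| / (r - |a|) is exactly eta. *)
pose a : C := (r * (eta / (1 + eta)))%:C.
have aE : normc a = r * (eta / (1 + eta)).
  by rewrite normc_real ger0_norm // mulr_ge0 ?divr_ge0 // ltW.
have ar : normc a < r by rewrite aE gtr_pMr // ltr_pdivrMr // mul1r ltrDr.
have a0 : a != 0 by rewrite -normc_gt0 aE mulr_gt0 // divr_gt0.
clearbody a.
exists (fun n => circ n (fun w => g w / w ^+ k * (w / (w - a))) z).
exists ((a ^+ k)^-1 * (g a - \sum_(i < k) a ^+ i * c i)); split.
  have H : ctends (fun n => (a ^+ k)^-1 * (circ n (fun w => g w * (w / (w - a))) z -
      \sum_(i < k) a ^+ i * circ n (fun w => g w / w ^+ i) z))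
      ((a ^+ k)^-1 * (g a - \sum_(i < k) a ^+ i * c i)).
    apply/ctendsZ/ctendsB.
      by apply: circ_cauchy gd _; rewrite ar.
    by apply: ctends_sum => i; apply/ctendsZ/cP.
  move: H; congr ctends; apply/funext => n.
  by rewrite (@circ_expansion n a z k ar) addrC addKr mulKf // expf_neq0.
near=> n; rewrite -circB; apply: le_circ => w wz.
have wa : normc a < normc w by rewrite wz.
have w0 : w != 0 by rewrite -normc_gt0 wz.
have -> : g w / w ^+ k - g w / w ^+ k * (w / (w - a)) =
    g w / w ^+ k * (- (a / w) * (w / (w - a))).
  have wna : w - a != 0 by rewrite subr_eq0; apply: contraTneq wa => ->; rewrite ltxx.
  by field; rewrite ?wna ?w0 ?expf_neq0.
rewrite !normcM normcN normcV normcX normcM normcV -[_ * normc (w - a)^-1]normcM.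
apply: (@le_trans _ _ (M / r ^+ k * eta)).
  rewrite wz -/r; apply: ler_pM.
  - by rewrite mulr_ge0 ?invr_ge0 ?exprn_ge0 ?normc_ge0.
  - by rewrite !mulr_ge0 ?invr_ge0 ?normc_ge0.
  - by rewrite ler_wpM2r ?gM // invr_ge0 exprn_ge0 ?normc_ge0.
  have := le_kernel wa; rewrite wz -/r => h.
  apply: (@le_trans _ _ (normc a / r * (r / (r - normc a)))).
    by rewrite ler_wpM2l // divr_ge0 ?normc_ge0.
  rewrite aE /r; have rn0 : r != 0 by rewrite gt_eqF.
  rewrite le_eqVlt; apply/orP; left; apply/eqP.
  by field; rewrite ?rn0 ?gt_eqF //; lra.
have -> : M / r ^+ k * eta = e * ((M / r ^+ k) / (M / r ^+ k + 1)) by rewrite /eta; ring.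
by rewrite ler_piMr ?(ltW e0) // ler_pdivrMr // mul1r lerDl.
Unshelve. all: by end_near. Qed.

(** Once the coefficients below k agree, the hypothesis at K = k + 1 bounds |c k - c' k| |a|^k by a
    constant times |a|^(k+1); then a tends to 0. *)
Lemma power_series_unique (c c' : nat -> C) (r : R) (D : nat -> R) : 0 < r ->
  (forall a K, normc a < r ->
     normc (\sum_(k < K) c k * a ^+ k - \sum_(k < K) c' k * a ^+ k) <= D K * normc a ^+ K) ->
  c = c'.
Proof.
move=> r0 cc'; apply/funext; elim/ltn_ind => k IH.
apply/eqP; rewrite -subr_eq0 -normc_eq0 eq_le normc_ge0 andbT.
apply/ler_addgt0Pl => e e0; rewrite addr0.
pose t := Num.min (r / 2) (e / (`|D k.+1| + 1)).
have D1 : 0 < `|D k.+1| + 1 by rewrite ltr_wpDl.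
have t0 : 0 < t by rewrite lt_min !divr_gt0.
have tr : t < r by rewrite gt_min ltr_pdivrMr // ltr_pMr // ltr1n.
have := cc' t%:C k.+1; rewrite normc_real gtr0_norm // => /(_ tr).
rewrite !big_ord_recr /= (eq_bigr (fun i : 'I_k => c' i * t%:C ^+ i)); last first.
  by move=> i _; rewrite IH.
rewrite opprD addrACA subrr add0r -mulrBl normcM normcX normc_real gtr0_norm //.
rewrite exprSr mulrA [D _ * _ * _]mulrAC ler_pM2r ?exprn_gt0 // => /le_trans; apply.
apply: (@le_trans _ _ ((`|D k.+1| + 1) * t)).
  by rewrite ler_wpM2r ?(ltW t0) // (le_trans (ler_norm _)) // lerDl.
rewrite mulrC -ler_pdivlMr // ge_min lexx orbT //.
Qed.

(* The coefficients are limits of means over the roots of unity instead of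
   Cauchy integrals. *)
Theorem taylor : 0 < rho -> exists c : nat -> C,
  (forall z k, 0 < normc z < rho ->
     ctends (fun n => circ n (fun w => g w / w ^+ k) z) (c k)) /\
  (forall r M, 0 < r < rho -> (forall w, normc w = r -> normc (g w) <= M) ->
     forall a K, normc a < r ->
     normc (g a - \sum_(k < K) c k * a ^+ k) <=
       M * (normc a / r) ^+ K * (r / (r - normc a))).
Proof.
move=> rho0.
have at_z z : exists c : nat -> C, 0 < normc z < rho ->
    (forall k, ctends (fun n => circ n (fun w => g w / w ^+ k) z) (c k)) /\
    (forall M, (forall w, normc w = normc z -> normc (g w) <= M) ->
     forall a K, normc a < normc z ->
     normc (g a - \sum_(k < K) c k * a ^+ k) <=
       M * (normc a / normc z) ^+ K * (normc z / (normc z - normc a))).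
  have [zP|] := boolP (0 < normc z < rho); last by exists (fun=> 0).
  have [c cP] := choice (fun k => circ_coefficient_cvg k zP).
  exists c => _; split => // M gM a K az.
  have /andP[z0 zrho] := zP.
  apply: (@ctends_le _ (fun n => a ^+ K * circ n (fun w => g w / w ^+ K * (w / (w - a))) z)).
    have azr : normc a < normc z < rho by rewrite az.
    have H := ctendsB (circ_cauchy gd azr)
      (ctends_sum (index_enum 'I_K) (fun i => ctendsZ (a ^+ i) (cP i))).
    move: H; congr ctends.
      by apply/funext => n; rewrite (@circ_expansion n a z K) // addrC addKr.
    by congr (_ - _); apply: eq_bigr => i _; rewrite mulrC.
  by near=> n; exact: le_circ_remainder.
have [c cP] := choice at_z; pose z0 : C := (rho / 2)%:C.
have z0P : 0 < normc z0 < rho.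
  rewrite normc_real gtr0_norm ?divr_gt0 //=.
  by rewrite ltr_pdivrMr // ltr_pMr // ltr1n.
(* The coefficients do not depend on the circle: both partial sums of length K approximate g to
   order K at 0. The factor 2 below bounds s / (s - |a|) for |a| < s / 2. *)
have cE z : 0 < normc z < rho -> c z = c z0.
  move=> zP; have [_ Bz] := cP z zP; have [_ B0] := cP z0 z0P.
  have /andP[z_gt0 zrho] := zP; have /andP[z0_gt0 z0rho] := z0P.
  have [M gM] := bounded_on_circle zrho; have [M0 gM0] := bounded_on_circle z0rho.
  have {}Bz := Bz M gM; have {}B0 := B0 M0 gM0.
  have M_ge0 : 0 <= M by rewrite (le_trans (normc_ge0 (g z))) // gM.
  have M0_ge0 : 0 <= M0 by rewrite (le_trans (normc_ge0 (g z0))) // gM0.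
  pose r := Num.min (normc z / 2) (normc z0 / 2).
  apply: (@power_series_unique _ _ r
    (fun K => M / normc z ^+ K * 2 + M0 / normc z0 ^+ K * 2)).
    by rewrite lt_min !divr_gt0.
  move=> a K; rewrite lt_min => /andP[az az0].
  have tail (s : R) (N : R) : 0 < s -> 0 <= N -> normc a < s / 2 ->
      N * (normc a / s) ^+ K * (s / (s - normc a)) <= N / s ^+ K * 2 * normc a ^+ K.
    move=> s0 N0 as2; rewrite expr_div_n.
    have -> : N / s ^+ K * 2 * normc a ^+ K = N * (normc a ^+ K / s ^+ K) * 2 by ring.
    rewrite ler_wpM2l ?mulr_ge0 ?invr_ge0 ?exprn_ge0 ?normc_ge0 ?(ltW s0) //.
    rewrite ler_pdivrMr; lra.
  have az' : normc a < normc z by apply: lt_trans az _; rewrite ltr_pdivrMr // ltr_pMr // ltr1n.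
  have az0' : normc a < normc z0 by apply: lt_trans az0 _; rewrite ltr_pdivrMr // ltr_pMr // ltr1n.
  rewrite mulrDl -(subrKA (g a)) (le_trans (normcD _ _)) // lerD //.
    by rewrite normcB; apply: le_trans (Bz a K az') _; exact: tail.
  by apply: le_trans (B0 a K az0') _; exact: tail.
exists (c z0); split => [z k zP|r M rP gM a K ar].
  by rewrite -(cE z zP); have [cz _] := cP z zP.
have rE : normc (r%:C : C) = r by rewrite normc_real gtr0_norm //; case/andP: rP.
have rP' : 0 < normc (r%:C : C) < rho by rewrite rE.
have [_] := cP r%:C rP'; rewrite rE => /(_ M gM a K ar).
by rewrite (cE _ rP').
Unshelve. all: by end_near. Qed.

End taylor.

(** * Holomorphic functions of several variables *)

Section several_variables.
Variables (R : realType) (m : nat).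
Local Notation C := (R[i]).
Local Notation V := (Cn R m).
Implicit Types (z h w : V) (f : V -> C^o).

Lemma normc_coord_le z i : normc (z 0 i) <= rnorm z.
Proof.
rewrite -lecR -rnormE -normcE.
have : mx_norm z <= mx_norm z by [].
by rewrite {1}mx_normE num_le => /bigmax_leP[_ /(_ (0, i) isT)]; rewrite -num_le.
Qed.

Lemma rnorm_le z (e : R) : 0 <= e -> (forall i, normc (z 0 i) <= e) -> rnorm z <= e.
Proof.
move=> e0 ze; rewrite -lecR -rnormE.
have [z0|/mx_norm_neq0[[i j]]] := eqVneq (mx_norm z) 0.
  by rewrite [leLHS]z0 lecR.
by move=> /= zij; rewrite [leLHS]zij normcE lecR ord1.
Qed.

Lemma rnormZ (c : C) z : rnorm (c *: z) = normc c * rnorm z.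
Proof. by apply: complexI; rewrite rmorphM -[LHS]rnormE normrZ rnormE. Qed.

Definition ballsum z := \sum_(i < m) normc (z 0 i) ^+ 2.

Lemma in_ball_le z w : (forall i, normc (w 0 i) <= normc (z 0 i)) ->
  in_ball z -> in_ball w.
Proof.
move=> wz; apply: le_lt_trans; apply: ler_sum => i _.
by rewrite ler_pXn2r ?nnegrE ?normc_ge0.
Qed.

Lemma in_ball_coord z i : in_ball z -> normc (z 0 i) < 1.
Proof.
move=> zb; rewrite -(@ltr_pXn2r _ 2) ?nnegrE ?normc_ge0 // expr1n.
apply: le_lt_trans zb; rewrite (bigD1 i) //= lerDl.
by apply: sumr_ge0 => j _; exact: sqr_ge0.
Qed.

Lemma in_ball0 : in_ball (0 : V).
Proof.
rewrite /in_ball big1 ?ltr01 // => i _.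
by rewrite mxE normc0 expr0n.
Qed.

Lemma in_ball_uniform (s : R) : s < 1 -> exists2 d : R, 0 < d &
  forall z h, ballsum z <= s -> rnorm h < d -> in_ball (z + h).
Proof.
move=> s1; have S1 : 0 < 1 - s by rewrite subr_gt0.
have m0 : 0 < 3 * m%:R + 1 :> R by rewrite ltr_wpDl // mulr_ge0.
(* Since |z_i| <= 1 and d <= 1, (|z_i| + d)^2 <= |z_i|^2 + 3 d, so the sum of squares grows by at
   most 3 m d. *)
exists (Num.min 1 ((1 - s) / (3 * m%:R + 1))) => [|z h zs].
  by rewrite lt_min ltr01 divr_gt0.
have zb : in_ball z := le_lt_trans zs s1.
set d := rnorm h; rewrite lt_min => /andP[d1 dS].
have d0 : 0 <= d := rnorm_ge0 h.
rewrite /in_ball; apply: (@le_lt_trans _ _ (\sum_(i < m) (normc (z 0 i) ^+ 2 + 3 * d))).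
  apply: ler_sum => i _; rewrite mxE.
  apply: (@le_trans _ _ ((normc (z 0 i) + d) ^+ 2)).
    rewrite ler_pXn2r ?nnegrE ?addr_ge0 ?normc_ge0 //.
    by rewrite (le_trans (normcD _ _)) // lerD2l normc_coord_le.
  have zi1 := ltW (in_ball_coord i zb); have zi0 := normc_ge0 (z 0 i).
  have : normc (z 0 i) * d <= 1 * d by rewrite ler_wpM2r.
  have : d * d <= 1 * d by rewrite ler_wpM2r // ltW.
  rewrite sqrrD !expr2 mulr2n; lra.
rewrite big_split /= -/(ballsum z) sumr_const card_ord -[_ *+ m]mulr_natr.
rewrite ltr_pdivlMr // in dS; lra.
Qed.

Lemma in_ball_open z : in_ball z -> exists2 d : R, 0 < d &
  forall h, rnorm h < d -> in_ball (z + h).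
Proof.
by move=> zb; have [d d0 dP] := in_ball_uniform zb; exists d => // h; exact: dP.
Qed.

Lemma slice_cderivable f z h (t : C) : differentiable f (z + t *: h) ->
  cderivable (fun s => f (z + s *: h)) t.
Proof.
move=> ft; apply: (@differentiable_comp _ C^o V C^o (fun s : C^o => z + s *: h) f) => //.
Qed.

(** The Taylor remainder with K = 2; the factor 2 bounds r / (r - |t|) for |t| <= r / 2. *)
Lemma taylor_second_order (g : C -> C) (rho r M : R) :
  (forall t, normc t < rho -> cderivable g t) -> 0 < r < rho ->
  (forall t, normc t = r -> normc (g t) <= M) ->
  exists B, forall t, normc t <= r / 2 ->
    normc (g t - g 0 - B * t) <= 2 * M * (normc t / r) ^+ 2.
Proof.
move=> gd rrho gM; have /andP[r0 rho1] := rrho.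
have [c [_ cP]] := taylor gd (lt_trans r0 rho1).
have {}cP := cP r M rrho gM.
have c0 : c 0%N = g 0.
  have := cP 0 1%N; rewrite normc0 mul0r expr1 mulr0 mul0r => /(_ r0).
  rewrite big_ord1 expr0 mulr1 => h; apply/esym/eqP; rewrite -subr_eq0 -normc_eq0.
  by rewrite eq_le h normc_ge0.
exists (c 1%N) => t tr; have tr' : normc t < r.
  by apply: (le_lt_trans tr); rewrite ltr_pdivrMr // ltr_pMr // ltr1n.
have := cP t 2%N tr'; rewrite big_ord_recr big_ord1 /= expr0 expr1 mulr1 c0 opprD addrA.
move=> /le_trans; apply; rewrite [2 * M]mulrC mulrAC.
have M0 : 0 <= M.
  by apply: le_trans (normc_ge0 (g r%:C)) (gM _ _); rewrite normc_real gtr0_norm.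
rewrite ler_wpM2r ?sqr_ge0 // ler_wpM2l //.
rewrite ler_pdivrMr; lra.
Qed.

(** The one-variable estimate on the slice t |-> f (z + t h). The error depends only on a bound for
    f and not on its derivatives, so it is uniform along a bounded sequence of functions. *)
Lemma differentiable_second_order f z (r M : R) : 0 < r ->
  (forall h, rnorm h < 2 * r -> differentiable f (z + h)) ->
  (forall h, rnorm h <= r -> normc (f (z + h)) <= M) ->
  forall h, rnorm h <= r / 2 ->
    normc (f (z + h) - f z - 'd f z h) <= 2 * M * (rnorm h / r) ^+ 2.
Proof.
move=> r0 fd fM h hr; have [h0|h0] := eqVneq (rnorm h) 0.
  have -> : h = 0 by apply/eqP; rewrite -normr_eq0 rnormE h0.
  rewrite addr0 subrr linear0 subr0 normc0.
  have M0 : 0 <= M.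
    by apply: le_trans (normc_ge0 (f (z + h))) (fM _ _); rewrite h0 ltW.
  by rewrite mulr_ge0 ?sqr_ge0 // mulr_ge0.
have s0 : 0 < rnorm h by rewrite lt_neqAle eq_sym h0 rnorm_ge0.
set s := rnorm h in hr s0 *; pose g (t : C) : C := f (z + t *: h).
have gd t : normc t < 2 * r / s -> cderivable g t.
  by move=> ts; apply/slice_cderivable/fd; rewrite rnormZ -ltr_pdivlMr.
have rs : 0 < r / s < 2 * r / s.
  by rewrite divr_gt0 //= ltr_pM2r ?invr_gt0 // ltr_pMl // ltr1n.
have gM t : normc t = r / s -> normc (g t) <= M.
  by move=> ts; apply: fM; rewrite rnormZ ts divfK // gt_eqF.
have [B gB] := taylor_second_order gd rs gM.
have M0 : 0 <= M.
  apply: le_trans (normc_ge0 (f (z + h))) (fM _ _).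
  by rewrite -/s (le_trans hr) // ler_pdivrMr // ler_pMr // ler1n.
(* The linear coefficient of the slice is the differential: both approximate f (z + t h) - f z up to
   o(t). *)
have BE : B = 'd f z h.
  apply/eqP; rewrite -subr_eq0 -normc_eq0 eq_le normc_ge0 andbT.
  apply/ler_addgt0Pr => e e0; rewrite add0r.
  have fz : differentiable f z.
    by have := fd 0; rewrite addr0; apply; rewrite /rnorm normr0 mulr_gt0.
  have e2s : 0 < e / (2 * s) by rewrite divr_gt0 // mulr_gt0.
  have [d d0 fdd] := differentiable_rnorm fz e2s.
  pose K := 2 * M * (s / r) ^+ 2 + 1.
  have K0 : 0 < K by rewrite ltr_wpDl // mulr_ge0 ?sqr_ge0 // mulr_ge0.
  (* The first two bounds make the two estimates applicable at t, the third makes the quadratic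
     error at most t e / 2; the other error is t e / 2 as well. *)
  pose t := Num.min (d / (2 * s)) (Num.min (r / s / 2) (e / (2 * K))).
  have t0 : 0 < t by rewrite !lt_min !divr_gt0 // mulr_gt0.
  have td : t * s < d.
    have : t <= d / (2 * s) by rewrite ge_min lexx.
    rewrite ler_pdivlMr ?mulr_gt0 // mulrCA; have := mulr_gt0 t0 s0; lra.
  have tr : t <= r / s / 2 by rewrite !ge_min lexx !orbT.
  have te : t * K <= e / 2.
    have : t <= e / (2 * K) by rewrite !ge_min lexx !orbT.
    by rewrite invfM mulrA ler_pdivlMr.
  have nt : normc (t%:C : C) = t by rewrite normc_real gtr0_norm.
  have := gB t%:C; rewrite nt => /(_ tr) h1.
  have := fdd (t%:C *: h); rewrite rnormZ nt => /(_ td) h2.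
  rewrite -(ler_pM2l t0) -[X in X * _ <= _]nt -normcM.
  have -> : t%:C * (B - 'd f z h) = (f (z + t%:C *: h) - f z - 'd f z (t%:C *: h)) -
     (g t%:C - g 0 - B * t%:C).
    by rewrite /g scale0r addr0 linearZ /= -[_ *: 'd f z h]/(_ * 'd f z h); ring.
  rewrite (le_trans (normcD _ _)) // normcN.
  apply: (@le_trans _ _ (e / (2 * s) * (t * s) + 2 * M * (t / (r / s)) ^+ 2)).
    by apply: lerD.
  have -> : e / (2 * s) * (t * s) = t * (e / 2) by field; rewrite gt_eqF.
  have -> : 2 * M * (t / (r / s)) ^+ 2 = t * (t * (2 * M * (s / r) ^+ 2)).
    by field; rewrite ?gt_eqF.
  rewrite -mulrDr ler_wpM2l ?(ltW t0) // [leRHS]splitr lerD2l (le_trans _ te) //.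
  by rewrite ler_wpM2l ?(ltW t0) // lerDl.
have := gB 1; rewrite normc1 => /(_ _).
rewrite /g scale1r scale0r addr0 mulr1 BE div1r invf_div; apply.
by rewrite ler_pdivlMr // mul1r ler_pdivlMr // mulrC -ler_pdivlMr.
Qed.

End several_variables.

(** * Bounded pointwise limits of differentiable functions *)

Section limits_of_differentiable_functions.
Variables (R : realType) (m : nat).
Local Notation C := (R[i]).
Local Notation V := (Cn R m).
Implicit Types (z h w : V) (f : V -> C^o).

(** The linear form with prescribed partial derivatives. Its registered linear structure lets it
    serve as the differential of a function. *)
Definition dotv (D : 'I_m -> C) (h : V) : C^o := \sum_i h 0 i * D i.

Fact dotv_linear D : linear (dotv D).
Proof.
move=> a x y; rewrite /dotv scaler_sumr -big_split; apply: eq_bigr => i _.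
by rewrite !mxE mulrDl -mulrA.
Qed.

HB.instance Definition _ D :=
  GRing.isLinear.Build C V C^o *:%R (dotv D) (dotv_linear D).

Lemma rnorm_dotv D h : rnorm (dotv D h) <= (\sum_i normc (D i)) * rnorm h.
Proof.
rewrite rnormc (le_trans (normc_sum _ _ _)) // mulr_suml; apply: ler_sum => i _.
by rewrite normcM mulrC ler_wpM2l ?normc_ge0 // normc_coord_le.
Qed.

Lemma dotv_continuous D : continuous (dotv D).
Proof.
move=> x A /nbhs_rnormP[e e0 eA]; pose K := \sum_i normc (D i) + 1.
have K0 : 0 < K by rewrite ltr_wpDl // sumr_ge0 // => i _; exact: normc_ge0.
apply/nbhs_rnormP; exists (e / K) => [|h he]; first exact: divr_gt0.
rewrite /= linearD; apply: eA; rewrite (le_lt_trans (rnorm_dotv _ _)) //.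
rewrite ltr_pdivlMr // in he; apply: le_lt_trans he.
by rewrite mulrC ler_wpM2l ?rnorm_ge0 // lerDl.
Qed.

Lemma linear_dotv (L : {linear V -> C^o}) h : L h = dotv (fun i => L (delta_mx 0 i)) h.
Proof.
rewrite {1}(matrix_sum_delta h) big_ord1 linear_sum; apply: eq_bigr => i _.
by rewrite linearZ.
Qed.

Lemma differentiable_near f f' z (d : R) : 0 < d ->
  (forall h, rnorm h < d -> f (z + h) = f' (z + h)) ->
  differentiable f z -> differentiable f' z.
Proof.
move=> d0 ff' fz; apply: (@rnorm_differentiable _ _ _ _ ('d f z)).
  exact: diff_continuous.
move=> e e0; have [d' d'0 fd'] := differentiable_rnorm fz e0.
exists (Num.min d d') => [|h]; first by rewrite lt_min d0.
rewrite lt_min => /andP[hd hd']; rewrite -ff' // -(addr0 z) -ff' ?addr0; first exact: fd'.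
by rewrite /rnorm normr0.
Qed.

(** Weierstrass' theorem at a point. By the second-order estimate the differentials at z are
    difference quotients up to an error small uniformly in n, hence they converge; the same estimate
    then passes to the limit. *)
Lemma limit_differentiable (F : nat -> V -> C^o) f z (r M : R) : 0 < r ->
  (forall n h, rnorm h < 2 * r -> differentiable (F n) (z + h)) ->
  (forall n h, rnorm h <= r -> normc (F n (z + h)) <= M) ->
  (forall h, rnorm h <= r -> ctends (fun n => F n (z + h)) (f (z + h))) ->
  differentiable f z.
Proof.
move=> r0 Fd FM Ff.
have Fz : ctends (fun n => F n z) (f z).
  by have := Ff 0; rewrite addr0; apply; rewrite /rnorm normr0 ltW.
have M0 : 0 <= M.
  apply: le_trans (normc_ge0 (F 0%N (z + 0))) (FM _ _ _).
  by rewrite /rnorm normr0 ltW.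
have so n h := differentiable_second_order r0 (Fd n) (FM n) (h := h).
have cvgL h : rnorm h <= 1 -> exists l, ctends (fun n => 'd (F n) z h : C) l.
  move=> h1; apply: ctends_approx => e e0.
  (* The second-order error 2 M (t / r)^2, divided by t, is at most t K. *)
  pose K := 2 * M / r ^+ 2 + 1.
  have K0 : 0 < K by rewrite ltr_wpDl // divr_ge0 ?sqr_ge0 // mulr_ge0.
  pose t := Num.min (r / 2) (e / K).
  have t0 : 0 < t by rewrite lt_min !divr_gt0.
  have tn0 : (t%:C : C) != 0 by rewrite -normc_gt0 normc_real gtr0_norm.
  have tr : t <= r / 2 by rewrite ge_min lexx.
  have te : t * K <= e by rewrite -ler_pdivlMr // ge_min lexx orbT.
  have th : rnorm (t%:C *: h) <= t.
    by rewrite rnormZ normc_real gtr0_norm // ler_piMr // ltW.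
  exists (fun n => (t%:C)^-1 * (F n (z + t%:C *: h) - F n z)).
  exists ((t%:C)^-1 * (f (z + t%:C *: h) - f z)); split.
    apply/ctendsZ/ctendsB => //; apply: Ff; rewrite (le_trans th) // (le_trans tr) //.
    by rewrite ler_pdivrMr // ler_pMr // ler1n.
  near=> n.
  have -> : 'd (F n) z h = (t%:C)^-1 * 'd (F n) z (t%:C *: h) :> C.
    by rewrite linearZ; exact: (esym (mulKf tn0 _)).
  rewrite -mulrBr normcM normcV normc_real gtr0_norm // normcB ler_pdivrMl //.
  apply: (le_trans (so n _ (le_trans th tr))).
  apply: (@le_trans _ _ (2 * M * (t / r) ^+ 2)).
    rewrite ler_wpM2l ?mulr_ge0 // ler_pXn2r ?nnegrE ?divr_ge0 ?rnorm_ge0 ?(ltW r0) ?(ltW t0) //.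
    by rewrite ler_pM2r ?invr_gt0.
  apply: (@le_trans _ _ (t * (t * K))); last by rewrite ler_pM2l.
  have -> : 2 * M * (t / r) ^+ 2 = t * (t * (2 * M / r ^+ 2)).
    by field; rewrite gt_eqF.
  by rewrite !ler_pM2l // lerDl.
have cvgD i : exists l, ctends (fun n => 'd (F n) z (delta_mx 0 i) : C) l.
  apply: cvgL; apply: rnorm_le => // j; rewrite mxE eqxx /=.
  by case: (j == i); rewrite ?normc1 ?normc0.
have [D DP] := choice cvgD.
have Ld h : ctends (fun n => 'd (F n) z h : C) (dotv D h).
  under eq_fun do rewrite linear_dotv.
  by apply: ctends_sum => i; exact: ctendsZ.
apply: (@rnorm_differentiable _ _ _ f (dotv D)); first exact: dotv_continuous.
move=> e e0; pose K := 2 * M / r ^+ 2 + 1.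
have K0 : 0 < K by rewrite ltr_wpDl // divr_ge0 ?sqr_ge0 // mulr_ge0.
exists (Num.min (r / 2) (e / K)) => [|h].
  by rewrite lt_min !divr_gt0.
rewrite lt_min => /andP[/ltW hr /ltW he].
apply: (@le_trans _ _ (2 * M * (rnorm h / r) ^+ 2)).
  apply: (ctends_le (ctendsB (ctendsB (Ff h _) Fz) (Ld h))).
    by rewrite (le_trans hr) // ler_pdivrMr // ler_pMr // ler1n.
  by near=> n; exact: so.
rewrite ler_pdivlMr // in he.
rewrite expr_div_n [rnorm h ^+ 2]expr2 !mulrA.
have -> : 2 * M * rnorm h * rnorm h / r ^+ 2 = rnorm h * (2 * M / r ^+ 2) * rnorm h by ring.
rewrite ler_wpM2r ?rnorm_ge0 // (le_trans _ he) // ler_wpM2l ?rnorm_ge0 //.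
by rewrite lerDl.
Unshelve. all: by end_near. Qed.

End limits_of_differentiable_functions.

(** * Integration on C^m *)

Section measure_preserving.
Variable R : realType.
Local Open Scope ereal_scope.

(** Invariance of the measure, phrased by integrals of nonnegative functions so that Tonelli's
    theorem carries it to products and shears. *)
Definition preserving (E : mspace R) (phi : ms_type E -> ms_type E) : Prop :=
  measurable_fun setT phi /\
  forall f : ms_type E -> \bar R, measurable_fun setT f -> (forall x, 0 <= f x) ->
    \int[ms_meas E]_x f (phi x) = \int[ms_meas E]_x f x.

Lemma preserving_id (E : mspace R) : @preserving E id.
Proof. by split => // f mf f0. Qed.

Lemma preserving_comp (E : mspace R) (phi psi : ms_type E -> ms_type E) :
  preserving phi -> preserving psi -> preserving (fun x => phi (psi x)).
Proof.
move=> [mphi iphi] [mpsi ipsi]; split; first exact: (measurableT_comp mphi).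
move=> f mf f0; rewrite (ipsi (fun x => f (phi x))) ?iphi //.
exact: (measurableT_comp mf).
Qed.

Lemma preserving_pair (E F : mspace R) (phi : ms_type E -> ms_type E)
    (psi : ms_type F -> ms_type F) :
  preserving phi -> preserving psi ->
  @preserving (mspace_prod E F) (fun p => (phi p.1, psi p.2)).
Proof.
move=> [mphi iphi] [mpsi ipsi].
have mpair : measurable_fun setT (fun p : ms_type E * ms_type F => (phi p.1, psi p.2)).
  by apply: measurable_fun_pair; exact: measurableT_comp.
split=> // f mf f0; rewrite /= /sfprod.
rewrite (fubini_tonelli1 (fun p : ms_type E * ms_type F => f (phi p.1, psi p.2))) //; last first.
  exact: (measurableT_comp mf mpair).
rewrite (fubini_tonelli1 f) //.
rewrite -[RHS](iphi (fun x => \int[ms_meas F]_y f (x, y))); first last.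
- by move=> x; apply: integral_ge0.
- exact: measurable_fun_fubini_tonelli_F.
apply: eq_integral => x _; apply: (ipsi (fun y => f (phi x, y))) => //.
exact: (measurableT_comp mf (pair1_measurable (phi x))).
Qed.

(** For fixed y the map acts on the first factor alone, so the inner integral in Tonelli's theorem
    is unchanged. *)
Lemma preserving_shear1 (E F : mspace R) (phi : ms_type F -> ms_type E -> ms_type E) :
  measurable_fun setT (fun p : ms_type E * ms_type F => phi p.2 p.1) ->
  (forall y, preserving (phi y)) ->
  @preserving (mspace_prod E F) (fun p => (phi p.2 p.1, p.2)).
Proof.
move=> mphi iphi.
have mpair : measurable_fun setT (fun p : ms_type E * ms_type F => (phi p.2 p.1, p.2)).
  by apply: measurable_fun_pair.
split=> // f mf f0; rewrite /= /sfprod.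
rewrite (fubini_tonelli2 (fun p : ms_type E * ms_type F => f (phi p.2 p.1, p.2))) //; last first.
  exact: (measurableT_comp mf mpair).
rewrite (fubini_tonelli2 f) //.
apply: eq_integral => y _; apply: (iphi y).2 (fun x => f (x, y)) _ _ => //.
exact: (measurableT_comp mf (pair2_measurable y)).
Qed.

Lemma preserving_shear2 (E F : mspace R) (phi : ms_type E -> ms_type F -> ms_type F) :
  measurable_fun setT (fun p : ms_type E * ms_type F => phi p.1 p.2) ->
  (forall x, preserving (phi x)) ->
  @preserving (mspace_prod E F) (fun p => (p.1, phi p.1 p.2)).
Proof.
move=> mphi iphi.
have mpair : measurable_fun setT (fun p : ms_type E * ms_type F => (p.1, phi p.1 p.2)).
  by apply: measurable_fun_pair.
split=> // f mf f0; rewrite /= /sfprod.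
rewrite (fubini_tonelli1 (fun p : ms_type E * ms_type F => f (p.1, phi p.1 p.2))) //; last first.
  exact: (measurableT_comp mf mpair).
rewrite (fubini_tonelli1 f) //.
apply: eq_integral => x _; apply: (iphi x).2 (fun y => f (x, y)) _ _ => //.
exact: (measurableT_comp mf (pair1_measurable x)).
Qed.

(** The image measure agrees with Lebesgue measure on half-open intervals, which determine it. *)
Lemma preserving_translation (a : R) : @preserving (lebesgueR R) (fun x => x + a)%R.
Proof.
pose phi (x : measurableTypeR R) : measurableTypeR R := (x + a)%R.
have mphi : measurable_fun setT phi by apply: measurable_funD.
split=> // f mf f0 /=.
have leb_phi A : measurable A ->
    (@lebesgue_measure R) A = pushforward (@lebesgue_measure R) phi A.
  apply: lebesgue_measure_unique => _ [[u v] _ <-] /=.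
  rewrite /pushforward.
  have -> : phi @^-1` `]u, v]%classic = `](u - a)%R, (v - a)%R]%classic.
    by apply/seteqP; split=> x /=; rewrite !in_itv /= /phi ltrBlDr lerBrDr.
  by rewrite !lebesgue_measure_itv /= !lte_fin ltrD2r -!EFinB opprB addrA subrK.
transitivity (\int[pushforward (@lebesgue_measure R) phi]_x f x).
  by rewrite ge0_integral_pushforward // preimage_setT.
by apply: eq_measure_integral => A mA _; exact: esym (leb_phi A mA).
Qed.

End measure_preserving.

Arguments coordinates : simpl never.

(** * Lebesgue measure on C^m: rotations, cubes, measurability *)

Section lebesgue_Cn.
Variable R : realType.
Local Notation C := (R[i]).

Definition preservingC (phi : C -> C) : Prop :=
  @preserving R (mspace_prod (lebesgueR R) (lebesgueR R))
    (fun p => (complex.Re (phi (p.1 +i* p.2)), complex.Im (phi (p.1 +i* p.2)))).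

Lemma preservingC_id : preservingC id.
Proof.
rewrite /preservingC (_ : (fun _ => _) = id); first exact: preserving_id.
by apply/funext => -[].
Qed.

Lemma preservingC_comp phi psi : preservingC phi -> preservingC psi ->
  preservingC (fun z => phi (psi z)).
Proof.
move=> hphi hpsi; have := preserving_comp hphi hpsi; rewrite /preservingC.
congr preserving; apply/funext => p /=.
by rewrite (_ : _ +i* _ = psi (p.1 +i* p.2)) //; case: (psi _).
Qed.

Lemma preservingC_translation (c : C) : preservingC (fun z => z + c).
Proof.
case: c => a b; have := preserving_pair (preserving_translation a) (preserving_translation b).
by [].
Qed.

(** A rotation by theta is a product of three shears, x - t y, then y + b x, then x - t y again,
    with b = sin theta and t = b / (1 + a) = tan (theta / 2). Each shear is a translation on the
    fibres. *)
Lemma preservingC_rotation (u : C) : normc u = 1 -> preservingC (fun z => u * z).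
Proof.
have rot (a b : R) : a ^+ 2 + b ^+ 2 = 1 -> 1 + a != 0 ->
    preservingC (fun z => (a +i* b) * z).
  move=> ab a1; pose t := b / (1 + a).
  have sh1 : @preserving R (mspace_prod (lebesgueR R) (lebesgueR R))
      (fun p => (p.1 + - t * p.2, p.2)).
    apply: (@preserving_shear1 _ (lebesgueR R) (lebesgueR R) (fun y x => x + - t * y)).
      by apply: measurable_funD => //; exact: measurable_funM.
    by move=> y; exact: preserving_translation.
  have sh2 : @preserving R (mspace_prod (lebesgueR R) (lebesgueR R))
      (fun p => (p.1, p.2 + b * p.1)).
    apply: (@preserving_shear2 _ (lebesgueR R) (lebesgueR R) (fun x y => y + b * x)).
      by apply: measurable_funD => //; exact: measurable_funM.
    by move=> y; exact: preserving_translation.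
  have := preserving_comp sh1 (preserving_comp sh2 sh1); rewrite /preservingC.
  congr preserving; apply/funext => -[x y] /=.
  have bb : b * b = (1 - a) * (1 + a) by move: ab; rewrite !expr2 => ab; lra.
  have tb : t * b = 1 - a by rewrite /t mulrAC bb mulfK.
  have ta : t * (1 + a) = b by rewrite /t divfK.
  have E : y + b * (x + - t * y) = b * x + a * y.
    have -> : y + b * (x + - t * y) = b * x + (1 - t * b) * y by ring.
    by rewrite tb; ring.
  rewrite E; congr (_, _); last by ring.
  have -> : x + - t * y + - t * (b * x + a * y) = (1 - t * b) * x - t * (1 + a) * y by ring.
  by rewrite tb ta; ring.
case: u => a b nu; have {nu} ab : a ^+ 2 + b ^+ 2 = 1.
  have : normc (a +i* b) ^+ 2 = 1 by rewrite nu expr1n.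
  by rewrite /normc sqr_sqrtr ?addr_ge0 ?sqr_ge0.
(* For the half-turn tan (theta / 2) is infinite; it is the square of the quarter-turn. *)
have [a1|] := eqVneq (1 + a) 0; last exact: rot.
have aE : a = -1 by apply/eqP; rewrite -subr_eq0 opprK addrC a1.
have bE : b = 0.
  by move/eqP: ab; rewrite aE sqrrN expr1n -subr_eq0 addrC addKr sqrf_eq0 => /eqP.
have i1 : preservingC (fun z => (0 +i* 1) * z).
  by apply: rot; rewrite ?expr0n ?expr1n ?add0r ?addr0 ?oner_eq0.
have := preservingC_comp i1 i1; congr preservingC; apply/funext => z.
rewrite aE bE mulrA; congr (_ * _); apply/eqP.
by rewrite eq_complex /= !mul0r !mulr0 mul1r !addr0 sub0r !eqxx.
Qed.

Lemma coordinatesS m (t : ms_type (lebesgueCn R m.+1)) :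
  coordinates t = \row_i (if unlift ord0 i is Some j then coordinates t.2 0 j
                          else t.1.1 +i* t.1.2).
Proof. by []. Qed.

Lemma coordwise_preserving m (phi : 'I_m -> C -> C) : (forall i, preservingC (phi i)) ->
  exists Phi : ms_type (lebesgueCn R m) -> ms_type (lebesgueCn R m),
    preserving Phi /\
    forall t, coordinates (Phi t) = \row_i phi i (coordinates t 0 i).
Proof.
elim: m phi => [|m IH] phi hphi.
  exists id; split; first exact: preserving_id.
  by move=> t; apply/rowP => -[].
have [Phi [hPhi PhiE]] := IH (fun j => phi (lift ord0 j)) (fun j => hphi _).
exists (fun t => ((complex.Re (phi ord0 (t.1.1 +i* t.1.2)),
                   complex.Im (phi ord0 (t.1.1 +i* t.1.2))), Phi t.2)); split.
  exact: (preserving_pair (hphi ord0) hPhi).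
move=> t; apply/rowP => i; rewrite !coordinatesS !mxE /=; case: unliftP => [j ->|->].
  by rewrite PhiE mxE.
by case: (phi _ _).
Qed.

Lemma measurable_coordinates m (i : 'I_m) :
  measurable_fun setT (fun t : ms_type (lebesgueCn R m) =>
    complex.Re (coordinates t 0 i)) /\
  measurable_fun setT (fun t : ms_type (lebesgueCn R m) =>
    complex.Im (coordinates t 0 i)).
Proof.
elim: m i => [[]//|m IH] i.
have [j ->|->] := unliftP ord0 i.
  have [mRe mIm] := IH j; split.
    rewrite (_ : (fun _ => _) = (fun t => complex.Re (coordinates t 0 j)) \o snd).
      exact: (measurableT_comp mRe measurable_snd).
    by apply/funext => t /=; rewrite coordinatesS !mxE liftK.
  rewrite (_ : (fun _ => _) = (fun t => complex.Im (coordinates t 0 j)) \o snd).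
    exact: (measurableT_comp mIm measurable_snd).
  by apply/funext => t /=; rewrite coordinatesS !mxE liftK.
split.
  rewrite (_ : (fun _ => _) = fst \o fst).
    by apply: measurableT_comp; [exact: measurable_fst|exact: measurable_fst].
  by apply/funext => t /=; rewrite coordinatesS !mxE unlift_none.
rewrite (_ : (fun _ => _) = snd \o fst).
  by apply: measurableT_comp; [exact: measurable_snd|exact: measurable_fst].
by apply/funext => t /=; rewrite coordinatesS !mxE unlift_none.
Qed.

Lemma in_itv_norm (x c e : R) : (x \in `]c - e, c + e[) = (`|x - c| < e).
Proof. by rewrite in_itv /= ltr_norml; apply/andP/andP => -[? ?]; split; lra. Qed.

Lemma ReB (x y : C) : complex.Re (x - y) = complex.Re x - complex.Re y.
Proof. by case: x y => [? ?] []. Qed.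

Lemma ImB (x y : C) : complex.Im (x - y) = complex.Im x - complex.Im y.
Proof. by case: x y => [? ?] []. Qed.

(** A product of intervals in the real coordinates. Its volume is explicit, which serves to estimate
    other volumes, and cubes with rational centres exhaust open sets. *)
Definition cube m (z : Cn R m) (e : R) : set (ms_type (lebesgueCn R m)) :=
  [set t | forall i, `|complex.Re (coordinates t 0 i - z 0 i)| < e /\
                     `|complex.Im (coordinates t 0 i - z 0 i)| < e].

Lemma measurable_cube m (z : Cn R m) e : measurable (cube z e).
Proof.
pose itv (c : R) : set (measurableTypeR R) := `]c - e, c + e[%classic.
have -> : cube z e = \bigcap_(i in [set: 'I_m])
   ((fun t => complex.Re (coordinates t 0 i)) @^-1` itv (complex.Re (z 0 i)) `&`
    (fun t => complex.Im (coordinates t 0 i)) @^-1` itv (complex.Im (z 0 i))).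
  apply/seteqP; split=> t tz i.
    by move=> _; have [h1 h2] := tz i; split; rewrite /itv /= in_itv_norm -?ReB -?ImB.
  by have [] := tz i I; rewrite /itv /= !in_itv_norm ReB ImB.
apply: fin_bigcap_measurable; first exact: finite_finset.
move=> i _; have [mRe mIm] := measurable_coordinates i.
apply: measurableI; rewrite -[X in measurable X]setTI.
  by apply: mRe => //; exact: measurable_itv.
by apply: mIm => //; exact: measurable_itv.
Qed.

Lemma cube_measure m (z : Cn R m) (e : R) : 0 < e ->
  ms_meas (lebesgueCn R m) (cube z e) = ((2 * e * (2 * e)) ^+ m)%:E.
Proof.
move=> e0; elim: m z => [|m IH] z.
  rewrite (_ : cube z e = setT) /= ?diracT ?expr0 //.
  by apply/seteqP; split=> // t _ [].
pose itv (c : R) : set (measurableTypeR R) := `]c - e, c + e[%classic.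
have IE (c : R) : (@lebesgue_measure R (itv c) = (2 * e)%:E)%E.
  rewrite lebesgue_measure_itv /= lte_fin ifT; last by lra.
  by rewrite -EFinB; congr EFin; ring.
have -> : cube z e = (itv (complex.Re (z 0 ord0)) `*` itv (complex.Im (z 0 ord0))) `*`
    cube (\row_j z 0 (lift ord0 j)) e.
  apply/seteqP; split=> t tz.
    split; last by move=> j; have := tz (lift ord0 j); rewrite coordinatesS !mxE liftK.
    have := tz ord0; rewrite coordinatesS !mxE unlift_none ReB ImB => -[h1 h2].
    by split; rewrite /itv /= in_itv_norm.
  move=> i; case: tz => -[h1 h2] h3; rewrite coordinatesS !mxE.
  case: unliftP => [j ->|->]; first by have := h3 j; rewrite !mxE.
  by rewrite ReB ImB /=; move: h1 h2; rewrite /itv /= !in_itv_norm.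
rewrite /= /sfprod product_measure1E; last 2 first.
- by apply: measurableX; exact: measurable_itv.
- exact: measurable_cube.
rewrite /= /sfprod product_measure1E; last 2 first.
- exact: measurable_itv.
- exact: measurable_itv.
by rewrite /= !IE IH -!EFinM exprS.
Qed.

Lemma cube_rnorm m (z : Cn R m) e (t : ms_type (lebesgueCn R m)) : 0 < e ->
  cube z e t -> rnorm (coordinates t - z) <= 2 * e.
Proof.
move=> e0 tz; apply: rnorm_le => [|i]; first by rewrite mulr_ge0 // ltW.
have [h1 h2] := tz i; rewrite !mxE; apply: (le_trans (normc_le_ReIm _)).
by rewrite mulr_natl mulr2n lerD // ltW.
Qed.

(** The sigma-algebra is a product one, so an open set is shown to be the union of the countably
    many cubes with rational centres and half-sides 1 / (k + 1) that it contains. *)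
Lemma measurable_open m (U : set (Cn R m)) :
  (forall z, U z -> exists2 d : R, 0 < d & forall h, rnorm h < d -> U (z + h)) ->
  measurable (@coordinates R m @^-1` U).
Proof.
move=> Uopen; pose J := ({ffun 'I_m -> rat * rat} * nat)%type.
pose ctr (j : J) : Cn R m := \row_i (ratr (j.1 i).1 +i* ratr (j.1 i).2).
pose K (j : J) := cube (ctr j) (j.2.+1%:R^-1).
have -> : @coordinates R m @^-1` U = \bigcup_(j in [set: J])
    (if pselect (K j `<=` @coordinates R m @^-1` U) then K j else set0).
  apply/seteqP; split=> t; last first.
    by move=> [j _]; case: pselect => // h /h.
  move=> Ut; have [d d0 dU] := Uopen _ Ut.
  (* Two points of a cube of half-side 1 / (k + 1) are each within 2 / (k + 1) of its centre. *)
  have [k kd] : exists k : nat, 4 / k.+1%:R < d.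
    have := archi_boundP (divr_ge0 (ler0n R 4) (ltW d0)); set b := Num.bound _.
    rewrite ltr_pdivrMr // => bd; exists b; rewrite ltr_pdivrMr ?ltr0n // mulrC.
    by apply: (lt_trans bd); rewrite ltr_pM2r // ltr_nat.
  have k0 : 0 < (k.+1%:R : R)^-1 by rewrite invr_gt0.
  have near_rat (r x : R) : 0 < r -> exists q : rat, `|x - ratr q| < r.
    move=> r0; have /rat_in_itvoo[q] : x - r < x + r by lra.
    by rewrite in_itv /= => /andP[q1 q2]; exists q; rewrite ltr_norml; apply/andP; split; lra.
  have /choice[q qP] (i : 'I_m) : exists q : rat * rat,
      `|complex.Re (coordinates t 0 i) - ratr q.1| < k.+1%:R^-1 /\
      `|complex.Im (coordinates t 0 i) - ratr q.2| < k.+1%:R^-1.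
    have [q1 h1] := near_rat _ (complex.Re (coordinates t 0 i)) k0.
    by have [q2 h2] := near_rat _ (complex.Im (coordinates t 0 i)) k0; exists (q1, q2).
  have Kt : K ([ffun i => q i], k) t.
    by move=> i; have := qP i; rewrite /ctr !mxE /= ffunE; case: (coordinates t 0 i).
  exists ([ffun i => q i], k) => //; case: pselect => // -[] t' Kt'.
  rewrite /= -[coordinates t'](subrKC (coordinates t)); apply: dU.
  apply: le_lt_trans kd; rewrite -(subrKA (ctr ([ffun i => q i], k))).
  apply: (@le_trans _ _ (2 / k.+1%:R + 2 / k.+1%:R)); last by rewrite -mulrDl -natrD.
  rewrite -lecR -rnormE (le_trans (ler_normD _ _)) // rmorphD lerD //.
    by rewrite rnormE lecR; exact: cube_rnorm Kt'.
  by rewrite -normrN opprB rnormE lecR; exact: cube_rnorm Kt.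
apply: countable_bigcupT_measurable => [|j].
  exact: (@countableP ({ffun 'I_m -> rat * rat} * nat)%type).
by case: pselect => h; [exact: measurable_cube|exact: measurable0].
Qed.

Lemma measurable_coord_ball m : measurable (@coord_ball R m).
Proof. by apply: (@measurable_open m [set z | in_ball z]) => z; exact: in_ball_open. Qed.

Lemma measurable_continuous m (f : Cn R m -> R) (U : set (Cn R m)) :
  (forall z, U z -> exists2 d : R, 0 < d & forall h, rnorm h < d -> U (z + h)) ->
  (forall z, U z -> forall e : R, 0 < e ->
     exists2 d : R, 0 < d & forall h, rnorm h < d -> `|f (z + h) - f z| < e) ->
  measurable_fun (@coordinates R m @^-1` U) (f \o @coordinates R m).
Proof.
move=> Uopen fc; apply: (measurability _ (RGenOInfty.measurableE R)) => _ [_ [a ->] <-].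
rewrite preimage_itvoy; apply: (@measurable_open m [set z | U z /\ a < f z]) => z [Uz fz].
have [d d0 dU] := Uopen z Uz.
have e0 : 0 < f z - a by rewrite subr_gt0.
have [d' d'0 df] := fc z Uz _ e0.
exists (Num.min d d') => [|h]; first by rewrite lt_min d0.
rewrite lt_min => /andP[hd hd']; split; first exact: dU.
have := df h hd'; rewrite ltr_norml => /andP[+ _]; lra.
Qed.

End lebesgue_Cn.

(** * Square integrable complex functions *)

Section square_integrable.
Context (R : realType) (d : measure_display) (T : measurableType d).
Variables (mu : {measure set T -> \bar R}) (D : set T).
Hypothesis mD : measurable D.
Local Notation C := (R[i]).
Implicit Types (f g h : T -> C).

Definition cmeasurable h :=
  measurable_fun D (fun t => complex.Re (h t)) /\ measurable_fun D (fun t => complex.Im (h t)).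

Definition sqint h : \bar R := (\int[mu]_(t in D) (normc (h t) ^+ 2)%:E)%E.

Definition square_integrable h := cmeasurable h /\ (sqint h < +oo)%E.

Definition cintegrable h :=
  mu.-integrable D (fun t => (complex.Re (h t))%:E) /\
  mu.-integrable D (fun t => (complex.Im (h t))%:E).

Definition cint h : C := Rintegral mu D (fun t => complex.Re (h t)) +i*
                         Rintegral mu D (fun t => complex.Im (h t)).

Lemma normc_sq (z : C) : normc z ^+ 2 = complex.Re z ^+ 2 + complex.Im z ^+ 2.
Proof. by case: z => a b; rewrite /normc sqr_sqrtr ?addr_ge0 ?sqr_ge0. Qed.

Lemma ReD (x y : C) : complex.Re (x + y) = complex.Re x + complex.Re y.
Proof. by case: x y => [? ?] []. Qed.

Lemma ImD (x y : C) : complex.Im (x + y) = complex.Im x + complex.Im y.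
Proof. by case: x y => [? ?] []. Qed.

Lemma ReM (x y : C) :
  complex.Re (x * y) = complex.Re x * complex.Re y - complex.Im x * complex.Im y.
Proof. by case: x y => [? ?] []. Qed.

Lemma ImM (x y : C) :
  complex.Im (x * y) = complex.Re x * complex.Im y + complex.Im x * complex.Re y.
Proof. by case: x y => [? ?] []. Qed.

Lemma cmeasurable_cst (c : C) : cmeasurable (fun=> c).
Proof. by split; exact: measurable_cst. Qed.

Lemma cmeasurableD f g : cmeasurable f -> cmeasurable g ->
  cmeasurable (fun t => f t + g t).
Proof.
move=> [f1 f2] [g1 g2]; split.
  by under eq_fun do rewrite ReD; exact: measurable_funD.
by under eq_fun do rewrite ImD; exact: measurable_funD.
Qed.

Lemma cmeasurableM f g : cmeasurable f -> cmeasurable g ->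
  cmeasurable (fun t => f t * g t).
Proof.
move=> [f1 f2] [g1 g2]; split.
  by under eq_fun do rewrite ReM; apply: measurable_funB; exact: measurable_funM.
by under eq_fun do rewrite ImM; apply: measurable_funD; exact: measurable_funM.
Qed.

Lemma cmeasurableZ (c : C) f : cmeasurable f -> cmeasurable (fun t => c * f t).
Proof. by move=> mf; apply: cmeasurableM => //; exact: cmeasurable_cst. Qed.

Lemma cmeasurable_conj f : cmeasurable f -> cmeasurable (fun t => conjc (f t)).
Proof.
move=> [f1 f2]; split.
  by apply: eq_measurable_fun f1 => t _; case: (f t).
rewrite (_ : (fun _ => _) = (fun t => - complex.Im (f t))).
    exact: measurable_funN.
by apply/funext => t; case: (f t).
Qed.

Lemma cmeasurable_sum I (r : seq I) (F : I -> T -> C) :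
  (forall i, cmeasurable (F i)) -> cmeasurable (fun t => \sum_(i <- r) F i t).
Proof.
move=> mF; elim: r => [|i r IH].
  by under eq_fun do rewrite big_nil; exact: cmeasurable_cst.
by under eq_fun do rewrite big_cons; exact: cmeasurableD.
Qed.

Lemma measurable_normc_sq f : cmeasurable f ->
  measurable_fun D (fun t => normc (f t) ^+ 2).
Proof.
move=> [f1 f2]; under eq_fun do rewrite normc_sq.
by apply: measurable_funD; exact: measurable_funX.
Qed.

Lemma sqint_ge0 f : (0 <= sqint f)%E.
Proof. by apply: integral_ge0 => t _; rewrite lee_fin sqr_ge0. Qed.

Lemma sqintE f : square_integrable f -> sqint f = (fine (sqint f))%:E.
Proof.
by move=> [_ foo]; rewrite fineK // ge0_fin_numE // sqint_ge0.
Qed.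

Lemma le_sqint f g (c : R) : cmeasurable f -> cmeasurable g ->
  (forall t, D t -> normc (f t) ^+ 2 <= c * normc (g t) ^+ 2) -> 0 <= c ->
  (sqint f <= c%:E * sqint g)%E.
Proof.
move=> mf mg fg c0; have mg2 := measurable_normc_sq mg; rewrite /sqint.
rewrite -ge0_integralZl_EFin //; first last.
- by apply/measurable_EFinP; exact: measurable_normc_sq.
- by move=> t _; rewrite lee_fin sqr_ge0.
apply: ge0_le_integral => //.
- by move=> t _; rewrite lee_fin sqr_ge0.
- by apply/measurable_EFinP; exact: measurable_normc_sq.
- have h : measurable_fun D (fun t => (c * normc (g t) ^+ 2)%:E).
    by apply/measurable_EFinP; exact: measurable_funM.
  exact: h.
Qed.

Lemma sqintZ c f : cmeasurable f ->
  sqint (fun t => c * f t) = ((normc c ^+ 2)%:E * sqint f)%E.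
Proof.
move=> mf; rewrite /sqint -ge0_integralZl_EFin ?sqr_ge0 //.
- by apply: eq_integral => t _; rewrite normcM exprMn.
- by move=> t _; rewrite lee_fin sqr_ge0.
- by apply/measurable_EFinP; exact: measurable_normc_sq.
Qed.

Lemma normc_sqD (x y : C) : normc (x + y) ^+ 2 <= 2 * normc x ^+ 2 + 2 * normc y ^+ 2.
Proof.
apply: (@le_trans _ _ ((normc x + normc y) ^+ 2)).
  by rewrite ler_pXn2r ?nnegrE ?addr_ge0 ?normc_ge0 // normcD.
by have := sqr_ge0 (normc x - normc y); rewrite sqrrB sqrrD; lra.
Qed.

Lemma sqintD f g : cmeasurable f -> cmeasurable g ->
  (sqint (fun t => f t + g t)%R <= 2%:E * sqint f + 2%:E * sqint g)%E.
Proof.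
move=> mf mg; have mf2 := measurable_normc_sq mf; have mg2 := measurable_normc_sq mg.
have m2 (u : T -> R) : measurable_fun D u -> measurable_fun D (fun t => 2%:E * (u t)%:E)%E.
  move=> mu2; have h : measurable_fun D (fun t => (2 * u t)%:E).
    by apply/measurable_EFinP; exact: measurable_funM.
  exact: h.
rewrite /sqint -!ge0_integralZl_EFin //; try by move=> t _; rewrite lee_fin sqr_ge0.
- rewrite -ge0_integralD //.
  + apply: ge0_le_integral => //.
    * by move=> t _; rewrite lee_fin sqr_ge0.
    * by apply/measurable_EFinP/measurable_normc_sq; exact: cmeasurableD.
    * by apply: emeasurable_funD; exact: m2.
    * by move=> t Dt; rewrite -!EFinM -EFinD lee_fin normc_sqD.
  + by move=> t _; rewrite -EFinM lee_fin mulr_ge0 // sqr_ge0.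
  + exact: m2.
  + by move=> t _; rewrite -EFinM lee_fin mulr_ge0 // sqr_ge0.
  + exact: m2.
- exact/measurable_EFinP.
- exact/measurable_EFinP.
Qed.

Lemma square_integrableD f g : square_integrable f -> square_integrable g ->
  square_integrable (fun t => f t + g t).
Proof.
move=> [mf fo] [mg go]; split; first exact: cmeasurableD.
apply: (le_lt_trans (sqintD mf mg)); rewrite lte_add_pinfty // lte_mul_pinfty //.
Qed.

Lemma square_integrableZ c f : square_integrable f ->
  square_integrable (fun t => c * f t).
Proof.
move=> [mf fo]; split; first exact: cmeasurableZ.
by rewrite sqintZ // lte_mul_pinfty // lee_fin sqr_ge0.
Qed.

Lemma normc_mul_le (x y : C) : normc (x * y) <= normc x ^+ 2 + normc y ^+ 2.
Proof.
rewrite normcM; have := sqr_ge0 (normc x - normc y); rewrite sqrrB.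
have := sqr_ge0 (normc x); have := sqr_ge0 (normc y); lra.
Qed.

Lemma square_integrableM f g : square_integrable f -> square_integrable g ->
  cintegrable (fun t => f t * g t).
Proof.
move=> [mf fo] [mg go].
have mf2 := measurable_normc_sq mf; have mg2 := measurable_normc_sq mg.
have int2 : mu.-integrable D (fun t => (normc (f t) ^+ 2 + normc (g t) ^+ 2)%:E).
  under eq_fun do rewrite EFinD.
  apply: integrableD => //.
    apply/integrableP; split; first exact/measurable_EFinP.
    by under eq_integral do rewrite gee0_abs ?lee_fin ?sqr_ge0 //.
  apply/integrableP; split; first exact/measurable_EFinP.
  by under eq_integral do rewrite gee0_abs ?lee_fin ?sqr_ge0 //.
have [mRe mIm] := cmeasurableM mf mg.
split.
  apply: (le_integrable mD _ _ int2); first exact/measurable_EFinP.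
  move=> t Dt /=; rewrite lee_fin [leRHS]ger0_norm ?addr_ge0 ?sqr_ge0 //.
  by rewrite (le_trans (normc_Re _)) // normc_mul_le.
apply: (le_integrable mD _ _ int2); first exact/measurable_EFinP.
move=> t Dt /=; rewrite lee_fin [leRHS]ger0_norm ?addr_ge0 ?sqr_ge0 //.
by rewrite (le_trans (normc_Im _)) // normc_mul_le.
Qed.

Lemma square_integrable_conj f : square_integrable f ->
  square_integrable (fun t => conjc (f t)).
Proof.
move=> [mf fo]; split; first exact: cmeasurable_conj.
by rewrite /sqint; under eq_integral do rewrite normc_conj.
Qed.

Lemma cintD f g : cintegrable f -> cintegrable g ->
  cint (fun t => f t + g t) = cint f + cint g.
Proof.
move=> [f1 f2] [g1 g2]; rewrite /cint.
under eq_Rintegral do rewrite ReD.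
under [X in _ +i* X]eq_Rintegral do rewrite ImD.
by rewrite !RintegralD.
Qed.

Lemma cintegrableZ c f : cintegrable f -> cintegrable (fun t => c * f t).
Proof.
move=> [f1 f2]; split.
  under eq_fun do rewrite ReM EFinB !EFinM.
  by apply: integrableB => //; exact: integrableZl.
under eq_fun do rewrite ImM EFinD !EFinM.
by apply: integrableD => //; exact: integrableZl.
Qed.

Lemma cintZ c f : cintegrable f -> cint (fun t => c * f t) = c * cint f.
Proof.
move=> [f1 f2]; case: c => a b; rewrite /cint.
under eq_Rintegral do rewrite ReM /=.
under [X in _ +i* X]eq_Rintegral do rewrite ImM /=.
have i1 (x : R) : mu.-integrable D (fun t => (x * complex.Re (f t))%:E).
  by under eq_fun do rewrite EFinM; exact: integrableZl.
have i2 (x : R) : mu.-integrable D (fun t => (x * complex.Im (f t))%:E).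
  by under eq_fun do rewrite EFinM; exact: integrableZl.
by rewrite (RintegralB mD (i1 a) (i2 b)) (RintegralD mD (i2 a) (i1 b)) !RintegralZl.
Qed.

Lemma cint_conj f : cintegrable f -> cint (fun t => conjc (f t)) = conjc (cint f).
Proof.
move=> [f1 f2]; rewrite /cint /=; congr (_ +i* _).
  by apply: eq_Rintegral => t _; case: (f t).
rewrite -mulN1r -RintegralZl //; apply: eq_Rintegral => t _.
by case: (f t) => a b; rewrite mulN1r.
Qed.

Lemma Re_cint_sq f : complex.Re (cint (fun t => f t * conjc (f t))) = fine (sqint f).
Proof.
rewrite /cint /= /Rintegral; congr fine; apply: eq_integral => t _.
by congr EFin; case: (f t) => a b /=; rewrite normc_sq /=; ring.
Qed.

Lemma Im_cint_sq f : complex.Im (cint (fun t => f t * conjc (f t))) = 0.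
Proof.
rewrite /cint /= /Rintegral (_ : (\int[mu]_(t in D) _)%E = 0%E) //.
rewrite integral0_eq // => t _; congr EFin.
by case: (f t) => a b /=; ring.
Qed.

Lemma fatou_bound (u : nat -> T -> R) (v : T -> R) (c : \bar R) :
  (forall n, measurable_fun D (u n)) -> (forall n t, D t -> 0 <= u n t) ->
  (forall t, D t -> (fun n => u n t) @ \oo --> v t) ->
  (\forall n \near \oo, (\int[mu]_(t in D) (u n t)%:E <= c)%E) ->
  (\int[mu]_(t in D) (v t)%:E <= c)%E.
Proof.
move=> mu_ u0 uv uc.
have mu' n : measurable_fun D (fun t => (u n t)%:E) by apply/measurable_EFinP.
have u0' n t : D t -> (0 <= (u n t)%:E)%E by move=> Dt; rewrite lee_fin u0.
have := fatou mu mD mu' u0'.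
rewrite (_ : (\int[mu]_(x in D) limn_einf _)%E = (\int[mu]_(t in D) (v t)%:E)%E); last first.
  apply: eq_integral => t /set_mem Dt.
  have : (fun n => (u n t)%:E) @ \oo --> (v t)%:E by apply: cvg_EFin; [near=> n|exact: uv].
  by move=> /cvg_limn_einf_sup[].
move=> /le_trans; apply; rewrite limn_einf_lim.
apply: lime_le; first exact: is_cvg_einfs.
near=> n; apply: (@le_trans _ _ (\int[mu]_(t in D) (u n t)%:E)%E); last by near: n.
by apply: ereal_inf_lbound; exists n => //=.
Unshelve. all: by end_near. Qed.

End square_integrable.

Section preserving_cint.
Variable R : realType.
Local Notation C := (R[i]).

Lemma preserving_cmeasurable (E : mspace R) (phi : ms_type E -> ms_type E)
    (h : ms_type E -> C) : preserving phi ->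
  cmeasurable setT h -> cmeasurable setT (fun t => h (phi t)).
Proof. by move=> [mphi _] [h1 h2]; split;
  [exact: (measurableT_comp h1 mphi)|exact: (measurableT_comp h2 mphi)]. Qed.

(** [preserving] speaks of nonnegative functions, hence the passage through positive and negative
    parts. *)
Lemma preserving_Rintegral (E : mspace R) (phi : ms_type E -> ms_type E)
    (h : ms_type E -> R) : preserving phi -> measurable_fun setT h ->
  Rintegral (ms_meas E) setT (fun t => h (phi t)) = Rintegral (ms_meas E) setT h.
Proof.
move=> [_ iphi] mh; rewrite /Rintegral; congr fine.
have mh' : measurable_fun setT (fun t => (h t)%:E) by exact/measurable_EFinP.
rewrite integralE [in RHS]integralE; congr (_ - _)%E.
  rewrite -(iphi (funepos (fun t => (h t)%:E)) (measurable_funepos mh')) //.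
  by apply: eq_integral => t _; rewrite !funeposE.
rewrite -(iphi (funeneg (fun t => (h t)%:E)) (measurable_funeneg mh')) //.
by apply: eq_integral => t _; rewrite !funenegE.
Qed.

Lemma preserving_cint (E : mspace R) (phi : ms_type E -> ms_type E)
    (h : ms_type E -> C) : preserving phi -> cmeasurable setT h ->
  cint (ms_meas E) setT (fun t => h (phi t)) = cint (ms_meas E) setT h.
Proof.
by move=> pphi [h1 h2]; rewrite /cint (preserving_Rintegral pphi h1) (preserving_Rintegral pphi h2).
Qed.

Lemma preserving_sqint (E : mspace R) (phi : ms_type E -> ms_type E)
    (h : ms_type E -> C) : preserving phi -> cmeasurable setT h ->
  sqint (ms_meas E) setT (fun t => h (phi t)) = sqint (ms_meas E) setT h.
Proof.
move=> [_ iphi] mh; apply: (iphi (fun t => (normc (h t) ^+ 2)%:E)).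
  by apply/measurable_EFinP; exact: measurable_normc_sq.
by move=> t; rewrite lee_fin sqr_ge0.
Qed.

End preserving_cint.

(** * The Bergman space *)

Section ball_functions.
Variables (R : realType) (m : nat).
Local Notation C := (R[i]).
Local Notation V := (Cn R m).
Local Notation T := (ms_type (lebesgueCn R m)).
Local Notation mu := (ms_meas (lebesgueCn R m)).
Implicit Types (f g : V -> C^o) (z h : V).

Definition ball_holomorphic f :=
  (forall z, in_ball z -> differentiable f z) /\ (forall z, ~~ in_ball z -> f z = 0).

Definition lift f : T -> C := fun t => f (coordinates t).

(** f is continuous on the open ball and 0 outside it. *)
Lemma lift_cmeasurable f : ball_holomorphic f -> cmeasurable setT (lift f).
Proof.
move=> [fd f0].
have fc z : in_ball z -> forall e : R, 0 < e -> exists2 r : R, 0 < r &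
    forall h, rnorm h < r -> normc (f (z + h) - f z) < e.
  move=> zb e e0; have fz := differentiable_continuous (fd z zb).
  have fA : nbhs (f z) [set y : C^o | normc (y - f z : C) < e].
    apply/nbhs_rnormP; exists e => // h he.
    by rewrite /= [f z + h]addrC addrK.
  by have /nbhs_rnormP[r r0 fr] := fz _ fA; exists r.
have meas (p : C -> R) : (forall x y, `|p x - p y| <= normc (x - y)) -> p 0 = 0 ->
    measurable_fun setT (fun t => p (lift f t)).
  move=> p1 p0.
  rewrite (_ : (fun _ => _) = (fun t => p (lift f t)) \_ (@coord_ball R m)); last first.
    apply/funext => t; rewrite /patch; case: ifPn => // /negP tb.
    by rewrite /lift f0 ?p0 //; apply/negP => h; apply: tb; rewrite inE.
  apply/(measurable_restrictT _ (measurable_coord_ball R m)).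
  apply: (@measurable_continuous R m (fun z => p (f z)) [set z | in_ball z]).
    by move=> z; exact: in_ball_open.
  move=> z zb e e0; have [r r0 fr] := fc z zb e e0.
  by exists r => // h /fr; apply: le_lt_trans (p1 _ _).
by split; apply: meas => // x y; rewrite -?ReB -?ImB ?normc_Re ?normc_Im.
Qed.

(** As f vanishes off the ball, the integral may run over the whole space, where the
    measure-preserving maps act. *)
Lemma bergman_setE f : bergman_set f <->
  ball_holomorphic f /\ (sqint mu setT (lift f) < +oo)%E.
Proof.
suff E : (forall z, ~~ in_ball z -> f z = 0) -> sqint mu setT (lift f) =
    (\int[mu]_(t in @coord_ball R m) (normc (f (coordinates t)) ^+ 2)%:E)%E.
  by split=> [[fd f0 foo]|[[fd f0] foo]]; split; rewrite ?E // -E.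
move=> f0; rewrite [RHS]integral_mkcond; apply: eq_integral => t _.
rewrite /patch; case: ifPn => // /negP tb.
by rewrite /lift f0 ?normc0 ?expr0n //; apply/negP => h; apply: tb; rewrite inE.
Qed.

Lemma bergman_innerE f g : ball_holomorphic f ->
  bergman_inner f g = ((ball_volume R m)^-1)%:C *
    cint mu setT (fun t => lift f t * conjc (lift g t)).
Proof.
move=> [_ f0]; rewrite /bergman_inner /cint; congr (_ * (_ +i* _)).
  rewrite [LHS]Rintegral_mkcond; apply: eq_Rintegral => t _.
  rewrite /patch; case: ifPn => // /negP tb.
  rewrite /lift f0 ?mul0r //; apply/negP => h; apply: tb; rewrite inE //.
rewrite [LHS]Rintegral_mkcond; apply: eq_Rintegral => t _.
rewrite /patch; case: ifPn => // /negP tb.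
by rewrite /lift f0 ?mul0r //; apply/negP => h; apply: tb; rewrite inE.
Qed.

Lemma rnorm_cube z (e : R) : 0 < e -> cube z (e / 4) `<=` [set t | rnorm (coordinates t - z) < e].
Proof.
move=> e0 t /cube_rnorm h /=; have e4 : 0 < e / 4 by rewrite divr_gt0.
apply: (le_lt_trans (h e4)).
by rewrite mulrCA gtr_pMr // ltr_pdivrMr // mul1r ltr_nat.
Qed.

(** The ball lies between two cubes. *)
Lemma ball_volume_fin : 0 < ball_volume R m /\ mu (@coord_ball R m) = (ball_volume R m)%:E.
Proof.
have mB := measurable_coord_ball R m.
have Bc1 : @coord_ball R m `<=` cube 0 1.
  move=> t tb i; have := in_ball_coord i tb; rewrite mxE subr0 => h.
  by split; apply: le_lt_trans h; [exact: normc_Re|exact: normc_Im].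
have [r r0 rB] := in_ball_open (in_ball0 R m).
have cB : cube 0 (r / 4) `<=` @coord_ball R m.
  move=> t /(rnorm_cube r0) /= h; rewrite /coord_ball /= -[coordinates t]add0r.
  by apply: rB; rewrite subr0 in h.
have fin : mu (@coord_ball R m) \is a fin_num.
  rewrite ge0_fin_numE //; apply: (@le_lt_trans _ _ (mu (cube 0 1))).
    by apply: le_measure => //; rewrite inE //; exact: measurable_cube.
  by rewrite cube_measure // ltry.
split; last by rewrite /ball_volume fineK.
rewrite -lte_fin /ball_volume fineK //.
apply: (@lt_le_trans _ _ (mu (cube 0 (r / 4)))).
  rewrite cube_measure ?divr_gt0 // lte_fin exprn_gt0 // !mulr_gt0 // divr_gt0 //.
by apply: le_measure => //; rewrite inE //; exact: measurable_cube.
Qed.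

End ball_functions.

Lemma rnormD (R : realType) (W : normedModType (R[i])) (x y : W) :
  rnorm (x + y) <= rnorm x + rnorm y.
Proof.
by rewrite -lecR -rnormE (le_trans (ler_normD _ _)) // rmorphD lerD // rnormE.
Qed.

Lemma sum_ereal_const (R : realType) (c : \bar R) n : (0 <= c)%E ->
  (\sum_(i < n) c = n%:R%:E * c)%E.
Proof.
move=> c0; elim: n => [|n IH]; first by rewrite big_ord0 mul0e.
by rewrite big_ord_recr /= IH -{2}(mul1e c) -ge0_muleDl ?lee_fin // -EFinD natr1.
Qed.

(** * The sub-mean value inequality *)

Section sub_mean_value.
Variables (R : realType) (m : nat).
Local Notation C := (R[i]).
Local Notation V := (Cn R m).
Local Notation T := (ms_type (lebesgueCn R m)).
Local Notation mu := (ms_meas (lebesgueCn R m)).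
Implicit Types (f g : V -> C^o) (z h : V).

Lemma measurable_normc d (X : measurableType d) (D : set X) (h : X -> C) : measurable D ->
  cmeasurable D h -> measurable_fun D (fun t => normc (h t)).
Proof.
move=> mD mh; rewrite (_ : (fun _ => _) = Num.sqrt \o (fun t => normc (h t) ^+ 2)).
  apply: measurableT_comp; last exact: measurable_normc_sq.
  by apply: continuous_measurable_fun; exact: sqrt_continuous.
by apply/funext => t /=; rewrite sqrtr_sqr ger0_norm ?normc_ge0.
Qed.

Lemma rotation_about z (u : C) : normc u = 1 ->
  exists Phi : T -> T, preserving Phi /\
    forall t, coordinates (Phi t) = z + u *: (coordinates t - z).
Proof.
move=> u1; have [i|Phi [pPhi PhiE]] := @coordwise_preserving R m
    (fun i x => u * (x + - z 0 i) + z 0 i).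
  apply: (@preservingC_comp _ (fun x => x + z 0 i)); first exact: preservingC_translation.
  apply: (@preservingC_comp _ (fun x => u * x)); first exact: preservingC_rotation.
  exact: preservingC_translation.
exists Phi; split=> // t; rewrite PhiE; apply/rowP => i; rewrite !mxE.
exact: addrC.
Qed.

Lemma measurable_rnorm_ball z (r : R) : measurable [set t : T | rnorm (coordinates t - z) < r].
Proof.
apply: (@measurable_open R m [set w | rnorm (w - z) < r]) => w /= wr.
exists (r - rnorm (w - z)) => [|h hr]; first by rewrite subr_gt0.
have : rnorm (w + h - z) <= rnorm (w - z) + rnorm h.
  by rewrite addrAC rnormD.
lra.
Qed.

(** The volume of the cube of half-side r / 4, which fits into the polydisc of radius r. *)
Definition kappa (r : R) : R := (r / 2 * (r / 2)) ^+ m.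

(** Means of f^2 over the rotations of the polydisc about z by roots of unity tend pointwise to
    f(z)^2. By invariance of the measure the integral of their modulus is at most that of |f|^2, and
    Fatou's lemma passes to the limit. Averaging f^2 instead of f makes the triangle inequality
    produce |f|^2 directly. *)
Lemma sub_mean_value f z (r : R) : ball_holomorphic f -> 0 < r ->
  (forall h, rnorm h < r -> in_ball (z + h)) ->
  ((normc (f z) ^+ 2 * kappa r)%:E <= sqint mu setT (lift f))%E.
Proof.
move=> hf r0 zr; pose D := [set t : T | rnorm (coordinates t - z) < r].
have mD : measurable D := measurable_rnorm_ball z r.
have rot (p : nat * nat) : exists Phi : T -> T, preserving Phi /\
    forall t, coordinates (Phi t) = z + uroot R p.1 p.2 *: (coordinates t - z).
  by apply: rotation_about; exact: normc_uroot.
have [Phi PhiP] := choice rot.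
pose G (t : T) (s : C) : C := f (z + s *: (coordinates t - z)) ^+ 2.
pose g n t : R := \1_D t * normc (circ n (G t) 1).
pose F t : R := \1_D t * normc (lift f t) ^+ 2.
have mlf := lift_cmeasurable hf.
have mF : measurable_fun setT F.
  by apply: measurable_funM => //; exact: measurable_normc_sq.
have F0 t : 0 <= F t by rewrite mulr_ge0 ?sqr_ge0.
have GE n t (k : nat) : G t (1 * uroot R n k) = lift f (Phi (n, k) t) ^+ 2.
  by rewrite /G mul1r /lift (PhiP (n, k)).2.
have mg n : measurable_fun setT (g n).
  apply: measurable_funM => //; apply: measurable_normc => //.
  rewrite /circ; apply: cmeasurableZ; apply: cmeasurable_sum => k.
  rewrite (_ : (fun _ => _) = (fun t =>
    lift f (Phi (n, nat_of_ord k) t) * lift f (Phi (n, nat_of_ord k) t))).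
    by apply: cmeasurableM; exact: (preserving_cmeasurable (PhiP _).1 mlf).
  by apply/funext => t; rewrite GE expr2.
have D_Phi n k t : \1_D (Phi (n, k) t) = \1_D t :> R.
  have E : rnorm (coordinates (Phi (n, k) t) - z) = rnorm (coordinates t - z).
    by rewrite (PhiP (n, k)).2 addrAC subrr add0r rnormZ normc_uroot mul1r.
  rewrite !indicE; congr (nat_of_bool _)%:R.
  by apply/idP/idP; rewrite !inE /D /= E.
have gF n t : g n t <= (2 ^ n)%:R^-1 * \sum_(k < 2 ^ n) F (Phi (n, nat_of_ord k) t).
  under eq_bigr do rewrite /F D_Phi.
  rewrite -mulr_sumr mulrCA /g ler_wpM2l // /circ normcM normcV normc_nat.
  rewrite ler_wpM2l ?invr_ge0 ?ler0n // (le_trans (normc_sum _ _ _)) //.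
  by apply: ler_sum => k _; rewrite GE normcX.
have intF n : (\int[mu]_t (g n t)%:E <= sqint mu setT (lift f))%E.
  have mFP k : measurable_fun setT (fun t => F (Phi (n, k) t)).
    by apply: (measurableT_comp mF); exact: (PhiP (n, k)).1.1.
  have mS : measurable_fun setT (fun t => \sum_(k < 2 ^ n) F (Phi (n, nat_of_ord k) t)).
    exact: measurable_sum.
  apply: (@le_trans _ _ (\int[mu]_t
    ((2 ^ n)%:R^-1%:E * (\sum_(k < 2 ^ n) F (Phi (n, nat_of_ord k) t))%:E))%E).
    apply: ge0_le_integral => //.
    - by move=> t _; rewrite lee_fin mulr_ge0 ?normc_ge0.
    - exact/measurable_EFinP.
    - have h : measurable_fun setT (fun t =>
         ((2 ^ n)%:R^-1 * \sum_(k < 2 ^ n) F (Phi (n, nat_of_ord k) t))%:E).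
        by apply/measurable_EFinP; exact: measurable_funM.
      exact: h.
    - by move=> t _; rewrite -EFinM lee_fin gF.
  rewrite ge0_integralZl_EFin //; last 2 first.
  - by move=> t _; rewrite lee_fin sumr_ge0.
  - exact/measurable_EFinP.
  under eq_integral do rewrite -sumEFin.
  rewrite ge0_integral_sum //; last 2 first.
  - by move=> k; exact/measurable_EFinP.
  - by move=> k t _; rewrite lee_fin.
  have FE k : (\int[mu]_t (F (Phi (n, k) t))%:E = \int[mu]_t (F t)%:E)%E.
    by apply: ((PhiP (n, k)).1.2 (fun t => (F t)%:E)); [exact/measurable_EFinP|move=> t; rewrite lee_fin].
  under eq_bigr do rewrite FE.
  have intFle : (\int[mu]_t (F t)%:E <= sqint mu setT (lift f))%E.
    apply: ge0_le_integral => //.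
    - by move=> t _; rewrite lee_fin.
    - exact/measurable_EFinP.
    - by apply/measurable_EFinP; exact: measurable_normc_sq.
    - move=> t _; rewrite lee_fin /F ler_piMl ?sqr_ge0 // indicE.
  rewrite sum_ereal_const; last by apply: integral_ge0 => t _; rewrite lee_fin.
  rewrite muleA -EFinM mulVf ?pow2_neq0 // mul1e.
  exact: intFle.
have cvgG t : D t -> (fun n => g n t) @ \oo --> normc (f z) ^+ 2.
  move=> Dt; rewrite -normcX.
  have -> : (fun n => g n t) = (fun n => normc (circ n (G t) 1)).
    by apply/funext => n; rewrite /g indicE mem_set // mul1r.
  apply: ctends_normc.
  have G0 : G t 0 = f z ^+ 2 by rewrite /G scale0r addr0.
  have Gd (s : C) : normc s <= 1 -> cderivable (G t) s.
    move=> s1; apply: cderivableX; apply: slice_cderivable; apply: hf.1; apply: zr.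
    by rewrite rnormZ (le_lt_trans _ Dt) // ler_piMl // rnorm_ge0.
  rewrite -G0; apply: (@ctends_circ_inner _ _ _ 2).
  - by rewrite normc1 ltr1n.
  - by move=> e; apply: cderivable_normc_continuous; apply: Gd; rewrite normc0.
  - by move=> s /andP[_]; rewrite normc1; exact: Gd.
have := @fatou_bound R _ T mu setT measurableT g
  (fun t => normc (f z) ^+ 2 * \1_D t) (sqint mu setT (lift f)) mg.
move=> fat; apply: (le_trans _ (fat _ _ _)); last 3 first.
- by move=> n t _; rewrite mulr_ge0 ?normc_ge0.
- move=> t _; have [tD|tD] := boolP (t \in D).
    by rewrite indicE tD mulr1; apply: cvgG; exact: set_mem.
  rewrite indicE (negbTE tD) mulr0 (_ : (fun n => _) = (fun=> 0)); first exact: cvg_cst.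
  by apply/funext => n; rewrite /g indicE (negbTE tD) mul0r.
- by near=> n; exact: intF.
under eq_integral do rewrite EFinM.
rewrite ge0_integralZl_EFin ?sqr_ge0 //; last first.
  exact/measurable_EFinP.
rewrite integral_indic // setIT EFinM lee_wpmul2l ?lee_fin ?sqr_ge0 //.
have r4 : 0 < r / 4 by rewrite divr_gt0.
apply: (@le_trans _ _ (mu (cube z (r / 4)))).
  rewrite cube_measure // lee_fin /kappa.
  by have -> : 2 * (r / 4) = r / 2 by field.
apply: le_measure; rewrite ?inE //; first exact: measurable_cube.
exact: rnorm_cube.
Unshelve. all: by end_near. Qed.

End sub_mean_value.

(** * The Bergman space as a Hilbert space *)

Section bergman_hilbert.
Variables (R : realType) (m : nat).
Local Notation C := (R[i]).
Local Notation V := (Cn R m).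
Local Notation T := (ms_type (lebesgueCn R m)).
Local Notation mu := (ms_meas (lebesgueCn R m)).
Local Notation H := (bergman_space R m).
Implicit Types (f g x y : V -> C^o) (z h : V).

Definition sqnorm f : R := fine (sqint mu setT (lift f)).

Lemma bergman_L2 f : bergman_set f -> square_integrable mu setT (lift f).
Proof. by move=> /bergman_setE[hf foo]; split=> //; exact: lift_cmeasurable. Qed.

Lemma ball_holomorphic_linear (a : C) f g : ball_holomorphic f -> ball_holomorphic g ->
  ball_holomorphic (a *: f + g).
Proof.
move=> [fd f0] [gd g0]; split=> z zb.
  by apply: differentiableD; [apply: differentiableZ; exact: fd|exact: gd].
by rewrite !fctE f0 // g0 // scaler0 addr0.
Qed.

Lemma ball_holomorphic0 : ball_holomorphic (0 : V -> C^o).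
Proof. by split=> z _ //; exact: differentiable_cst. Qed.

Lemma bergman_set_linear (a : C) f g : bergman_set f -> bergman_set g ->
  bergman_set (a *: f + g).
Proof.
move=> bf bg; have [hf _] := (bergman_setE f).1 bf; have [hg _] := (bergman_setE g).1 bg.
apply/bergman_setE; split; first exact: ball_holomorphic_linear.
have Laf := square_integrableZ measurableT a (bergman_L2 bf).
exact: (square_integrableD measurableT Laf (bergman_L2 bg)).2.
Qed.

Lemma bergman_set0 : bergman_set (0 : V -> C^o).
Proof.
apply/bergman_setE; split; first exact: ball_holomorphic0.
rewrite /sqint; under eq_integral do rewrite normc0 expr0n.
by rewrite integral0.
Qed.

Lemma bergman_set_sub f g : bergman_set f -> bergman_set g -> bergman_set (f - g).
Proof. by move=> bf bg; have := bergman_set_linear (-1) bg bf; rewrite scaleN1r addrC. Qed.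

Lemma bergman_inner_linear (a : C) f g (h : V -> C^o) :
  bergman_set f -> bergman_set g -> bergman_set h ->
  bergman_inner (a *: f + g) h = a * bergman_inner f h + bergman_inner g h.
Proof.
move=> bf bg bh; have [hf _] := (bergman_setE f).1 bf; have [hg _] := (bergman_setE g).1 bg.
have Lh := square_integrable_conj (bergman_L2 bh).
have If := square_integrableM measurableT (bergman_L2 bf) Lh.
have Ig := square_integrableM measurableT (bergman_L2 bg) Lh.
rewrite (bergman_innerE h (ball_holomorphic_linear a hf hg)).
rewrite (bergman_innerE h hf) (bergman_innerE h hg).
rewrite mulrCA -(cintZ measurableT a If) -mulrDr.
rewrite -(cintD measurableT (cintegrableZ measurableT a If) Ig).
congr (_ * cint _ _ _); apply/funext => t.
by rewrite /lift !fctE mulrDl -mulrA.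
Qed.

Lemma bergman_inner_conj f g : bergman_set f -> bergman_set g ->
  bergman_inner g f = conjc (bergman_inner f g).
Proof.
move=> bf bg; have [hf _] := (bergman_setE f).1 bf; have [hg _] := (bergman_setE g).1 bg.
have I := square_integrableM measurableT (bergman_L2 bf) (square_integrable_conj (bergman_L2 bg)).
rewrite (bergman_innerE g hf) (bergman_innerE f hg).
have conj_real (a : R) (w : C) : conjc (a%:C * w) = a%:C * conjc w.
  by case: w => b c /=; apply/eqP; rewrite eq_complex /= !mul0r !subr0 !addr0 mulrN !eqxx.
rewrite conj_real -(cint_conj measurableT I); congr (_ * cint _ _ _).
apply/funext => t; case: (lift f t) (lift g t) => [a b] [c d] /=.
by apply/eqP; rewrite eq_complex /=; apply/andP; split; apply/eqP; ring.
Qed.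

Lemma bergman_inner_sq f : bergman_set f ->
  bergman_inner f f = (sqnorm f / ball_volume R m)%:C.
Proof.
move=> bf; have [hf _] := (bergman_setE f).1 bf; rewrite bergman_innerE //.
rewrite -[cint _ _ _](_ : (sqnorm f)%:C = _) -?rmorphM ?[_^-1 * _]mulrC //.
by apply/eqP; rewrite eq_complex Re_cint_sq Im_cint_sq /= !eqxx.
Qed.

Lemma inormE f : bergman_set f -> @inorm R H f = Num.sqrt (sqnorm f / ball_volume R m).
Proof. by move=> bf; rewrite /inorm [inner _ _]bergman_inner_sq. Qed.

Lemma inorm_lt f (e : R) : bergman_set f -> 0 < e ->
  (@inorm R H f < e) = (sqnorm f < e ^+ 2 * ball_volume R m).
Proof.
move=> bf e0; have [v0 _] := ball_volume_fin R m.
rewrite inormE // -[X in _ < X](ger0_norm (ltW e0)) -sqrtr_sqr.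
by rewrite ltr_sqrt ?exprn_gt0 // ltr_pdivrMr.
Qed.

Lemma sqnorm_point f z (r : R) : bergman_set f -> 0 < r ->
  (forall h, rnorm h < r -> in_ball (z + h)) ->
  normc (f z) ^+ 2 * kappa m r <= sqnorm f.
Proof.
move=> bf r0 zr; have [hf _] := (bergman_setE f).1 bf.
by have := sub_mean_value hf r0 zr; rewrite (sqintE (bergman_L2 bf)) lee_fin.
Qed.

Lemma kappa_gt0 (r : R) : 0 < r -> 0 < kappa m r.
Proof. by move=> r0; rewrite exprn_gt0 // mulr_gt0 // divr_gt0. Qed.

Lemma bergman_inner_gt0 f : bergman_set f -> f != 0 -> 0 < bergman_inner f f.
Proof.
move=> bf f0; rewrite bergman_inner_sq // ltcR.
have [hf _] := (bergman_setE f).1 bf.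
have [z fz] : exists z, f z != 0.
  apply: contrapT => h; move/negP: f0; apply; apply/eqP/funext => z.
  by apply/eqP; apply: contrapT => /negP fz; apply: h; exists z.
have zb : in_ball z by apply: contraTT fz => /hf.2 ->; rewrite eqxx.
have [r r0 rB] := in_ball_open zb.
rewrite divr_gt0 ?(ball_volume_fin R m).1 //.
apply: lt_le_trans (sqnorm_point bf r0 rB).
by rewrite mulr_gt0 ?kappa_gt0 // exprn_gt0 // normc_gt0.
Qed.

(** The norm bound gives a local uniform bound by the sub-mean value inequality, so the limit is
    holomorphic by [limit_differentiable]; Fatou's lemma gives its norm. *)
Lemma bergman_limit (u : nat -> V -> C^o) f (S : R) :
  (forall n, bergman_set (u n)) -> (forall n, sqnorm (u n) <= S) ->
  (forall z, in_ball z -> ctends (fun n => u n z) (f z)) ->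
  (forall z, ~~ in_ball z -> f z = 0) ->
  bergman_set f /\ sqnorm f <= S.
Proof.
move=> bu uS uf f0.
have hf : ball_holomorphic f.
  split=> // z zb; have [d d0 dB] := in_ball_open zb.
  have d2 : 0 < d / 2 by rewrite divr_gt0.
  have d4 : 0 < d / 4 by rewrite divr_gt0.
  have Bh h : rnorm h <= d / 4 -> in_ball (z + h).
    by move=> hd; apply: dB; rewrite (le_lt_trans hd) // ltr_pdivrMr // ltr_pMr // ltr1n.
  (* Points within d / 4 of z carry a polydisc of radius d / 2 inside the one of radius d, so the
     sub-mean value inequality bounds the values there in terms of S. *)
  apply: (@limit_differentiable R m u f z (d / 4) (Num.sqrt (S / kappa m (d / 2)))) => //.
  - move=> n h hd; have [[hu _] _] := (bergman_setE (u n)).1 (bu n).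
    by apply: hu; apply: dB; apply: (lt_trans hd); lra.
  - move=> n h hd; rewrite -(ger0_norm (normc_ge0 _)) -sqrtr_sqr ler_wsqrtr //.
    rewrite ler_pdivlMr ?kappa_gt0 // (le_trans _ (uS n)) //.
    apply: sqnorm_point => // h' hd'; rewrite -addrA; apply: dB.
    apply: (le_lt_trans (rnormD _ _)); rewrite (lt_trans (ler_ltD hd hd')) //; lra.
  - by move=> h hd; apply/uf/Bh.
have luf t : ctends (fun n => lift (u n) t) (lift f t).
  have [tb|tb] := boolP (in_ball (coordinates t)); first exact: uf.
  have -> : (fun n => lift (u n) t) = (fun=> 0).
    apply/funext => n; have [[_ u0] _] := (bergman_setE (u n)).1 (bu n).
    exact: u0.
  by rewrite /lift f0 //; exact: ctends_cst.
have sqf : (sqint mu setT (lift f) <= S%:E)%E.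
  apply: (@fatou_bound R _ T mu setT measurableT (fun n t => normc (lift (u n) t) ^+ 2)).
  - by move=> n; apply: measurable_normc_sq => //; exact: (bergman_L2 (bu n)).1.
  - by move=> n t _; exact: sqr_ge0.
  - move=> t _; have := ctends_normc (luf t) => h.
    by under eq_cvg do rewrite expr2; rewrite expr2; exact: cvgM.
  - near=> n; rewrite -[X in (X <= _)%E]/(sqint mu setT (lift (u n))).
    by rewrite (sqintE (bergman_L2 (bu n))) lee_fin; exact: uS.
have bf : bergman_set f by apply/bergman_setE; split=> //; exact: le_lt_trans sqf (ltry _).
by split=> //; rewrite -lee_fin -(sqintE (bergman_L2 bf)).
Unshelve. all: by end_near. Qed.

(** A Cauchy sequence converges pointwise to some f. Applying [bergman_limit] to u n - u (N + p), as
    p grows, shows at once that u n - f lies in the space and that its norm is small. *)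
Lemma bergman_complete (u : nat -> H) : (forall n, bergman_set (u n)) -> is_cauchy u ->
  exists2 x : H, is_dom x & converges_to u x.
Proof.
move=> bu uc; have [v0 _] := ball_volume_fin R m.
have uc' (e : R) : 0 < e -> exists N, forall p q, (N <= p)%N -> (N <= q)%N ->
    sqnorm (u p - u q) <= e ^+ 2 * ball_volume R m.
  move=> e0; have [N NP] := uc e e0; exists N => p q Np Nq.
  by rewrite ltW // -(inorm_lt (bergman_set_sub (bu p) (bu q)) e0); exact: NP.
have ptw z : exists l, ctends (fun n => u n z : C) l.
  have [zb|zb] := boolP (in_ball z); last first.
    exists 0; have -> : (fun n => u n z) = (fun=> 0); last exact: ctends_cst.
    by apply/funext => n; have [[_ u0] _] := (bergman_setE (u n)).1 (bu n); exact: u0.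
  have [r r0 rB] := in_ball_open zb; have k0 := kappa_gt0 r0.
  apply: ctends_cauchy => e e0.
  (* Makes the bound e'^2 vol on the squared norm equal to e^2 kappa, so the values differ by at
     most e. *)
  pose e' := Num.sqrt (e ^+ 2 * kappa m r / ball_volume R m).
  have e'0 : 0 < e' by rewrite sqrtr_gt0 divr_gt0 // mulr_gt0 // exprn_gt0.
  have [N NP] := uc' e' e'0; exists N => p q Np Nq.
  have := sqnorm_point (bergman_set_sub (bu p) (bu q)) r0 rB.
  move=> /le_trans/(_ (NP p q Np Nq)); rewrite sqr_sqrtr; last first.
    by rewrite divr_ge0 ?mulr_ge0 ?sqr_ge0 // ltW.
  rewrite divfK ?gt_eqF // ler_pM2r // ler_pXn2r ?nnegrE ?normc_ge0 ?(ltW e0) //.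
have [f fP] := choice ptw.
have f0 z : ~~ in_ball z -> f z = 0.
  move=> zb; apply: (ctends_unique (fP z)).
  have -> : (fun n => u n z) = (fun=> 0); last exact: ctends_cst.
  by apply/funext => n; have [[_ u0] _] := (bergman_setE (u n)).1 (bu n); exact: u0.
have tail (e : R) : 0 < e -> exists N, forall n, (N <= n)%N ->
    bergman_set (u n - f : V -> C^o) /\ sqnorm (u n - f : V -> C^o) <= e ^+ 2 * ball_volume R m.
  move=> e0; have [N NP] := uc' e e0; exists N => n Nn.
  apply: (@bergman_limit (fun p => u n - u (N + p)%N)).
  - by move=> p; exact: bergman_set_sub.
  - by move=> p; apply: NP => //; exact: leq_addr.
  - move=> z zb; apply: ctendsB; first exact: ctends_cst.
    move=> e1 e10; have [M _ MP] := fP z e1 e10; exists M => // p /= Mp.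
    by apply: MP => /=; rewrite (leq_trans Mp) // leq_addl.
  - move=> z zb; have [[_ u0] _] := (bergman_setE (u n)).1 (bu n).
    by rewrite !fctE f0 // u0 // subr0.
have [N NP] := tail 1 ltr01; have [bNf _] := NP N (leqnn N).
have bf : bergman_set f.
  have := bergman_set_sub (bu N) bNf.
  by rewrite opprB [u N + _]addrC subrK.
exists f => // e e0; have e2 : 0 < e / 2 by rewrite divr_gt0.
have [N' N'P] := tail _ e2; exists N' => n /N'P[bnf le_nf].
rewrite (inorm_lt bnf e0); apply: (le_lt_trans le_nf); rewrite ltr_pM2r //.
by rewrite ltr_pXn2r ?nnegrE ?(ltW e0) ?(ltW e2) // ltr_pdivrMr // ltr_pMr // ltr1n.
Qed.

Lemma bergman_is_hilbert : is_hilbert H.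
Proof.
split.
- by split=> [|a x y]; [exact: bergman_set0|exact: bergman_set_linear].
- by move=> a x y z; exact: bergman_inner_linear.
- by move=> x y; exact: bergman_inner_conj.
- by move=> x; exact: bergman_inner_gt0.
- exact: bergman_complete.
Qed.

End bergman_hilbert.

Section cis_powers.
Variable R : realType.
Local Notation C := (R[i]).

Lemma cisX (t : R) n : cis t ^+ n = cis (t * n%:R).
Proof.
elim: n => [|n IH]; first by rewrite mulr0 cis0.
by rewrite exprSr IH -cisD -[n.+1]addn1 natrD mulrDr mulr1.
Qed.

Lemma conjc_cis (t : R) : conjc (cis t) = cis (- t).
Proof. by rewrite /cis cosN sinN. Qed.

Lemma conjcX (z : C) n : conjc (z ^+ n) = conjc z ^+ n.
Proof. exact: rmorphXn. Qed.

Lemma conjcM (x y : C) : conjc (x * y) = conjc x * conjc y.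
Proof. exact: rmorphM. Qed.

Lemma normc1_mul_conj (u : C) : normc u = 1 -> u * conjc u = 1.
Proof.
case: u => a b u1; have : normc (a +i* b) ^+ 2 = 1 by rewrite u1 expr1n.
rewrite normc_sq /= => ab; apply/eqP; rewrite eq_complex /=; apply/andP; split; apply/eqP.
  by rewrite -ab; ring.
by ring.
Qed.

(** With u = exp (i pi / |a - b|) the product is exp (i pi) or exp (- i pi), that is -1. *)
Lemma separating_rotation (a b : nat) : a != b ->
  exists2 u : C, normc u = 1 & u ^+ a * conjc u ^+ b != 1.
Proof.
have lt_case (p q : nat) : (p < q)%N -> exists2 u : C, normc u = 1 &
    u ^+ q * conjc u ^+ p = -1 /\ u ^+ p * conjc u ^+ q = -1.
  move=> pq; pose d : R := (q - p)%N%:R.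
  have d0 : d != 0 by rewrite pnatr_eq0 -lt0n subn_gt0.
  have qE : q%:R = p%:R + d by rewrite -natrD subnKC // ltnW.
  exists (cis (pi / d)); first exact: normc_cis.
  have cispi : cis pi = -1 :> C.
    by rewrite /cis cospi sinpi; apply/eqP; rewrite eq_complex /= oppr0 !eqxx.
  have cisNpi : cis (- pi) = -1 :> C.
    by rewrite /cis cosN sinN cospi sinpi; apply/eqP; rewrite eq_complex /= !oppr0 !eqxx.
  rewrite conjc_cis !cisX -!cisD; split.
    by rewrite -cispi; congr cis; rewrite qE; field.
  by rewrite -cisNpi; congr cis; rewrite qE; field.
have n1 : (-1 : C) != 1.
  by rewrite eq_complex /=; apply/negP => /andP[/eqP h _]; move: h; lra.
by case: ltngtP => // /lt_case[u u1 [h1 h2]] _; exists u; rewrite ?h1 ?h2.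
Qed.

End cis_powers.

(** * Monomials and their orthogonality *)

Section monomials.
Variables (R : realType) (m : nat).
Local Notation C := (R[i]).
Local Notation V := (Cn R m).
Local Notation T := (ms_type (lebesgueCn R m)).
Local Notation mu := (ms_meas (lebesgueCn R m)).
Implicit Types (f g : V -> C^o) (z h : V) (k : 'I_m -> nat).

Definition upd z (i : 'I_m) (w : C) : V := \row_j (if j == i then w else z 0 j).

Lemma updE z i w j : upd z i w 0 j = if j == i then w else z 0 j.
Proof. by rewrite mxE. Qed.

Lemma upd_id z i : upd z i (z 0 i) = z.
Proof. by apply/rowP => j; rewrite mxE; case: eqP => [->|]. Qed.

Lemma upd_upd z i v w : upd (upd z i v) i w = upd z i w.
Proof. by apply/rowP => j; rewrite !mxE; case: eqP. Qed.

Lemma updC z i j v w : i != j -> upd (upd z i v) j w = upd (upd z j w) i v.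
Proof.
move=> ij; apply/rowP => l; rewrite !mxE; case: (eqVneq l j) => [->|//].
by rewrite eq_sym (negbTE ij).
Qed.

Lemma upd_shift z i w : upd z i w = upd z i 0 + w *: delta_mx 0 i.
Proof.
apply/rowP => j; rewrite !mxE eqxx /=; case: (j == i).
  by rewrite add0r mulr1.
by rewrite mulr0 addr0.
Qed.

Lemma ballsum_upd z i w : normc w = normc (z 0 i) -> ballsum (upd z i w) = ballsum z.
Proof.
move=> wz; apply: eq_bigr => j _; rewrite mxE; case: eqP => [->|//].
by rewrite wz.
Qed.

Lemma in_ball_upd z i w : normc w <= normc (z 0 i) -> in_ball z -> in_ball (upd z i w).
Proof.
move=> wz; apply: in_ball_le => j; rewrite mxE.
by case: eqP => [->|].
Qed.

Definition cmon k z : C := \prod_(i < m) z 0 i ^+ k i.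

Definition mono k : V -> C^o := on_ball (cmon k : V -> C^o).

Lemma e_E (n : mpoly.multinom m) :
  e_ R n = ((Num.sqrt (omega0 R n))%:C)^-1 *: mono n :> (V -> C^o).
Proof.
apply/funext => z; rewrite /e_ /on_ball !fctE /mono /on_ball; case: ifP => _.
  exact: mulrC.
by rewrite scaler0.
Qed.

Lemma omega0_gt0 (n : mpoly.multinom m) : 0 < omega0 R n.
Proof.
rewrite /omega0 divr_gt0 // ltr0n ?fact_gt0 // muln_gt0 fact_gt0 andbT.
by apply: prodn_gt0 => i; exact: fact_gt0.
Qed.

Lemma e_coeff_neq0 (n : mpoly.multinom m) : ((Num.sqrt (omega0 R n))%:C)^-1 != 0 :> C.
Proof.
by rewrite invr_eq0 -normc_eq0 normc_real normr_eq0 gt_eqF // sqrtr_gt0 omega0_gt0.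
Qed.

Lemma cmon_differentiable k z : differentiable (cmon k : V -> C^o) z.
Proof.
rewrite (_ : (cmon k : V -> C^o) = (fun z => \prod_(i <- index_enum 'I_m) (z 0 i : C) ^+ k i)) //.
elim: (index_enum _) => [|i r IH].
  by under eq_fun do rewrite big_nil; exact: differentiable_cst.
under eq_fun do rewrite big_cons; apply: differentiableM => //.
elim: (k i) => [|n IHn]; first exact: differentiable_cst.
rewrite (_ : (fun _ => _) = (fun z : V => (z 0 i : C) * (z 0 i : C) ^+ n)).
  by apply: differentiableM => //; exact: differentiable_coord.
by apply/funext => w; rewrite exprS.
Qed.

Lemma on_ball_holomorphic f : (forall z, differentiable f z) -> ball_holomorphic (on_ball f).
Proof.
move=> fd; split=> z zb; last by rewrite /on_ball (negbTE zb).
have [d d0 dB] := in_ball_open zb.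
apply: (differentiable_near d0 _ (fd z)) => h /dB hb.
by rewrite /on_ball hb.
Qed.

Lemma mono_holomorphic k : ball_holomorphic (mono k).
Proof. by apply: on_ball_holomorphic => z; exact: cmon_differentiable. Qed.

Lemma normc_prod (I : Type) (r : seq I) (F : I -> C) :
  normc (\prod_(i <- r) F i) = \prod_(i <- r) normc (F i).
Proof.
elim: r => [|i r IH]; first by rewrite !big_nil normc1.
by rewrite !big_cons normcM IH.
Qed.

Lemma mono_le1 k z : normc (mono k z) <= 1.
Proof.
rewrite /mono /on_ball; case: ifP => [zb|_]; last by rewrite normc0.
rewrite /cmon normc_prod; apply: prodr_ile1 => i _.
by rewrite normcX exprn_ge0 ?normc_ge0 // exprn_ile1 ?normc_ge0 // ltW // in_ball_coord.
Qed.

Lemma bounded_bergman f (M : R) : ball_holomorphic f -> (forall z, normc (f z) <= M) ->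
  bergman_set f.
Proof.
move=> hf fM; apply/bergman_setE; split=> //.
have mB := measurable_coord_ball R m; have [_ vE] := ball_volume_fin R m.
have M0 : 0 <= M := le_trans (normc_ge0 (f 0)) (fM 0).
apply: (@le_lt_trans _ _ (\int[mu]_t ((M ^+ 2)%:E * (\1_(@coord_ball R m) t)%:E))%E).
  apply: ge0_le_integral => //.
  - by move=> t _; rewrite lee_fin sqr_ge0.
  - by apply/measurable_EFinP/measurable_normc_sq => //; exact: lift_cmeasurable.
  - have h : measurable_fun setT (fun t : T => (M ^+ 2 * \1_(@coord_ball R m) t)%:E).
      by apply/measurable_EFinP; exact: measurable_funM.
    exact: h.
  - move=> t _; rewrite -EFinM lee_fin indicE.
    have [tb|tb] := boolP (t \in _).
      by rewrite mulr1; apply: lerXn2r; [exact: normc_ge0|exact: M0|exact: fM].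
    rewrite mulr0 /lift hf.2 ?normc0 ?expr0n //.
    by apply/negP => h; move/negP: tb; apply; rewrite inE.
rewrite ge0_integralZl_EFin ?sqr_ge0 //; last exact/measurable_EFinP.
rewrite (_ : (\int[mu]_x _ = (ball_volume R m)%:E)%E) -?EFinM ?ltry //.
by rewrite integral_indic // setIT; exact: vE.
Qed.

Lemma mono_bergman k : bergman_set (mono k).
Proof. exact: (bounded_bergman (mono_holomorphic k) (mono_le1 k)). Qed.

Lemma mono_neq0 k : mono k != 0.
Proof.
have [d d0 dB] := in_ball_open (in_ball0 R m).
pose a : V := const_mx (d / 2)%:C.
have ab : in_ball a.
  rewrite -[a]add0r; apply: dB; apply: (@le_lt_trans _ _ (d / 2)); last first.
    by rewrite ltr_pdivrMr // ltr_pMr // ltr1n.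
  apply: rnorm_le => [|i]; first by rewrite divr_ge0 // ltW.
  by rewrite mxE normc_real ger0_norm // divr_ge0 // ltW.
apply/eqP => /(congr1 (fun f => f a)); rewrite /mono /on_ball ab /cmon => /eqP.
apply/negP; apply/prodf_neq0 => i _; rewrite expf_neq0 // mxE.
by rewrite -normc_gt0 normc_real gtr0_norm ?divr_gt0.
Qed.

Lemma coordinate_rotation (i : 'I_m) (u : C) : normc u = 1 ->
  exists Phi : T -> T, preserving Phi /\
    forall t, coordinates (Phi t) = upd (coordinates t) i (u * coordinates t 0 i).
Proof.
move=> u1; have [j|Phi [pPhi PhiE]] := @coordwise_preserving R m
    (fun j x => if j == i then u * x else x).
  by case: (j == i); [exact: preservingC_rotation|exact: preservingC_id].
exists Phi; split=> // t; rewrite PhiE; apply/rowP => j; rewrite !mxE.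
by case: eqP => [->|].
Qed.

Lemma mono_rotation k z i (u : C) : normc u = 1 ->
  mono k (upd z i (u * z 0 i)) = u ^+ k i * mono k z.
Proof.
move=> u1; have uz : normc (u * z 0 i) = normc (z 0 i) by rewrite normcM u1 mul1r.
rewrite /mono /on_ball -[in_ball _]/(ballsum _ < 1) ballsum_upd // -[in_ball z]/(ballsum z < 1).
case: ifP => _; last by rewrite mulr0.
rewrite /cmon (bigD1 i) // [in RHS](bigD1 i) //= updE eqxx exprMn -mulrA; congr (_ * (_ * _)).
by apply: eq_bigr => j ji; rewrite updE (negbTE ji).
Qed.

(** Rotating a coordinate in which the exponents differ preserves the inner product and multiplies
    it by a number other than 1. *)
Lemma mono_orthogonal k k' : (exists i, k i != k' i) ->
  bergman_inner (mono k) (mono k') = 0.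
Proof.
move=> [i ki]; have [u u1 uk] := @separating_rotation R _ _ ki.
have [Phi [pPhi PhiE]] := coordinate_rotation i u1.
rewrite (bergman_innerE _ (mono_holomorphic k)).
set h := fun t => _; have mh : cmeasurable setT h.
  apply: cmeasurableM; first exact: (lift_cmeasurable (mono_holomorphic k)).
  exact/cmeasurable_conj/(lift_cmeasurable (mono_holomorphic k')).
have hPhi : (fun t => h (Phi t)) = (fun t => u ^+ k i * conjc u ^+ k' i * h t).
  apply/funext => t; rewrite /h /lift PhiE !mono_rotation // conjcM conjcX.
  ring.
have Ih : cintegrable mu setT h.
  apply: square_integrableM => //; first exact: (bergman_L2 (mono_bergman k)).
  exact/square_integrable_conj/(bergman_L2 (mono_bergman k')).
have := preserving_cint pPhi mh; rewrite hPhi (cintZ measurableT _ Ih) => /eqP.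
rewrite -subr_eq0 -[X in _ - X]mul1r -mulrBl mulf_eq0 subr_eq0 (negbTE uk) /= => /eqP ->.
exact: mulr0.
Qed.

Lemma coord_mul_bergman (p : 'I_m) f : bergman_set f -> bergman_set (coord_mul p f) /\
  sqnorm (coord_mul p f) <= sqnorm f.
Proof.
move=> bf; have [hf foo] := (bergman_setE f).1 bf.
have hpf : ball_holomorphic (coord_mul p f).
  split=> z zb; last by rewrite /coord_mul hf.2 // mulr0.
  by apply: differentiableM; [exact: differentiable_coord|exact: hf.1].
have le1 : (sqint mu setT (lift (coord_mul p f)) <= 1%:E * sqint mu setT (lift f))%E.
  apply: le_sqint => //; [exact: lift_cmeasurable hpf|exact: lift_cmeasurable hf|].
  move=> t _; rewrite mul1r /lift /coord_mul normcM exprMn.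
  have [tb|tb] := boolP (in_ball (coordinates t)); last first.
    by rewrite hf.2 // normc0 expr0n mulr0.
  rewrite ler_piMl ?sqr_ge0 // exprn_ile1 ?normc_ge0 // ltW // in_ball_coord //.
rewrite mul1e in le1.
have bpf : bergman_set (coord_mul p f).
  by apply/bergman_setE; split=> //; exact: le_lt_trans le1 foo.
split=> //; rewrite -lee_fin -(sqintE (bergman_L2 bpf)) -(sqintE (bergman_L2 bf)).
exact: le1.
Qed.

End monomials.

Lemma mulc_conj (R : realType) (a : R[i]) : a * conjc a = (normc a ^+ 2)%:C.
Proof.
case: a => p q; rewrite normc_sq /=; apply/eqP; rewrite eq_complex /=.
by apply/andP; split; apply/eqP; ring.
Qed.

(** * Hilbert spaces *)

Section uroot_group.
Variable R : realType.
Local Notation C := (R[i]).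

Lemma uroot_mul n j l : uroot R n j * uroot R n l = uroot R n (j + l).
Proof. by rewrite /uroot -cisD -mulrDr -mulrDl -natrD. Qed.

(** For n <= n' a 2^n-th root of unity is also a 2^n'-th one, and multiplying by it shifts the
    latter cyclically. *)
Lemma sum_uroot (U : nmodType) (F : C -> U) n n' k : (n <= n')%N ->
  \sum_(l < 2 ^ n') F (uroot R n k * uroot R n' l) = \sum_(l < 2 ^ n') F (uroot R n' l).
Proof.
move=> nn'; have -> : uroot R n k = uroot R n' (k * 2 ^ (n' - n)).
  rewrite /uroot; congr (cis (_ * _)); rewrite -{2}(subnK nn') expnD !natrM invfM.
  by field; rewrite !pow2_neq0.
elim: (k * _)%N => [|j IH]; first by under eq_bigr do rewrite uroot0 mul1r.
rewrite -{}IH; under eq_bigr do rewrite uroot_mul.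
under [RHS]eq_bigr do rewrite uroot_mul.
case: (2 ^ n')%N (uroot_period R n') => [|N] period; first by rewrite !big_ord0.
rewrite big_ord_recr big_ord_recl /= addn0 addrC; congr (F _ + _).
  by rewrite addSnnS -uroot_mul period mulr1.
by apply: eq_bigr => l _; rewrite /= addSnnS.
Qed.

End uroot_group.

Section hilbert.
Variables (R : realType) (H : ispace R).
Hypothesis hH : is_hilbert H.
Local Notation C := (R[i]).
Local Notation dom := (@is_dom R H).
Local Notation dot := (@inner R H).
Local Notation norm := (@inorm R H).
Implicit Types (x y z : H) (a : C).

Lemma dom_linear a x y : dom x -> dom y -> dom (a *: x + y).
Proof. by have [[_ h] _ _ _ _] := hH; exact: h. Qed.

Lemma dom0 : dom 0.
Proof. by have [[]] := hH. Qed.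

Lemma domZ a x : dom x -> dom (a *: x).
Proof. by move=> dx; rewrite -[_ *: _]addr0; apply: dom_linear => //; exact: dom0. Qed.

Lemma domD x y : dom x -> dom y -> dom (x + y).
Proof. by move=> dx dy; rewrite -[x]scale1r; exact: dom_linear. Qed.

Lemma domB x y : dom x -> dom y -> dom (x - y).
Proof. by move=> dx dy; rewrite addrC -scaleN1r; exact: dom_linear. Qed.

Lemma dom_sum (J : Type) (r : seq J) (P : pred J) (F : J -> H) :
  (forall i, P i -> dom (F i)) -> dom (\sum_(i <- r | P i) F i).
Proof. by move=> dF; elim/big_ind: _ => //; [exact: dom0|exact: domD]. Qed.

Lemma inner_linear a x y z : dom x -> dom y -> dom z ->
  dot (a *: x + y) z = a * dot x z + dot y z.
Proof. by have [_ h _ _ _] := hH; exact: h. Qed.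

Lemma innerC x y : dom x -> dom y -> dot y x = conjc (dot x y).
Proof. by have [_ _ h _ _] := hH; exact: h. Qed.

Lemma inner0l x : dom x -> dot 0 x = 0.
Proof.
move=> dx; have := inner_linear (-1) dom0 dom0 dx.
by rewrite scaler0 addr0 mulN1r addNr.
Qed.

Lemma innerDl x y z : dom x -> dom y -> dom z -> dot (x + y) z = dot x z + dot y z.
Proof. by move=> dx dy dz; rewrite -[x]scale1r inner_linear // scale1r mul1r. Qed.

Lemma innerZl a x z : dom x -> dom z -> dot (a *: x) z = a * dot x z.
Proof.
by move=> dx dz; rewrite -[a *: x]addr0 inner_linear ?inner0l ?addr0 //; exact: dom0.
Qed.

Lemma innerBl x y z : dom x -> dom y -> dom z -> dot (x - y) z = dot x z - dot y z.
Proof.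
move=> dx dy dz; rewrite -scaleN1r innerDl ?innerZl ?mulN1r //; exact: domZ.
Qed.

Lemma inner0r x : dom x -> dot x 0 = 0.
Proof. by move=> dx; rewrite innerC ?inner0l ?rmorph0 //; exact: dom0. Qed.

Lemma innerDr x y z : dom x -> dom y -> dom z -> dot z (x + y) = dot z x + dot z y.
Proof.
move=> dx dy dz; rewrite (innerC (domD dx dy) dz) (innerC dx dz) (innerC dy dz).
by rewrite innerDl // rmorphD.
Qed.

Lemma innerZr a x z : dom x -> dom z -> dot z (a *: x) = conjc a * dot z x.
Proof.
by move=> dx dz; rewrite (innerC (domZ a dx) dz) (innerC dx dz) innerZl // rmorphM.
Qed.

Lemma innerZZ a b x y : dom x -> dom y ->
  dot (a *: x) (b *: y) = a * conjc b * dot x y.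
Proof. by move=> dx dy; rewrite innerZl ?innerZr ?mulrA //; exact: domZ. Qed.

Lemma innerBr x y z : dom x -> dom y -> dom z -> dot z (x - y) = dot z x - dot z y.
Proof.
move=> dx dy dz; rewrite (innerC (domB dx dy) dz) (innerC dx dz) (innerC dy dz).
by rewrite innerBl // rmorphB.
Qed.

Lemma inner_suml (J : Type) (r : seq J) (P : pred J) (F : J -> H) z :
  (forall i, P i -> dom (F i)) -> dom z ->
  dot (\sum_(i <- r | P i) F i) z = \sum_(i <- r | P i) dot (F i) z.
Proof.
move=> dF dz; elim: r => [|i r IH]; first by rewrite !big_nil inner0l.
rewrite !big_cons; case: ifP => // Pi.
by rewrite innerDl ?IH //; [exact: dF|exact: dom_sum].
Qed.

Lemma inner_sumr (J : Type) (r : seq J) (P : pred J) (F : J -> H) z :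
  (forall i, P i -> dom (F i)) -> dom z ->
  dot z (\sum_(i <- r | P i) F i) = \sum_(i <- r | P i) dot z (F i).
Proof.
move=> dF dz; elim: r => [|i r IH]; first by rewrite !big_nil inner0r.
rewrite !big_cons; case: ifP => // Pi.
by rewrite innerDr ?IH //; [exact: dF|exact: dom_sum].
Qed.

Lemma inner_norm x : dom x -> dot x x = (norm x ^+ 2)%:C.
Proof.
move=> dx; have [_ _ _ pos _] := hH.
have [->|/(pos _ dx) h] := eqVneq x 0.
  by rewrite /inorm (inner0l dom0) /= sqrtr0 expr0n.
have [h0 {1}->] := lt0c_real h; by rewrite /inorm sqr_sqrtr // ltW.
Qed.

Lemma norm_ge0 x : 0 <= norm x.
Proof. exact: sqrtr_ge0. Qed.

Lemma norm_eq0 x : dom x -> norm x = 0 -> x = 0.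
Proof.
move=> dx x0; have [_ _ _ pos _] := hH.
have [//|/(pos _ dx)] := eqVneq x 0.
by rewrite inner_norm // x0 expr0n ltxx.
Qed.

Lemma norm0 : norm 0 = 0.
Proof. by rewrite /inorm (inner0l dom0) /= sqrtr0. Qed.

Lemma normZ a x : dom x -> norm (a *: x) = normc a * norm x.
Proof.
move=> dx; have dax := domZ a dx.
apply/eqP; rewrite -(@eqrXn2 _ 2) ?mulr_ge0 ?norm_ge0 ?normc_ge0 // exprMn.
apply/eqP/complexI; rewrite -inner_norm // innerZl // innerZr // inner_norm // mulrA.
by rewrite mulc_conj -rmorphM.
Qed.

Lemma cauchy_schwarz x y : dom x -> dom y -> normc (dot x y) <= norm x * norm y.
Proof.
move=> dx dy; have [y0|y0] := eqVneq (norm y) 0.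
  by rewrite (norm_eq0 dy y0) inner0r // normc0 norm0 mulr0.
have yp : 0 < norm y by rewrite lt_neqAle eq_sym y0 norm_ge0.
pose a := dot x y / (norm y ^+ 2)%:C; have day := domZ a dy.
have yC : (norm y ^+ 2)%:C != 0 :> C by rewrite (fmorph_eq0 (real_complex R)) sqrf_eq0.
have dyx : dot y x = conjc (dot x y) by exact: innerC.
have E : dot (x - a *: y) (x - a *: y) = (norm x ^+ 2 - normc (dot x y) ^+ 2 / norm y ^+ 2)%:C.
  rewrite innerBl ?innerBr ?innerZl ?innerZr //; try exact: domB.
  have -> : (norm x ^+ 2 - normc (dot x y) ^+ 2 / norm y ^+ 2)%:C =
      (norm x ^+ 2)%:C - dot x y * conjc (dot x y) / (norm y ^+ 2)%:C.
    by rewrite mulc_conj -(fmorph_div (real_complex R)) -(rmorphB (real_complex R)).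
  have ca : conjc a = conjc (dot x y) / (norm y ^+ 2)%:C.
    rewrite (rmorphM conjc) (fmorphV conjc); congr (_ / _); exact: conjc_real.
  rewrite dyx !inner_norm // ca /a; clear -yC.
  by move: ((norm y ^+ 2)%:C) (conjc _) yC => N b N0; field.
move: E; rewrite (inner_norm (domB dx day)) => /complexI E.
have : 0 <= norm x ^+ 2 - normc (dot x y) ^+ 2 / norm y ^+ 2 by rewrite -E sqr_ge0.
rewrite subr_ge0 ler_pdivrMr ?exprn_gt0 // -exprMn ler_pXn2r ?nnegrE ?normc_ge0 //.
by rewrite mulr_ge0 ?norm_ge0.
Qed.

Lemma norm_sqD x y : dom x -> dom y ->
  norm (x + y) ^+ 2 = norm x ^+ 2 + 2 * complex.Re (dot x y) + norm y ^+ 2.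
Proof.
move=> dx dy; have dxy := domD dx dy.
have : dot (x + y) (x + y) = dot x x + dot x y + (conjc (dot x y) + dot y y).
  by rewrite innerDl // !innerDr // (innerC dx dy).
rewrite !inner_norm // => /(congr1 (@complex.Re R)) /= ->.
by case: (dot x y) => a b /=; ring.
Qed.

Lemma norm_sqB x y : dom x -> dom y ->
  norm (x - y) ^+ 2 = norm x ^+ 2 - 2 * complex.Re (dot x y) + norm y ^+ 2.
Proof.
move=> dx dy; have dN : dom (- y) by rewrite -scaleN1r; exact: domZ.
rewrite norm_sqD // -scaleN1r innerZr // normZ // normcN normc1 mul1r.
by case: (dot x y) => a b /=; ring.
Qed.

Lemma norm_triangle x y : dom x -> dom y -> norm (x + y) <= norm x + norm y.
Proof.
move=> dx dy; rewrite -(@ler_pXn2r _ 2) ?nnegrE ?addr_ge0 ?norm_ge0 //.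
rewrite norm_sqD // sqrrD lerD2r lerD2l -[X in _ <= X]mulr_natl ler_pM2l ?ltr0n //.
apply: le_trans (cauchy_schwarz dx dy).
exact: le_trans (ler_norm _) (normc_Re _).
Qed.

Lemma norm_sum (J : Type) (r : seq J) (P : pred J) (F : J -> H) :
  (forall i, P i -> dom (F i)) ->
  norm (\sum_(i <- r | P i) F i) <= \sum_(i <- r | P i) norm (F i).
Proof.
move=> dF; elim: r => [|i r IH]; first by rewrite !big_nil norm0.
rewrite !big_cons; case: ifP => // Pi.
apply: le_trans (norm_triangle (dF i Pi) _) _; first exact: dom_sum.
by rewrite lerD2l.
Qed.

Lemma normN x : dom x -> norm (- x) = norm x.
Proof. by move=> dx; rewrite -scaleN1r normZ // normcN normc1 mul1r. Qed.

Lemma norm_distC x y : dom x -> dom y -> norm (x - y) = norm (y - x).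
Proof. by move=> dx dy; rewrite -opprB normN //; exact: domB. Qed.

Lemma hilbert_complete (u : nat -> H) : (forall n, dom (u n)) -> is_cauchy u ->
  exists2 x : H, dom x & converges_to u x.
Proof. by have [_ _ _ _ h] := hH; exact: h. Qed.

Lemma dot_cvg (u : nat -> H) x y : (forall n, dom (u n)) -> dom x -> dom y ->
  converges_to u x -> ctends (fun n => dot (u n) y) (dot x y).
Proof.
move=> du dx dy ux e e0; have y1 : 0 < norm y + 1 by rewrite ltr_wpDl ?norm_ge0.
have [N uN] := ux (e / (norm y + 1)) (divr_gt0 e0 y1).
near=> n; rewrite -innerBl //.
apply: (le_trans (cauchy_schwarz (domB (du n) dx) dy)).
have nN : (N <= n)%N by near: n; exact: nbhs_infty_ge.
have := uN n nN => /ltW h.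
apply: (@le_trans _ _ (e / (norm y + 1) * (norm y + 1))).
  by apply: ler_pM; rewrite ?norm_ge0 // lerDl.
by rewrite divfK // gt_eqF.
Unshelve. all: by end_near. Qed.

Lemma norm_cvg (u : nat -> H) x : (forall n, dom (u n)) -> dom x ->
  converges_to u x -> forall S, (forall n, norm (u n) <= S) -> norm x <= S.
Proof.
move=> du dx ux S uS; apply/ler_addgt0Pr => e e0; have [N /(_ N (leqnn N)) uN] := ux e e0.
rewrite -[x](subrK (u N)) addrC (le_trans (norm_triangle _ _)) //; first exact: domB.
by rewrite lerD // norm_distC // ltW.
Qed.

(** For sequences of orthogonal projections: there the squared distances are differences of the
    squared norms, which are monotone and bounded. *)
Lemma cauchy_of_sq (u : nat -> H) (a : nat -> R) : (forall n, dom (u n)) -> cvgn a ->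
  (forall p q, (p <= q)%N -> norm (u p - u q) ^+ 2 <= `|a p - a q|) -> is_cauchy u.
Proof.
move=> du a_cvg dist e e0; have e2 : 0 < e ^+ 2 / 2 by rewrite divr_gt0 // exprn_gt0.
have /cvgrPdist_lt/(_ _ e2)[N _ aN] := a_cvg; exists N.
suff ordered p q : (N <= p)%N -> (p <= q)%N -> norm (u p - u q) < e.
  move=> p q Np Nq; have [pq|/ltnW qp] := leqP p q; first exact: ordered.
  by rewrite norm_distC //; exact: ordered.
move=> Np pq; rewrite -(@ltr_pXn2r _ 2) ?nnegrE ?norm_ge0 ?ltW //.
apply: (le_lt_trans (dist p q pq)); rewrite (splitr (e ^+ 2)).
rewrite -(subrK (limn a) (a p)) -addrA (le_lt_trans (ler_normD _ _)) //.
rewrite ltrD //; last exact: aN (leq_trans Np pq).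
by rewrite distrC; exact: aN.
Qed.

(* The averages of an orbit of the dyadic roots of unity under a unitary action
   are the orthogonal projections onto a decreasing sequence of subspaces. *)
Definition orbit_average (x : C -> H) n : H :=
  (2 ^ n)%:R^-1 *: \sum_(k < 2 ^ n) x (uroot R n k).

(** For n <= n' unitarity gives <P n, P n'> = <x 1, P n'> = <P n', P n'>. Hence |P n - P n'|^2 = |P
    n|^2 - |P n'|^2, and the squared norms decrease. *)
Lemma orbit_average_cauchy (x : C -> H) : (forall u, normc u = 1 -> dom (x u)) ->
  (forall u v w, normc u = 1 -> normc v = 1 -> normc w = 1 ->
     dot (x (u * v)) (x (u * w)) = dot (x v) (x w)) ->
  is_cauchy (orbit_average x).
Proof.
move=> dx xU; pose P := orbit_average x.
have dsum n : dom (\sum_(k < 2 ^ n) x (uroot R n k)).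
  by apply: dom_sum => k _; apply: dx; exact: normc_uroot.
have dP n : dom (P n) by apply: domZ; exact: dsum.
have d1 : dom (x 1) by apply: dx; exact: normc1.
have PP n n' : (n <= n')%N -> dot (P n) (P n') = dot (x 1) (P n').
  move=> nn'; have E (k : 'I_(2 ^ n)) : dot (x (uroot R n k)) (P n') = dot (x 1) (P n').
    have dk : dom (x (uroot R n k)) by apply: dx; exact: normc_uroot.
    rewrite !innerZr // !inner_sumr => //; try by move=> l _; apply: dx; exact: normc_uroot.
    congr (_ * _); rewrite -(@sum_uroot R C (fun u => dot (x (uroot R n k)) (x u)) _ _ k nn').
    apply: eq_bigr => l _; rewrite -{1}[uroot R n k]mulr1.
    by apply: xU; rewrite ?normc1 ?normc_uroot.
  rewrite {1}/P /orbit_average innerZl // inner_suml //; last first.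
    by move=> l _; apply: dx; exact: normc_uroot.
  rewrite (eq_bigr (fun=> dot (x 1) (P n'))) // sumr_const card_ord -[X in _ * X]mulr_natl.
  by rewrite mulKf // pow2_neq0.
pose a n := norm (P n) ^+ 2.
have dist n n' : (n <= n')%N -> norm (P n - P n') ^+ 2 = a n - a n'.
  move=> nn'; rewrite norm_sqB //.
  have -> : dot (P n) (P n') = (a n')%:C by rewrite PP // -(PP n') // inner_norm.
  rewrite /= /a; ring.
have a_cvg : cvgn a.
  apply: nonincreasing_is_cvgn; last by exists 0 => _ [n _ <-]; exact: sqr_ge0.
  by apply/nonincreasing_seqP => n; rewrite -subr_ge0 -dist // sqr_ge0.
apply: (cauchy_of_sq dP a_cvg) => p q pq; rewrite dist //; exact: ler_norm.
Qed.

End hilbert.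

(** * Totality of the monomials *)

Section rotations.
Variables (R : realType) (m : nat).
Local Notation C := (R[i]).
Local Notation V := (Cn R m).
Local Notation H := (bergman_space R m).
Implicit Types (f g : V -> C^o) (z h : V) (k : 'I_m -> nat) (i : 'I_m).

Definition rot i (u : C) f : V -> C^o := fun z => f (upd z i (u * z 0 i)).

Lemma rot_rot i u v f : rot i u (rot i v f) = rot i (u * v) f.
Proof. by apply/funext => z; rewrite /rot upd_upd updE eqxx mulrCA mulrA. Qed.

Lemma in_ball_rot i (u : C) z : normc u = 1 -> in_ball (upd z i (u * z 0 i)) = in_ball z.
Proof.
move=> u1; rewrite -[in_ball _]/(ballsum _ < 1) ballsum_upd //.
by rewrite normcM u1 mul1r.
Qed.

(** Chain rule: the differential is that of f at the rotated point, with its i-th partial derivative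
    multiplied by u. *)
Lemma rot_holomorphic i u f : normc u = 1 -> ball_holomorphic f -> ball_holomorphic (rot i u f).
Proof.
move=> u1 [fd f0]; split=> z zb; last by rewrite /rot f0 // in_ball_rot.
have fz := fd _ (etrans (in_ball_rot i z u1) zb).
set z' := upd z i _ in fz; pose L := 'd f z' : {linear V -> C^o}.
pose D j := (if j == i then u else 1) * (L (delta_mx 0 j) : C).
have LE h : L (upd h i (u * h 0 i)) = dotv D h.
  rewrite linear_dotv /dotv; apply: eq_bigr => j _; rewrite updE /D.
  by case: eqP => [->|_]; [rewrite mulrAC mulrC mulrA|rewrite mul1r].
apply: (@rnorm_differentiable R V C^o (rot i u f) (dotv D) z); first exact: dotv_continuous.
move=> e e0; have [d d0 dP] := differentiable_rnorm fz e0.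
exists d => // h hd; have hh : rnorm (upd h i (u * h 0 i)) <= rnorm h.
  apply: rnorm_le => [|j]; first exact: rnorm_ge0.
  rewrite updE; case: eqP => [_|_]; rewrite ?normcM ?u1 ?mul1r; exact: normc_coord_le.
have -> : rot i u f (z + h) = f (z' + upd h i (u * h 0 i)).
  rewrite /rot; congr f; apply/rowP => j; rewrite !mxE.
  by case: (j == i) => //; rewrite mulrDr.
have LEh : 'd f z' (upd h i (u * h 0 i)) = dotv D h := LE h.
have := dP _ (le_lt_trans hh hd); rewrite LEh => /le_trans; apply.
by rewrite ler_pM2l.
Qed.

Lemma rot_bergman i u f : normc u = 1 -> bergman_set f -> bergman_set (rot i u f).
Proof.
move=> u1 /bergman_setE[hf foo]; apply/bergman_setE; split; first exact: rot_holomorphic.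
have [Phi [pPhi PhiE]] := coordinate_rotation i u1.
have <- : (fun t => lift f (Phi t)) = lift (rot i u f).
  by apply/funext => t; rewrite /lift PhiE.
by rewrite (preserving_sqint pPhi (lift_cmeasurable hf)).
Qed.

Lemma rot_inner i u f g : normc u = 1 -> bergman_set f -> bergman_set g ->
  bergman_inner (rot i u f) (rot i u g) = bergman_inner f g.
Proof.
move=> u1 /bergman_setE[hf _] /bergman_setE[hg _].
rewrite (bergman_innerE _ (rot_holomorphic i u1 hf)) (bergman_innerE _ hf).
have [Phi [pPhi PhiE]] := coordinate_rotation i u1; congr (_ * _).
have mh : cmeasurable setT (fun t => lift f t * conjc (lift g t)).
  apply: cmeasurableM; first exact: lift_cmeasurable hf.
  exact/cmeasurable_conj/lift_cmeasurable.
rewrite -(preserving_cint pPhi mh); congr (cint _ _ _); apply/funext => t.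
by rewrite /lift PhiE.
Qed.

(** The projection of f to the functions on which each 2^n-th root of unity u, rotating the i-th
    coordinate, acts by u^d. *)
Definition torus_average i d f : nat -> H :=
  @orbit_average R H (fun u => conjc u ^+ d *: rot i u f).

Lemma torus_averageE i d f n z : torus_average i d f n z =
  circ n (fun u => conjc u ^+ d * f (upd z i (u * z 0 i))) 1.
Proof.
rewrite /torus_average /orbit_average /circ.
rewrite -[LHS]/(_^-1 * ((\sum_(k < 2 ^ n) _ : V -> C^o) z)); congr (_ * _).
rewrite fct_sumE; apply: eq_bigr => k _; by rewrite mul1r.
Qed.

Lemma torus_average_dom i d f n : bergman_set f -> bergman_set (torus_average i d f n).
Proof.
move=> bf; have hH := bergman_is_hilbert R m.
apply: (domZ hH); apply: (dom_sum hH) => k _; apply: (domZ hH).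
by apply: rot_bergman => //; exact: normc_uroot.
Qed.

Lemma torus_average_cauchy i d f : bergman_set f -> is_cauchy (torus_average i d f).
Proof.
move=> bf; have hH := bergman_is_hilbert R m; have rb u u1 := @rot_bergman i u f u1 bf.
apply: (orbit_average_cauchy hH) => [u u1|u v w u1 v1 w1].
  by apply: (domZ hH); exact: rb.
have uv1 : normc (u * v) = 1 by rewrite normcM u1 v1 mul1r.
have uw1 : normc (u * w) = 1 by rewrite normcM u1 w1 mul1r.
have bv := rb v v1; have bw := rb w w1.
have buv := rb _ uv1; have buw := rb _ uw1.
rewrite [LHS](innerZZ hH _ _ buv buw) [RHS](innerZZ hH _ _ bv bw).
rewrite -!rot_rot [inner _ _](rot_inner i u1 bv bw); congr (_ * _).
rewrite !conjcX !conjcM !conjcK -!exprMn; congr (_ ^+ _).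
by rewrite -[RHS]mul1r -(normc1_mul_conj u1); ring.
Qed.

(** The monomial is fixed by each twisted rotation of the average, and these rotations are
    unitary. *)
Lemma torus_average_inner i k f n : bergman_set f ->
  bergman_inner (torus_average i (k i) f n) (mono k) = bergman_inner f (mono k).
Proof.
move=> bf; have hH := bergman_is_hilbert R m; have bk := @mono_bergman R m k.
have rb u u1 := @rot_bergman i u f u1 bf.
have dl (l : 'I_(2 ^ n)) : is_dom (conjc (uroot R n l) ^+ k i *: rot i (uroot R n l) f : H).
  by apply: (domZ hH); apply: rb; exact: normc_uroot.
rewrite [LHS](innerZl hH _ (dom_sum hH _ (fun l _ => dl l)) bk).
rewrite (inner_suml hH _ (fun l _ => dl l) bk).
rewrite (eq_bigr (fun=> bergman_inner f (mono k))) => [|l _].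
  by rewrite sumr_const card_ord -[X in _ * X]mulr_natl mulKf // pow2_neq0.
set u := uroot _ _ _; have u1 : normc u = 1 by exact: normc_uroot.
rewrite (innerZl hH _ (rb _ u1) bk).
have mk : mono k = conjc u ^+ k i *: rot i u (mono k) :> (V -> C^o).
  apply/funext => z; rewrite -[RHS]/(_ * _) /rot mono_rotation // mulrA -exprMn.
  by rewrite [_ * u]mulrC normc1_mul_conj // expr1n mul1r.
rewrite {1}mk (innerZr hH _ (rot_bergman i u1 bk) (rb _ u1)).
rewrite [inner _ _](rot_inner i u1 bf bk) mulrA conjcX conjcK -exprMn [_ * u]mulrC.
by rewrite normc1_mul_conj // expr1n mul1r.
Qed.

Lemma bergman_point_cvg (u : nat -> H) f z : (forall n, bergman_set (u n)) ->
  bergman_set f -> converges_to u f -> in_ball z -> ctends (fun n => u n z) (f z).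
Proof.
move=> bu bf uf zb e e0; have [d d0 dz] := in_ball_open zb.
have [v0 _] := ball_volume_fin R m; have k0 := kappa_gt0 m d0.
pose q := kappa m d / ball_volume R m; have q0 : 0 < q by exact: divr_gt0.
have e'0 : 0 < e * Num.sqrt q by rewrite mulr_gt0 // sqrtr_gt0.
have [N uN] := uf _ e'0; near=> n; have nN : (N <= n)%N by near: n; exact: nbhs_infty_ge.
have buf := bergman_set_sub (bu n) bf.
have := uN n nN; rewrite inorm_lt // exprMn (sqr_sqrtr (ltW q0)) -mulrA /q.
rewrite [_ / _ * _]divfK ?gt_eqF // => h.
have := le_lt_trans (sqnorm_point buf d0 dz) h.
rewrite ltr_pM2r // ltr_pXn2r ?nnegrE ?normc_ge0 ?(ltW e0) // => h'; exact: ltW.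
Unshelve. all: by end_near. Qed.

End rotations.

Section totality.
Variables (R : realType) (m : nat).
Local Notation C := (R[i]).
Local Notation V := (Cn R m).
Local Notation H := (bergman_space R m).
Implicit Types (f g : V -> C^o) (z h : V) (k : 'I_m -> nat) (i : 'I_m).

Lemma conj_invX (v : C) d : normc v = 1 -> conjc v ^+ d = (v ^+ d)^-1.
Proof.
move=> v1; have v0 : v != 0 by rewrite -normc_gt0 v1.
by rewrite -exprVn; congr (_ ^+ _); apply: (mulfI v0); rewrite normc1_mul_conj // divff.
Qed.

(** On the unit circle conj v = 1 / v, so the limit is the d-th Taylor coefficient of the constant
    1. Computing it on the circles of radius 1 and 2 gives c = 2^-d c, hence c = 0. *)
Lemma circ_conj_power d : (0 < d)%N -> ctends (fun n => circ n (fun v : C => conjc v ^+ d) 1) 0.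
Proof.
move=> d0; pose g (w : C) : C := 1.
have [c [cP _]] := @taylor R g 4 (fun w _ => cderivable_cst 1 w) (ltr0n _ 4).
have n1 : normc (1 : C) = 1 := normc1 R.
have n2 : normc (2 : C) = 2 := normc_nat R 2.
have h1 : ctends (fun n => circ n (fun w => g w / w ^+ d) 1) (c d).
  by apply: cP; rewrite n1 ltr01 ltr1n.
have h2 : ctends (fun n => circ n (fun w => g w / w ^+ d) 2) (c d).
  by apply: cP; rewrite n2 ltr0n ltr_nat.
have h3 : ctends (fun n => circ n (fun w => g w / w ^+ d) 2) ((2 ^+ d)^-1 * c d).
  have E n : circ n (fun w => g w / w ^+ d) 2 = (2 ^+ d)^-1 * circ n (fun w => g w / w ^+ d) 1.
    rewrite -circZ -{1}[2]mulr1 circ_scale; apply: eq_circ => w _.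
    by rewrite /g !mul1r exprMn invfM.
  by rewrite (funext E); exact: ctendsZ.
have cd0 : c d = 0.
  apply/eqP; have /eqP := ctends_unique h2 h3.
  rewrite -subr_eq0 -[X in X - _]mul1r -mulrBl mulf_eq0 => /orP[|//].
  rewrite subr_eq0 => /eqP/(congr1 (@normc R)); rewrite n1 normcV normcX n2 => /esym/eqP.
  rewrite invr_eq1 -natrX pnatr_eq1 => /eqP h.
  by have := ltn_expl d (ltnSn 1); rewrite h ltnS leqn0 => /eqP d0'; rewrite d0' in d0.
rewrite -cd0 (_ : (fun n => _) = (fun n => circ n (fun w => g w / w ^+ d) 1)) //.
apply/funext => n; apply: eq_circ => w; rewrite n1 => w1.
by rewrite conj_invX // /g mul1r.
Qed.

(** The Taylor expansion of f in the i-th coordinate on the slice of the ball through z, which is a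
    disc. The averages isolate its d-th term; if all terms vanish, the remainder bound forces f z =
    0. *)
Lemma slice_coefficients i f z : ball_holomorphic f -> in_ball z -> exists c : nat -> C,
  (forall d w, in_ball (upd z i w) ->
     ctends (fun n => torus_average i d f n (upd z i w)) (c d * w ^+ d)) /\
  ((forall d w, in_ball (upd z i w) -> c d * w ^+ d = 0) -> f z = 0).
Proof.
move=> [fd f0] zb; pose s := ballsum (upd z i 0).
have s1 : s < 1 by apply: (in_ball_upd (i := i) (w := 0) _ zb); rewrite normc0 normc_ge0.
have S w : ballsum (upd z i w) = s + normc w ^+ 2.
  rewrite /s /ballsum (bigD1 i) // [in RHS](bigD1 i) //= !updE eqxx normc0 expr0n add0r addrC.
  by congr (_ + _); apply: eq_bigr => j ji; rewrite !updE (negbTE ji).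
pose rho := Num.sqrt (1 - s); have rho0 : 0 < rho by rewrite sqrtr_gt0 subr_gt0.
have inE w : in_ball (upd z i w) = (normc w < rho).
  rewrite -[in_ball _]/(ballsum _ < 1) S -ltrBrDl -(sqr_sqrtr (a := 1 - s)) ?subr_ge0 1?ltW //.
  by rewrite ltr_pXn2r ?nnegrE ?normc_ge0 // ltW.
pose g (w : C) : C := f (upd z i w).
have gd w : normc w < rho -> cderivable g w.
  have -> : g = (fun t => f (upd z i 0 + t *: delta_mx 0 i)).
    by apply/funext => t; rewrite /g upd_shift.
  by rewrite -inE => /fd; rewrite upd_shift; exact: slice_cderivable.
have [c [cP cR]] := taylor gd rho0; exists c; split=> [d w|c0].
  rewrite inE => wrho.
  have AE n : torus_average i d f n (upd z i w) = circ n (fun v => conjc v ^+ d * g (v * w)) 1.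
    by rewrite torus_averageE updE eqxx; apply: eq_circ => v _; rewrite upd_upd.
  rewrite (funext AE); have [->|w0] := eqVneq w 0; last first.
    have E n : circ n (fun v => conjc v ^+ d * g (v * w)) 1 =
        w ^+ d * circ n (fun x => g x / x ^+ d) w.
      rewrite -{3}[w]mulr1 circ_scale -circZ; apply: eq_circ => v; rewrite normc1 => v1.
      rewrite conj_invX // exprMn invfM [v * w]mulrC.
      have v0 : v != 0 by rewrite -normc_gt0 v1 ltr01.
      by field; rewrite !expf_neq0.
    rewrite (funext E) mulrC; apply: ctendsZ; apply: cP.
    by rewrite normc_gt0 w0.
  (* At w = 0 only the mean of conj v^d remains: it tends to 0 for d > 0, and for d = 0 it is 1 and
     the coefficient is g 0. *)
  have E n : circ n (fun v => conjc v ^+ d * g (v * 0)) 1 = g 0 * circ n (fun v => conjc v ^+ d) 1.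
    by rewrite -circZ; apply: eq_circ => v _; rewrite mulr0 mulrC.
  rewrite (funext E); case: d {AE E} => [|d]; last first.
    have -> : c d.+1 * 0 ^+ d.+1 = g 0 * 0 by rewrite expr0n !mulr0.
    by apply: ctendsZ; exact: circ_conj_power.
  have -> : c 0%N = g 0.
    have r1 : rho / 2 < rho by rewrite ltr_pdivrMr // ltr_pMr // ltr1n.
    have r0 : 0 < rho / 2 by rewrite divr_gt0.
    have [M gM] := bounded_on_circle gd r1.
    have := cR (rho / 2) M _ gM 0 1%N; rewrite r0 r1 normc0 => /(_ isT r0).
    rewrite big_ord1 expr0 mulr1 mul0r expr1 mulr0 mul0r => h.
    apply/esym/eqP; rewrite -subr_eq0 -normc_eq0 eq_le h; exact: normc_ge0.
  rewrite expr0; apply: ctendsZ.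
  have E n : circ n (fun v => conjc v ^+ 0) 1 = 1 :> C by exact: circ_cst.
  by rewrite (funext E); exact: ctends_cst.
have {}c0 : forall d, c d = 0.
  move=> d; have w0 : normc (rho / 2)%:C = rho / 2.
    by rewrite normc_real ger0_norm // divr_ge0 // ltW.
  have := c0 d (rho / 2)%:C; rewrite inE w0 ltr_pdivrMr // ltr_pMr // ltr1n => /(_ isT)/eqP.
  rewrite mulf_eq0 => /orP[/eqP//|]; rewrite expf_eq0 => /andP[_].
  by rewrite -normc_eq0 w0 gt_eqF // divr_gt0.
pose a := z 0 i; have fa : f z = g a by rewrite /g upd_id.
have arho : normc a < rho by rewrite -inE upd_id.
pose r := (normc a + rho) / 2.
have ar : normc a < r by rewrite /r ltr_pdivlMr // mulr_natr mulr2n ltrD2l.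
have rrho : r < rho by rewrite /r ltr_pdivrMr // mulr_natr mulr2n ltrD2r.
have r0 : 0 < r by exact: le_lt_trans (normc_ge0 a) ar.
have [M gM] := bounded_on_circle gd rrho.
have bnd K : normc (g a) <= M * (normc a / r) ^+ K * (r / (r - normc a)).
  have := cR r M _ gM a K; rewrite r0 rrho => /(_ isT ar).
  by rewrite big1 ?subr0 // => k _; rewrite c0 mul0r.
have x1 : `|normc a / r| < 1.
  rewrite ger0_norm; first by rewrite ltr_pdivrMr // mul1r.
  by apply: divr_ge0; [exact: normc_ge0|exact: ltW].
rewrite fa; apply/eqP; rewrite -normc_eq0 eq_le normc_ge0 andbT.
have lim0 : (fun K => M * (normc a / r) ^+ K * (r / (r - normc a))) @ \oo --> (0 : R).
  rewrite -(mul0r (r / (r - normc a))) -{1}(mulr0 M).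
  apply: cvgM; last exact: cvg_cst.
  by apply: cvgM; [exact: cvg_cst|exact: cvg_expr].
rewrite -(cvg_lim _ lim0) //; apply: limr_ge; first by apply/cvg_ex; exists 0.
by apply: nearW => K; exact: bnd.
Qed.

(** The factor a ranges over the closed disc and not only over rotations, so that values at points
    of different moduli can be compared. *)
Definition homogeneous i d f := forall z (a : C), in_ball z -> normc a <= 1 ->
  f (upd z i (a * z 0 i)) = a ^+ d * f z.

Lemma isotypic_components i f : bergman_set f -> exists q : nat -> V -> C^o,
  [/\ forall d, bergman_set (q d),
      forall d k, k i = d -> bergman_inner (q d) (mono k) = bergman_inner f (mono k),
      forall d, homogeneous i d (q d),
      forall d j d', j != i -> homogeneous j d' f -> homogeneous j d' (q d) &
      (forall d, q d = 0) -> f = 0].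
Proof.
move=> bf; have hH := bergman_is_hilbert R m; have [hf _] := (bergman_setE f).1 bf.
have bA d n := @torus_average_dom R m i d f n bf.
have /choice[q qP] d : exists q : V -> C^o,
    bergman_set q /\ converges_to (torus_average i d f) (q : H).
  by have [q bq qP] := hilbert_complete hH (bA d) (torus_average_cauchy i d bf); exists q.
have bq d : bergman_set (q d) by have [] := qP d.
have qz d z : in_ball z -> ctends (fun n => torus_average i d f n z) (q d z).
  by apply: bergman_point_cvg => //; have [] := qP d.
have in_scale z j (a : C) : in_ball z -> normc a <= 1 -> in_ball (upd z j (a * z 0 j)).
  move=> zb a1; apply: in_ball_upd => //.
  by rewrite normcM ler_piMl ?normc_ge0.
exists q; split=> // [d k <-|d z a zb a1|d j d' ji fj z a zb a1|q0].
- have [_ qc] := qP (k i).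
  have h := dot_cvg hH (bA (k i)) (bq (k i)) (@mono_bergman R m k) qc.
  apply: (ctends_unique h); rewrite (_ : (fun n => _) = (fun=> bergman_inner f (mono k))).
    exact: ctends_cst.
  by apply/funext => n; exact: torus_average_inner.
- have [c [cP _]] := slice_coefficients i hf zb; have zb' := in_scale z i a zb a1.
  have := ctends_unique (qz d _ zb') (cP d _ zb') => ->.
  have zi : in_ball (upd z i (z 0 i)) by rewrite upd_id.
  have := cP d _ zi; rewrite upd_id => h.
  by rewrite (ctends_unique (qz d _ zb) h) exprMn mulrCA.
- have zb' := in_scale z j a zb a1; apply: (ctends_unique (qz d _ zb')).
  rewrite (_ : (fun n => _) = (fun n => a ^+ d' * torus_average i d f n z)).
    by apply: ctendsZ; exact: qz.
  apply/funext => n; rewrite !torus_averageE -circZ; apply: eq_circ => v; rewrite normc1 => v1.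
  rewrite updE eq_sym (negbTE ji) updC // mulrCA; congr (_ * _).
  have zv : in_ball (upd z i (v * z 0 i)) by rewrite in_ball_rot.
  by rewrite -(fj _ a zv a1) updE (negbTE ji).
apply/funext => z; have [zb|zb] := boolP (in_ball z); last exact: hf.2.
have [c [cP]] := slice_coefficients i hf zb; apply=> d w wb.
by have := ctends_unique (qz d _ wb) (cP d _ wb); rewrite q0 => <-.
Qed.

(** The coordinates are scaled one after another; every intermediate point stays in the ball because
    the factors have modulus at most 1. *)
Lemma homogeneous_scale (n : 'I_m -> nat) f (a : 'I_m -> C) z :
  (forall i, homogeneous i (n i) f) -> (forall i, normc (a i) <= 1) -> in_ball z ->
  f (\row_i (a i * z 0 i)) = \prod_i a i ^+ n i * f z.
Proof.
move=> fh a1 zb; pose w := foldr (fun i z => upd z i (a i * z 0 i)) z.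
have wP s : uniq s -> [/\ in_ball (w s), f (w s) = \prod_(i <- s) a i ^+ n i * f z &
    forall i, w s 0 i = (if i \in s then a i else 1) * z 0 i].
  elim: s => [|i s IH] /= => [_|/andP[is_ /IH[b1 b2 b3]]].
    by rewrite big_nil mul1r; split=> // i; rewrite mul1r.
  split.
  - by apply: in_ball_upd => //; rewrite normcM ler_piMl ?normc_ge0.
  - by rewrite fh // b2 big_cons mulrA.
  - move=> j; rewrite updE inE b3; case: eqP => [->|//] /=.
    by rewrite (negbTE is_) mul1r.
have [_ fw wE] := wP _ (enum_uniq 'I_m).
rewrite big_enum /= in fw; rewrite -fw; congr f; apply/rowP => i.
by rewrite mxE wE mem_enum.
Qed.

(** Induction on the number e of coordinates in which g is not yet known to be homogeneous; passing
    to isotypic components settles one more. A function homogeneous in all coordinates is a multiple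
    of one monomial, to which it is orthogonal. *)
Theorem bergman_monomials_total f : bergman_set f ->
  (forall k, bergman_inner f (mono k) = 0) -> f = 0.
Proof.
move=> bf0 f0; have hH := bergman_is_hilbert R m.
suff claim e : forall J (n : 'I_m -> nat) g, (m <= J + e)%N -> bergman_set g ->
    (forall j : 'I_m, (j < J)%N -> homogeneous j (n j) g) ->
    (forall k, (forall j : 'I_m, (j < J)%N -> k j = n j) -> bergman_inner g (mono k) = 0) ->
    g = 0.
  by apply: (claim m 0%N (fun=> 0%N)) => //; rewrite add0n.
elim: e => [|e IH] J n g mJ bg gh g0; last first.
  have [mJ'|Jm] := leqP m J; first by apply: (IH J n) => //; rewrite (leq_trans mJ') // leq_addr.
  pose i := Ordinal Jm; have [q [bq qin qi qj]] := isotypic_components i bg; apply=> d.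
  apply: (IH J.+1 (fun j => if j == i then d else n j)) => //.
  - by rewrite addSnnS.
  - move=> j; rewrite ltnS leq_eqVlt => /orP[/eqP jJ|jJ].
      have -> : j = i by exact/val_inj.
      by rewrite eqxx; exact: qi.
    have ji : j != i by rewrite -val_eqE /= neq_ltn jJ.
    by rewrite (negbTE ji); apply: qj => //; exact: gh.
  - move=> k kn; rewrite qin; last by rewrite kn ?eqxx.
    apply: g0 => j jJ; rewrite kn ?(ltnW jJ) //; last exact: leqW.
    by rewrite -val_eqE /= ltn_eqF.
rewrite addn0 in mJ.
have {}gh i : homogeneous i (n i) g by apply: gh; exact: leq_trans (ltn_ord i) mJ.
have {}g0 : bergman_inner g (mono n) = 0 by exact: g0.
have [s [s0 pb]] : exists s : R, 0 < s /\ in_ball (const_mx s%:C : V).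
  have [d d0 dB] := in_ball_open (in_ball0 R m).
  have d2 : 0 < d / 2 by rewrite divr_gt0.
  exists (d / 2); split=> //; rewrite -[const_mx _]add0r; apply: dB.
  apply: (@le_lt_trans _ _ (d / 2)); last by rewrite ltr_pdivrMr // ltr_pMr // ltr1n.
  by apply: rnorm_le => [|i]; rewrite ?mxE ?normc_real ?ger0_norm // ltW.
have [hg _] := (bergman_setE g).1 bg.
have sC : s%:C != 0 :> C by rewrite -normc_gt0 normc_real gtr0_norm.
have s1 (i : 'I_m) : normc (s%:C : C) <= 1.
  by have := in_ball_coord i pb; rewrite mxE => /ltW.
pose c := g (const_mx s%:C) / \prod_(i < m) s%:C ^+ n i.
have P0 : \prod_(i < m) s%:C ^+ n i != 0 :> C.
  by apply/prodf_neq0 => i _; rewrite expf_neq0.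
have gE : g = c *: mono n.
  apply/funext => z; rewrite -[RHS]/(c * mono n z) /mono /on_ball.
  case: ifP => [zb|/negbT zb]; last by rewrite hg.2 // mulr0.
  (* The point with coordinates s z_i is the constant point scaled by z and also z scaled by s;
     comparing the two values of g gives g z = c z^n. *)
  have h1 := homogeneous_scale gh (a := fun i => z 0 i) (fun i => ltW (in_ball_coord i zb)) pb.
  have h2 := homogeneous_scale gh (a := fun=> s%:C) s1 zb.
  apply: (mulfI P0); rewrite -h2 (_ : \row_i _ = \row_i (z 0 i * (const_mx s%:C : V) 0 i)).
    by rewrite h1 /c /cmon mulrC mulrA [X in _ = X * _]mulrCA divff ?mulr1.
  by apply/rowP => i; rewrite !mxE mulrC.
have mb := @mono_bergman R m n.
have := bergman_inner_gt0 mb (@mono_neq0 R m n); rewrite lt0r => /andP[mm0 _].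
have [c0|c0] := eqVneq c 0; first by rewrite gE c0 scale0r.
move: g0; rewrite gE [bergman_inner _ _](innerZl hH _ mb mb) => /eqP.
by rewrite mulf_eq0 (negbTE c0) (negbTE mm0).
Qed.

End totality.

(** * Orthonormal bases and truncations *)

Section basis_sum.
Variables (R : realType) (H : ispace R) (J : countType) (u : J -> H).
Implicit Types (f : H) (B : pred J).

(** The basis is enumerated by the codes of the countable type J; a k that is no code contributes
    0. *)
Definition basis_term B f k : H :=
  if @pickle_inv J k is Some t then if B t then @inner R H f (u t) *: u t else 0 else 0.

Definition basis_sum B f n : H := \sum_(k < n) basis_term B f k.

End basis_sum.

(* Locking proj and coef keeps unification from comparing integrals. *)
HB.lock Definition proj (R : realType) (H : ispace R) (J : countType) (u : J -> H)
    (B : pred J) (f : H) : H :=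
  xget 0 [set g | is_dom g /\ converges_to (basis_sum u B f) g].

Section hilbert_basis.
Variables (R : realType) (H : ispace R) (J : countType).
Hypothesis hH : is_hilbert H.
Local Notation C := (R[i]).
Local Notation dom := (@is_dom R H).
Local Notation dot := (@inner R H).
Local Notation norm := (@inorm R H).
Implicit Types (f g : H) (B D : pred J) (t : J).

Definition hilbert_basis (u : J -> H) :=
  [/\ forall t, dom (u t), forall s t, dot (u s) (u t) = (s == t)%:R &
      forall f, dom f -> (forall t, dot f (u t) = 0) -> f = 0].

Variable u : J -> H.
Hypothesis hu : hilbert_basis u.

Lemma basis_dom t : dom (u t).
Proof. by have [h _ _] := hu; exact: h. Qed.

Lemma basis_dot s t : dot (u s) (u t) = (s == t)%:R.
Proof. by have [_ h _] := hu; exact: h. Qed.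

Lemma basis_ext f g : dom f -> dom g -> (forall t, dot f (u t) = dot g (u t)) -> f = g.
Proof.
move=> df dg fg; have [_ _ h] := hu; apply/eqP; rewrite -subr_eq0; apply/eqP/h.
  exact: domB.
by move=> t; rewrite innerBl //; [rewrite fg subrr|exact: basis_dom].
Qed.

Lemma basis_norm t : norm (u t) = 1.
Proof.
have := inner_norm hH (basis_dom t); rewrite basis_dot eqxx => /(congr1 (@complex.Re R)) /= h.
by apply/eqP; rewrite -sqrp_eq1 ?norm_ge0 // -h.
Qed.

Local Notation basis_term := (basis_term u).
Local Notation basis_sum := (basis_sum u).

Lemma basis_sumS B f n : basis_sum B f n.+1 = basis_sum B f n + basis_term B f n.
Proof. exact: big_ord_recr. Qed.

Lemma basis_term_dom B f k : dom (basis_term B f k).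
Proof.
rewrite /basis_term; case: pickle_inv => [t|]; last exact: dom0.
by case: (B t); [exact/(domZ hH)/basis_dom|exact: dom0].
Qed.

Lemma basis_sum_dom B f n : dom (basis_sum B f n).
Proof. by apply: (dom_sum hH) => k _; exact: basis_term_dom. Qed.

Lemma basis_sum_dot B f n t :
  dot (basis_sum B f n) (u t) = if B t && (pickle t < n)%N then dot f (u t) else 0.
Proof.
elim: n => [|n IH]; first by rewrite /basis_sum big_ord0 andbF (inner0l hH (basis_dom t)).
rewrite basis_sumS innerDl ?IH //; try exact: basis_dom; try exact: basis_sum_dom;
  last exact: basis_term_dom.
have -> : dot (basis_term B f n) (u t) = if B t && (pickle t == n) then dot f (u t) else 0.
  rewrite /basis_term; case E: (@pickle_inv J n) => [s|]; last first.
    case: eqP => [tn|_]; last by rewrite andbF (inner0l hH (basis_dom t)).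
    by have := pickleK_inv t; rewrite tn E.
  have sn : pickle s = n by have := @pickle_invK J n; rewrite E.
  rewrite -sn (inj_eq (pcan_inj pickleK)); have [->|st] := eqVneq t s.
    rewrite andbT; case: (B s); last by rewrite (inner0l hH (basis_dom s)).
    by rewrite innerZl ?basis_dot ?eqxx ?mulr1 //; exact: basis_dom.
  rewrite andbF; case: (B s); last by rewrite (inner0l hH (basis_dom t)).
  by rewrite innerZl ?basis_dot 1?eq_sym ?(negbTE st) ?mulr0 //; exact: basis_dom.
rewrite [in RHS]ltnS [in RHS]leq_eqVlt; case: (B t) => /=; last exact: addr0.
by case: ltngtP => _ /=; rewrite ?addr0 ?add0r.
Qed.

Lemma dot_basis_sum B f g h p : dom g -> dom h ->
  (forall t, B t -> (pickle t < p)%N -> dot g (u t) = dot h (u t)) ->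
  dot g (basis_sum B f p) = dot h (basis_sum B f p).
Proof.
move=> dg dh gh; rewrite !(inner_sumr hH) //; try by move=> k _; exact: basis_term_dom.
apply: eq_bigr => k _; rewrite /basis_term; case E: (@pickle_inv J k) => [t|]; last first.
  by rewrite !(inner0r hH).
case: ifP => Bt; last by rewrite !(inner0r hH).
have tk : pickle t = k by have := @pickle_invK J k; rewrite E.
by rewrite !(innerZr hH) ?gh ?tk //; exact: basis_dom.
Qed.

Lemma basis_sum_dotr B f p q : dom f -> (p <= q)%N ->
  dot (basis_sum B f q) (basis_sum B f p) = dot f (basis_sum B f p).
Proof.
move=> df pq; apply: dot_basis_sum => // [|t Bt tp]; first exact: basis_sum_dom.
by rewrite basis_sum_dot Bt (leq_trans tp pq).
Qed.

(** With S the partial sum, |S|^2 = <f, S> <= |f| |S|. *)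
Lemma bessel B f p : dom f -> norm (basis_sum B f p) <= norm f.
Proof.
move=> df; have dS := basis_sum_dom B f p.
have := cauchy_schwarz hH df dS; rewrite -(basis_sum_dotr B df (leqnn p)) inner_norm //.
rewrite normc_real ger0_norm ?sqr_ge0 // expr2.
have [->|n0] := eqVneq (norm (basis_sum B f p)) 0; first by rewrite norm_ge0.
by rewrite ler_pM2r // lt_neqAle eq_sym n0 norm_ge0.
Qed.

Lemma basis_sum_cvg B f : dom f -> exists2 g : H, dom g & converges_to (basis_sum B f) g.
Proof.
move=> df; apply: (hilbert_complete hH (basis_sum_dom B f)).
have dS n := basis_sum_dom B f n; pose a n := norm (basis_sum B f n) ^+ 2.
have dist p q : (p <= q)%N -> norm (basis_sum B f p - basis_sum B f q) ^+ 2 = a q - a p.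
  move=> pq; rewrite (norm_distC hH) // (norm_sqB hH) // basis_sum_dotr //.
  rewrite -(basis_sum_dotr B df (leqnn p)) inner_norm //= /a; ring.
apply: (cauchy_of_sq hH dS (a := a)) => [|p q pq]; last first.
  by rewrite dist // distrC; exact: ler_norm.
apply: nondecreasing_is_cvgn.
  by apply/nondecreasing_seqP => n; rewrite -subr_ge0 -dist // sqr_ge0.
exists (norm f ^+ 2) => _ [n _ <-].
by rewrite /a ler_pXn2r ?nnegrE ?norm_ge0 // bessel.
Qed.

Local Notation proj := (proj u).

Lemma proj_cvg B f : dom f -> dom (proj B f) /\ converges_to (basis_sum B f) (proj B f).
Proof.
move=> df; have [g dg gP] := basis_sum_cvg B df; rewrite unlock.
by have := @xgetPex _ (0 : H) [set g | dom g /\ converges_to (basis_sum B f) g]; apply; exists g.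
Qed.

Lemma proj_dom B f : dom f -> dom (proj B f).
Proof. by move=> df; have [] := proj_cvg B df. Qed.

Lemma proj_dot B f t : dom f -> dot (proj B f) (u t) = if B t then dot f (u t) else 0.
Proof.
move=> df; have [dp cp] := proj_cvg B df.
have h := dot_cvg hH (basis_sum_dom B f) dp (basis_dom t) cp.
apply: (ctends_unique h) => e e0; near=> n.
have tn : (pickle t < n)%N by near: n; exact: nbhs_infty_gt.
by rewrite basis_sum_dot tn andbT subrr normc0 ltW.
Unshelve. all: by end_near. Qed.

Lemma proj_norm B f : dom f -> norm (proj B f) <= norm f.
Proof.
move=> df; have [dp cp] := proj_cvg B df.
by apply: (norm_cvg hH (basis_sum_dom B f) dp cp) => n; exact: bessel.
Qed.

Lemma proj_linear B (a : C) f g : dom f -> dom g ->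
  proj B (a *: f + g) = a *: proj B f + proj B g.
Proof.
move=> df dg; have dfg := dom_linear hH a df dg.
have dpf := proj_dom B df; have dpg := proj_dom B dg.
apply: basis_ext => [||t]; [exact: proj_dom|exact: dom_linear|].
rewrite (inner_linear hH) ?proj_dot //; try exact: basis_dom.
rewrite (inner_linear hH) //; last exact: basis_dom.
by case: (B t) => //; rewrite mulr0 addr0.
Qed.

(* By continuity T f is the limit of the images of the partial sums of f. *)
Lemma bounded_dot_eq0 (T : H -> H) f y : bounded_linear T -> dom f -> dom y ->
  (forall t, dot f (u t) = 0 \/ dot (T (u t)) y = 0) -> dot (T f) y = 0.
Proof.
move=> [Tdom Tlin [M TM]] df dy fT; have [dp cp] := proj_cvg predT df.
have fE : f = proj predT f by apply: basis_ext => // t; rewrite proj_dot.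
have T0 : T 0 = 0.
  by have := Tlin (-1) 0 0 (dom0 hH) (dom0 hH); rewrite scaler0 addr0 scaleN1r addNr.
have dS n := basis_sum_dom predT f n.
have TS0 n : dot (T (basis_sum predT f n)) y = 0.
  elim: n => [|n IH]; first by rewrite /basis_sum big_ord0 T0 (inner0l hH dy).
  rewrite basis_sumS addrC /basis_term; case: pickle_inv => [t|]; last by rewrite add0r.
  rewrite Tlin //; last exact: basis_dom.
  rewrite (inner_linear hH) ?IH ?addr0 //; try (apply: Tdom => //; exact: basis_dom).
  by have [->|->] := fT t; rewrite ?mul0r ?mulr0.
have TS : converges_to (fun n => T (basis_sum predT f n)) (T f).
  move=> e e0; have M1 : 0 < `|M| + 1 by rewrite ltr_wpDl.
  have [N SN] := cp _ (divr_gt0 e0 M1); exists N => n /SN h.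
  have -> : T (basis_sum predT f n) - T f = T (basis_sum predT f n - f).
    by rewrite addrC -scaleN1r -Tlin // scaleN1r addrC.
  apply: (le_lt_trans (TM _ (domB hH (dS n) df))).
  rewrite -fE ltr_pdivlMr // mulrC in h; apply: le_lt_trans h.
  by rewrite ler_wpM2r ?norm_ge0 // (le_trans (ler_norm M)) // lerDl.
have h := dot_cvg hH (fun n => Tdom _ (dS n)) (Tdom _ df) dy TS.
by apply: (ctends_unique h); rewrite (funext TS0); exact: ctends_cst.
Qed.

Definition supported D : set H := [set f | dom f /\ forall t, ~~ D t -> dot f (u t) = 0].

(** Coefficients are continuous, so those outside D still vanish on the closure. Conversely the
    partial sums of an element supported in D belong to S by the last two hypotheses. *)
Lemma closure_supported D (S : set H) : S `<=` supported D -> S 0 ->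
  (forall a t f, D t -> S f -> S (a *: u t + f)) -> closure_in S = supported D.
Proof.
move=> SD S0 SZ; apply/seteqP; split=> [f [df fS]|f [df fD]]; split=> //; [move=> t Dt|move=> e e0].
  apply/eqP; rewrite -normc_eq0 eq_le normc_ge0 andbT; apply/ler_addgt0Pr => e e0.
  have [g [Sg fg]] := fS e e0; have [dg /(_ t Dt) g0] := SD g Sg.
  have -> : dot f (u t) = dot (f - g) (u t).
    by rewrite innerBl // ?g0 ?subr0 //; exact: basis_dom.
  apply: (le_trans (cauchy_schwarz hH (domB hH df dg) (basis_dom t))).
  by rewrite basis_norm mulr1 add0r ltW.
have [dp cp] := proj_cvg D df; have fE : f = proj D f.
  by apply: basis_ext => // t; rewrite proj_dot //; case: ifPn => // /fD.
have [N /(_ N (leqnn N)) fN] := cp e e0; exists (basis_sum D f N); split; last first.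
  by rewrite fE -{2}fE (norm_distC hH) //; exact: basis_sum_dom.
elim: (N) => [|n IH]; first by rewrite /basis_sum big_ord0.
rewrite basis_sumS addrC /basis_term; case: pickle_inv => [t|]; last by rewrite add0r.
by case: ifPn => [Dt|_]; [exact: SZ|rewrite add0r].
Qed.

Lemma supported_hilbert D : is_hilbert (Defs.subspace (H := H) (supported D)).
Proof.
have [[h0 h1] h2 h3 h4 h5] := hH; split.
- split=> [|a x y [dx xD] [dy yD]]; split; first exact: h0.
  + by move=> t _; exact: (inner0l hH (basis_dom t)).
  + exact: h1.
  + by move=> t Dt; rewrite h2 ?xD ?yD ?mulr0 ?addr0 //; exact: basis_dom.
- by move=> a x y z [dx _] [dy _] [dz _]; exact: h2.
- by move=> x y [dx _] [dy _]; exact: h3.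
- by move=> x [dx _]; exact: h4.
- move=> v dv vc; have dv' n : dom (v n) by have [] := dv n.
  have [x dx vx] := h5 v dv' vc; exists x => //; split=> // t Dt.
  have h := dot_cvg hH dv' dx (basis_dom t) vx.
  apply: (ctends_unique h); rewrite (_ : (fun n => _) = (fun=> 0)); first exact: ctends_cst.
  by apply/funext => n; have [_ ->] := dv n.
Qed.

End hilbert_basis.

Local Notation succ n p := (mpoly.mnm_add n (mpoly.mnm1 p)).

(** * The monomial basis, coefficients and truncations *)

Section bergman_basis.
Variables (R : realType) (m : nat).
Local Notation C := (R[i]).
Local Notation V := (Cn R m).
Local Notation H := (bergman_space R m).
Local Notation J := (mpoly.multinom m).
Local Notation hH := (bergman_is_hilbert R m).
Implicit Types (f g : V -> C^o) (n : J) (B D : pred J) (p : 'I_m).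

(** Normalised by the norm itself, so no integral has to be evaluated; [e_ R n] is a nonzero
    multiple of the same monomial and spans the same line. *)
Definition munit n : H := ((@inorm R H (mono n))^-1)%:C *: mono n.

Lemma mono_norm_gt0 n : 0 < @inorm R H (mono n).
Proof.
rewrite lt_neqAle norm_ge0 andbT eq_sym; apply/eqP => n0.
by have := @mono_neq0 R m n; rewrite (norm_eq0 hH (mono_bergman R n) n0) eqxx.
Qed.

Lemma mono_munit n : mono n = (@inorm R H (mono n))%:C *: munit n :> (V -> C^o).
Proof.
have n0 := mono_norm_gt0 n; rewrite /munit scalerA -(rmorphM (real_complex R)) /=.
by rewrite divff ?gt_eqF // scale1r.
Qed.

Lemma munit_basis : hilbert_basis munit.
Proof.
have bm n := mono_bergman R n; split=> [n|s t|f bf f0].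
- exact: (domZ hH _ (bm n)).
- rewrite [LHS](innerZZ hH _ _ (bm s) (bm t)).
  have [->|st] := eqVneq s t.
    have n0 := mono_norm_gt0 t; rewrite [inner _ _](inner_norm hH (bm t)).
    rewrite mulc_conj normc_real ger0_norm ?invr_ge0 ?ltW // -(rmorphM (real_complex R)) /=.
    by rewrite -exprMn mulVf ?gt_eqF // expr1n.
  rewrite [inner _ _]mono_orthogonal ?mulr0 //; apply/existsP; rewrite -negb_forall.
  by apply: contra st => /forallP h; apply/eqP/mpoly.mnmP => i; apply/eqP; exact: h.
- apply: bergman_monomials_total => // k.
  have kE : mono k = mono (mpoly.Multinom (mktuple k)) :> (V -> C^o).
    by congr mono; apply/funext => i; rewrite mpoly.multinomE tnth_mktuple.
  rewrite kE mono_munit [LHS](innerZr hH _ (domZ hH _ (bm _)) bf).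
  by have -> := f0 (mpoly.Multinom (mktuple k)); rewrite mulr0.
Qed.

Lemma coord_mul_mono p n : coord_mul p (mono n) = mono (succ n p) :> (V -> C^o).
Proof.
apply/funext => z; rewrite /coord_mul /mono /on_ball; case: ifP => _; last exact: mulr0.
rewrite /cmon (bigD1 p) // [in RHS](bigD1 p) //= mulrA -exprS; congr (_ * _).
  by rewrite mpoly.mnmDE mpoly.mnm1E eqxx addn1.
by apply: eq_bigr => i ip; rewrite mpoly.mnmDE mpoly.mnm1E eq_sym (negbTE ip) addn0.
Qed.

Lemma coord_mul_bounded p : @bounded_linear R H H (coord_mul p).
Proof.
split=> [f bf|a f g _ _|]; first by have [] := coord_mul_bergman p bf.
  apply/funext => z; rewrite /coord_mul -![in RHS]/(_ * _) mulrDr; congr (_ + _).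
  exact: mulrCA.
exists 1 => f bf; have [bpf le] := coord_mul_bergman p bf; rewrite mul1r !inormE //.
have [v0 _] := ball_volume_fin R m.
by rewrite ler_wsqrtr // ler_pM2r // invr_gt0.
Qed.

Lemma munit_bergman n : bergman_set (munit n).
Proof. exact: (basis_dom munit_basis). Qed.

End bergman_basis.

Arguments munit R {m} n.

HB.lock Definition coef (R : realType) (m : nat) (f : Cn R m -> (R[i])^o)
  (n : mpoly.multinom m) : R[i] := bergman_inner f (munit R n).

Section coefficients.
Variables (R : realType) (m : nat).
Local Notation C := (R[i]).
Local Notation V := (Cn R m).
Local Notation H := (bergman_space R m).
Local Notation J := (mpoly.multinom m).
Local Notation hH := (bergman_is_hilbert R m).
Implicit Types (f g : V -> C^o) (n : J) (B D : pred J) (p : 'I_m).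
Local Notation hu := (munit_basis R m).

Lemma coefE f n : coef f n = bergman_inner f (munit R n).
Proof. by rewrite unlock. Qed.

Lemma coef_linear (a : C) f g n : bergman_set f -> bergman_set g ->
  coef (a *: f + g) n = a * coef f n + coef g n.
Proof. by move=> bf bg; rewrite !coefE; exact: (inner_linear hH a bf bg (munit_bergman R n)). Qed.

Lemma coefB f g n : bergman_set f -> bergman_set g -> coef (f - g) n = coef f n - coef g n.
Proof. by move=> bf bg; rewrite !coefE; exact: (innerBl hH bf bg (munit_bergman R n)). Qed.

Lemma coef0 n : coef (0 : V -> C^o) n = 0.
Proof. by rewrite coefE; exact: (inner0l hH (munit_bergman R n)). Qed.

Lemma coefZ (a : C) f n : bergman_set f -> coef (a *: f) n = a * coef f n.
Proof. by move=> bf; rewrite !coefE; exact: (innerZl hH a bf (munit_bergman R n)). Qed.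

Lemma coef_sum (K : Type) (r : seq K) (Q : pred K) (F : K -> V -> C^o) n :
  (forall k, Q k -> bergman_set (F k)) ->
  coef (\sum_(k <- r | Q k) F k) n = \sum_(k <- r | Q k) coef (F k) n.
Proof.
move=> bF; rewrite coefE [LHS](inner_suml hH _ bF (munit_bergman R n)).
by apply: eq_bigr => k _; rewrite coefE.
Qed.

Lemma coef_ext f g : bergman_set f -> bergman_set g ->
  (forall n, coef f n = coef g n) -> f = g.
Proof.
move=> bf bg fg; apply: (basis_ext hH hu bf bg) => n.
by have := fg n; rewrite !coefE.
Qed.

Lemma coef_munit n n' : coef (munit R n) n' = (n == n')%:R.
Proof. by rewrite coefE; exact: (basis_dot hu). Qed.

Lemma coef_mono n n' : n != n' -> coef (mono n : V -> C^o) n' = 0.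
Proof.
by move=> nn'; rewrite mono_munit (coefZ _ n' (munit_bergman R n)) coef_munit (negbTE nn') mulr0.
Qed.

(** z_p sends the monomial n' to a multiple of its successor in direction p; [bounded_dot_eq0]
    extends this from monomials to f. *)
Lemma coef_coord_mul p f n : bergman_set f ->
  (forall n', succ n' p = n -> coef f n' = 0) -> coef (coord_mul p f) n = 0.
Proof.
move=> bf fn; have bm n' : bergman_set (mono n') := @mono_bergman R m n'.
rewrite coefE; apply: (bounded_dot_eq0 hH hu (coord_mul_bounded R p) bf (munit_bergman R n)) => n'.
have [E|E] := eqVneq (succ n' p) n; [by left; rewrite -[LHS]coefE; exact: fn|right].
have -> : coord_mul p (munit R n') =
    ((@inorm R H (mono n'))^-1)%:C *: mono (succ n' p) :> (V -> C^o).
  rewrite -coord_mul_mono; apply/funext => z; exact: mulrCA.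
by rewrite -[LHS]coefE (coefZ _ n (bm _)) (coef_mono E) mulr0.
Qed.

Lemma coord_mul_sub p f g : coord_mul p (f - g) = coord_mul p f - coord_mul p g.
Proof. by apply/funext => z; exact: mulrBr. Qed.

Lemma coord_mul_dom p f : bergman_set f -> bergman_set (coord_mul p f).
Proof. by move=> bf; have [] := coord_mul_bergman p bf. Qed.

Definition trunc B : (V -> C^o) -> V -> C^o := proj (munit R : J -> H) B.

Lemma trunc_bergman B f : bergman_set f -> bergman_set (trunc B f).
Proof. exact: (proj_dom hH hu B (f := f)). Qed.

Lemma coef_trunc B f n : bergman_set f -> coef (trunc B f) n = if B n then coef f n else 0.
Proof. by move=> bf; rewrite !coefE; exact: (proj_dot hH hu B n bf). Qed.

Lemma trunc_linear B (a : C) f g : bergman_set f -> bergman_set g ->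
  trunc B (a *: f + g) = a *: trunc B f + trunc B g.
Proof. exact: (proj_linear hH hu B a (f := f) (g := g)). Qed.

Lemma trunc_norm B f : bergman_set f -> @inorm R H (trunc B f) <= @inorm R H f.
Proof. exact: (proj_norm hH hu B (f := f)). Qed.

Definition down_closed B := forall n p, B (succ n p) -> B n.

(** The part of f outside a down-closed B is moved by z_p to exponents outside B, so discarding it
    early changes nothing. This makes truncations to boxes compatible with the module actions. *)
Lemma trunc_coord_mul B p f : down_closed B -> bergman_set f ->
  trunc B (coord_mul p (trunc B f)) = trunc B (coord_mul p f).
Proof.
move=> Bd bf; have bPf := trunc_bergman B bf.
have bp := coord_mul_dom p bf; have bpP := coord_mul_dom p bPf.
apply: (coef_ext (trunc_bergman B bpP) (trunc_bergman B bp)) => n.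
rewrite (coef_trunc B n bpP) (coef_trunc B n bp).
case: ifP => // Bn; apply/eqP; rewrite eq_sym -subr_eq0 -(coefB n bp bpP) -coord_mul_sub; apply/eqP.
apply: coef_coord_mul => [|n' E]; first exact: (bergman_set_sub bf bPf).
by rewrite (coefB n' bf bPf) (coef_trunc B n' bf) (Bd n' p) ?E // subrr.
Qed.

Lemma trunc_trunc B B' f : (forall n, B n -> B' n) -> bergman_set f ->
  trunc B (trunc B' f) = trunc B f.
Proof.
move=> BB' bf; have bf' := trunc_bergman B' bf.
apply: (coef_ext (trunc_bergman B bf') (trunc_bergman B bf)) => n.
by rewrite (coef_trunc B n bf') (coef_trunc B' n bf) (coef_trunc B n bf); case: ifP => // /BB' ->.
Qed.

Definition supp_in D : set (V -> C^o) :=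
  [set f | bergman_set f /\ forall n, ~~ D n -> coef f n = 0].

Lemma supp_inE D : supp_in D = supported (munit R : J -> H) D.
Proof.
apply/seteqP; split=> f [bf fD]; split=> // n Dn; have := fD n Dn; by rewrite coefE.
Qed.

Lemma trunc_id B f : supp_in B f -> trunc B f = f.
Proof.
move=> [bf fB]; apply: (coef_ext (trunc_bergman B bf) bf) => n.
by rewrite (coef_trunc B n bf); case: ifPn => // /fB.
Qed.

Lemma trunc_supp B f : bergman_set f -> supp_in B (trunc B f).
Proof.
move=> bf; split=> [|n Bn]; first exact: trunc_bergman.
by rewrite (coef_trunc B n bf) (negbTE Bn).
Qed.

Lemma supp_in_linear D (a : C) f g : supp_in D f -> supp_in D g -> supp_in D (a *: f + g).
Proof.
move=> [bf f0] [bg g0]; split=> [|n Dn]; first exact: bergman_set_linear.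
by rewrite (coef_linear a n bf bg) (f0 n Dn) (g0 n Dn) mulr0 addr0.
Qed.

Lemma supp_in0 D : supp_in D 0.
Proof. by split=> [|n _]; [exact: bergman_set0|exact: coef0]. Qed.

Lemma supp_in_hilbert D : is_hilbert (Defs.subspace (H := H) (supp_in D)).
Proof. by rewrite supp_inE; exact: (supported_hilbert hH hu). Qed.

Lemma closure_supp_in D (S : set (V -> C^o)) : S `<=` supp_in D -> S 0 ->
  (forall (a : C) n f, D n -> S f -> S (a *: mono n + f)) -> closure_in (H := H) S = supp_in D.
Proof.
move=> SD S0 SZ; rewrite supp_inE; apply: (closure_supported hH hu) => //.
  by rewrite -supp_inE.
by move=> a n f Dn Sf; rewrite /munit scalerA; exact: SZ.
Qed.

Lemma mono_supp D n : D n -> supp_in D (mono n).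
Proof.
move=> Dn; split=> [|n' Dn']; first exact: mono_bergman.
by apply: coef_mono; apply: contraNneq Dn' => <-.
Qed.

Lemma lin_span0 (W : lmodType C) (S : set W) : lin_span S 0.
Proof.
exists 0%N, (fun=> 0), (fun=> 0); split=> [[]//|].
by rewrite big_ord0.
Qed.

Lemma lin_spanD (W : lmodType C) (S : set W) (a : C) x y :
  S x -> lin_span S y -> lin_span S (a *: x + y).
Proof.
move=> Sx [n [c [v [Sv ->]]]].
exists n.+1, (fun i => if unlift ord0 i is Some j then c j else a),
  (fun i => if unlift ord0 i is Some j then v j else x); split=> [i|].
  by case: unlift.
rewrite big_ord_recl unlift_none; congr (_ + _).
by apply: eq_bigr => j _; rewrite liftK.
Qed.

Lemma closure_e D :
  closure_in (H := H) (lin_span [set e_ R n | n in [set n | D n]]) = supp_in D.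
Proof.
apply: closure_supp_in => [f [n [c [v [Sv ->]]]]||a n f Dn Sf].
- elim/big_ind: _ => [|x y Dx Dy|i _]; first exact: supp_in0.
    by rewrite -[x]scale1r; exact: supp_in_linear.
  have [n' /= Dn' <-] := Sv i; rewrite e_E scalerA -[_ *: _]addr0.
  by apply: supp_in_linear; [exact: mono_supp|exact: supp_in0].
- exact: lin_span0.
- have e0 := e_coeff_neq0 R n.
  have -> : mono n = (((Num.sqrt (omega0 R n))%:C)^-1)^-1 *: (e_ R n : V -> C^o).
    by rewrite e_E scalerA mulVf // scale1r.
  by rewrite scalerA; apply: lin_spanD => //; exists n.
Qed.

End coefficients.

(** * Box modules *)

Section hilbert_sum.
Variables (R : realType) (H : ispace R) (s : nat) (D : 'I_s -> set H).
Hypothesis hD : forall i, is_hilbert (Defs.subspace (D i)).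
Local Notation dot := (@inner R H).
Local Notation norm := (@inorm R H).

(** The summands are subspaces of one ambient space, as in [box_sum], so that [sum_hilbert] applies
    to sums of box modules by conversion. *)
Definition sum_ispace : ispace R :=
  @ISpace R ('I_s -> H : lmodType R[i]) [set x | forall i, D i (x i)]
    (fun x y => \sum_(i < s) dot (x i) (y i)).

Lemma sum_norm_sq (x : sum_ispace) : is_dom x -> inorm x ^+ 2 = \sum_(i < s) norm (x i) ^+ 2.
Proof.
move=> dx; have E : complex.Re (inner x x) = \sum_(i < s) norm (x i) ^+ 2.
  rewrite -[inner x x]/(\sum_(i < s) dot (x i) (x i)) (raddf_sum (@complex.Re R)).
  by apply: eq_bigr => i _; rewrite [dot _ _](inner_norm (hD i) (dx i)).
by rewrite /inorm sqr_sqrtr E //; apply: sumr_ge0 => i _; exact: sqr_ge0.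
Qed.

Lemma sum_norm_coord (x : sum_ispace) i : is_dom x -> norm (x i) <= inorm x.
Proof.
move=> dx; rewrite -(@ler_pXn2r _ 2) ?nnegrE ?norm_ge0 // sum_norm_sq //.
by rewrite (bigD1 i) //= lerDl; apply: sumr_ge0 => j _; exact: sqr_ge0.
Qed.

Lemma sum_norm_le (x : sum_ispace) : is_dom x -> inorm x <= \sum_(i < s) norm (x i).
Proof.
move=> dx; have S0 : 0 <= \sum_(i < s) norm (x i) by apply: sumr_ge0 => i _; exact: norm_ge0.
rewrite -(@ler_pXn2r _ 2) ?nnegrE ?norm_ge0 // sum_norm_sq //.
rewrite [X in _ <= X]expr2 mulr_suml; apply: ler_sum => i _.
rewrite expr2 ler_wpM2l ?norm_ge0 // (bigD1 i) //= lerDl.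
by apply: sumr_ge0 => j _; exact: norm_ge0.
Qed.

Lemma sum_hilbert : is_hilbert sum_ispace.
Proof.
split.
- split=> [i|a x y dx dy i]; first by have [[]] := hD i.
  by have [[_ h] _ _ _ _] := hD i; exact: h.
- move=> a x y z dx dy dz; rewrite /inner /= mulr_sumr -big_split; apply: eq_bigr => i _.
  exact: (inner_linear (hD i) a (dx i) (dy i) (dz i)).
- move=> x y dx dy; rewrite /inner /= (rmorph_sum conjc); apply: eq_bigr => i _.
  exact: (innerC (hD i) (dx i) (dy i)).
- move=> x dx x0; have [i xi0] : exists i, x i != 0.
    apply/existsP; rewrite -negb_forall; apply: contra x0 => /forallP h.
    by apply/eqP/funext => i; exact/eqP.
  have ge0 j : 0 <= dot (x j) (x j).
    by rewrite [dot _ _](inner_norm (hD j) (dx j)) lecR sqr_ge0.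
  have [_ _ _ pos _] := hD i.
  rewrite /inner /= (bigD1 i) //=; apply: ltr_pwDl; first exact: pos (dx i) xi0.
  by apply: sumr_ge0 => j _; exact: ge0.
- move=> v dv vc; have dv' i n : is_dom (v n i : Defs.subspace (D i)) by exact: dv.
  have dB p q : is_dom (v p - v q : sum_ispace) by move=> i; exact: (domB (hD i) (dv p i) (dv q i)).
  have vi i : @is_cauchy R (Defs.subspace (D i)) (fun n => v n i).
    move=> e /vc[N vN]; exists N => p q Np Nq; apply: le_lt_trans (vN p q Np Nq).
    exact: (sum_norm_coord i (dB p q)).
  have /choice[x xP] i : exists x : H, D i x /\
      @converges_to R (Defs.subspace (D i)) (fun n => v n i) x.
    by have [x dx xP] := hilbert_complete (hD i) (dv' i) (vi i); exists x.
  have dx i : D i (x i) by have [] := xP i.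
  exists x => // e e0; have s0 : 0 < s%:R + 1 :> R by rewrite ltr_wpDl.
  have /choice[N NP] i : exists N, forall n, (N <= n)%N -> norm (v n i - x i) < e / (s%:R + 1).
    by have [_] := xP i; apply; exact: divr_gt0.
  exists (\max_(i < s) N i) => n nN.
  have dvx : is_dom (v n - x : sum_ispace) by move=> i; exact: (domB (hD i) (dv n i) (dx i)).
  apply: (le_lt_trans (sum_norm_le dvx)).
  apply: (@le_lt_trans _ _ (\sum_(i < s) e / (s%:R + 1))).
    apply: ler_sum => i _; apply/ltW/NP; apply: leq_trans nN.
    by apply: (@leq_bigmax_cond _ xpredT N i).
  rewrite sumr_const card_ord -[X in X < _]mulr_natr mulrAC ltr_pdivrMr // ltr_pM2l //.
  by rewrite ltrDl.
Qed.

End hilbert_sum.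

Section box_modules.
Variables (R : realType) (m : nat).
Local Notation C := (R[i]).
Local Notation V := (Cn R m).
Local Notation H := (bergman_space R m).
Local Notation J := (mpoly.multinom m).
Local Notation succ n p := (mpoly.mnm_add n (mpoly.mnm1 p)).
Implicit Types (f g : V -> C^o) (n : J) (p : 'I_m) (B : box m).

Definition box_shift B p : box_space R B -> box_space R B :=
  fun f => trunc (in_box B) (coord_mul p f).

Lemma in_box_down B : down_closed (in_box B).
Proof.
move=> n p /forallP nB; apply/forallP => r; apply: leq_trans (nB r).
by rewrite mpoly.mnmDE leq_addr.
Qed.

Lemma box_hilbert B : is_hilbert (box_space R B).
Proof. rewrite /box_space closure_e; exact: supp_in_hilbert. Qed.

Lemma box_domE B f : @is_dom R (box_space R B) f = supp_in (in_box B) f.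
Proof. by rewrite -closure_e. Qed.

Lemma trunc_mono (D : pred J) n :
  trunc D (mono n) = (if D n then mono n else 0) :> (V -> C^o).
Proof.
have bn := @mono_bergman R m n; case: ifPn => Dn; first exact/trunc_id/mono_supp.
apply: (coef_ext (trunc_bergman D bn) (bergman_set0 R m)) => n'.
rewrite (coef_trunc D n' bn) coef0; case: ifP => // Dn'.
by apply: coef_mono; apply: contraNneq Dn => ->.
Qed.

Lemma coord_mul_norm p f : bergman_set f ->
  @inorm R H (coord_mul p f) <= @inorm R H f.
Proof.
move=> bf; have [bpf le] := coord_mul_bergman p bf; rewrite (inormE bpf) (inormE bf).
have [v0 _] := ball_volume_fin R m.
by rewrite ler_wsqrtr // ler_pM2r // invr_gt0.
Qed.

Lemma coord_mul_linear p (a : C) f g :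
  coord_mul p (a *: f + g) = a *: coord_mul p f + coord_mul p g.
Proof.
apply/funext => z; rewrite /coord_mul -![in RHS]/(_ * _) mulrDr; congr (_ + _).
exact: mulrCA.
Qed.

Lemma box_shiftP B p : is_box_shift p (@box_shift B p).
Proof.
have bD f : @is_dom R (box_space R B) f -> bergman_set f by rewrite box_domE => -[].
split=> [|n nB]; first split=> [f df|a f g /bD df /bD dg|].
- by rewrite box_domE; apply/trunc_supp/coord_mul_dom/bD.
- rewrite /box_shift coord_mul_linear.
  exact: (trunc_linear _ a (coord_mul_dom p df) (coord_mul_dom p dg)).
- exists 1 => f /bD df; rewrite mul1r; have dpf := coord_mul_dom p df.
  exact: le_trans (trunc_norm _ dpf) (coord_mul_norm p df).
have bn := @mono_bergman R m (succ n p); rewrite /box_shift.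
have -> : coord_mul p (e_ R n) =
    ((Num.sqrt (omega0 R n))%:C)^-1 *: mono (succ n p) + 0 :> (V -> C^o).
  by rewrite addr0 e_E -coord_mul_mono; apply/funext => z; exact: mulrCA.
rewrite (trunc_linear _ _ bn (bergman_set0 R m)) trunc_mono.
rewrite (trunc_id (supp_in0 R (in_box B))) !addr0.
by case: ifP => // _; rewrite scaler0.
Qed.

(** By [trunc_coord_mul] both sides are the truncation of z_p z_q f. *)
Lemma box_shiftC B p q f : supp_in (in_box B) f ->
  box_shift (B := B) p (box_shift (B := B) q f) = box_shift (B := B) q (box_shift (B := B) p f).
Proof.
move=> [bf _]; have bd := @in_box_down B; rewrite /box_shift.
rewrite (trunc_coord_mul p bd (coord_mul_dom q bf)) (trunc_coord_mul q bd (coord_mul_dom p bf)).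
by congr trunc; apply/funext => z; exact: mulrCA.
Qed.

Definition box_sum_shift (s : nat) (B : 'I_s -> box m) : hmodule R m :=
  box_sum (fun i => @box_shift (B i)).

Lemma box_sum_domE (s : nat) (B : 'I_s -> box m) (x : 'I_s -> V -> C^o) :
  @is_dom R (box_sum_shift B) x <-> forall i, supp_in (in_box (B i)) (x i).
Proof.
by split=> h i; have := h i; [rewrite -box_domE|rewrite /= -[supp_in _ _]box_domE].
Qed.

Lemma box_sum_hilbert (s : nat) (B : 'I_s -> box m) : is_hilbert (box_sum_shift B).
Proof. by have := sum_hilbert (fun i => box_hilbert (B i)); exact. Qed.

Lemma box_sum_module (s : nat) (B : 'I_s -> box m) : is_hilbert_module (box_sum_shift B).
Proof.
split=> [|p|p q x /box_sum_domE dx]; first exact: box_sum_hilbert; last first.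
  by apply/funext => i; exact: (box_shiftC p q (dx i)).
have hB i := box_hilbert (B i).
split=> [x dx i|a x y dx dy|].
- by have [[h _ _] _] := box_shiftP (B i) p; exact: h (dx i).
- apply/funext => i; have [[_ h _] _] := box_shiftP (B i) p.
  exact: h (dx i) (dy i).
- exists s%:R => x dx; have dpx : is_dom (@hm_act R m (box_sum_shift B) p x).
    by move=> i; have [[h _ _] _] := box_shiftP (B i) p; exact: h (dx i).
  apply: (le_trans (sum_norm_le hB dpx)).
  have -> : s%:R * inorm x = \sum_(i < s) inorm x by rewrite sumr_const card_ord mulr_natl.
  apply: ler_sum => i _; apply: le_trans (sum_norm_coord hB i dx).
  have [bx _] := (box_sum_domE _ _).1 dx i; have bpx := coord_mul_dom p bx.
  exact: le_trans (trunc_norm _ bpx) (coord_mul_norm p bx).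
Qed.

End box_modules.

(** * Monomial ideals and coverings by boxes *)

Section ideals.
Variables (R : realType) (m l : nat) (alpha : 'I_l -> mpoly.multinom m).
Local Notation C := (R[i]).
Local Notation V := (Cn R m).
Local Notation H := (bergman_space R m).
Local Notation J := (mpoly.multinom m).
Local Notation succ n p := (mpoly.mnm_add n (mpoly.mnm1 p)).
Implicit Types (f g : V -> C^o) (n : J) (p : 'I_m).

Definition in_ideal n : bool := [exists i, [forall j, (alpha i j <= n j)%N]].

Lemma poly_on_ballX n : poly_on_ball (mpoly.mpolyX C n) = mono n :> (V -> C^o).
Proof.
apply/funext => z; rewrite /poly_on_ball /mono /on_ball; case: ifP => // _.
exact: mpoly.mevalX.
Qed.

Lemma poly_on_ball_linear (a : C) (q r : mpoly.mpoly m C) :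
  poly_on_ball (a *: q + r) = a *: poly_on_ball q + poly_on_ball r :> (V -> C^o).
Proof.
apply/funext => z; rewrite -[RHS]/(a * poly_on_ball q z + poly_on_ball r z).
rewrite /poly_on_ball /on_ball; case: ifP => _; first by rewrite mpoly.mevalD mpoly.mevalZ.
by rewrite mulr0 addr0.
Qed.

Lemma poly_on_ball0 : poly_on_ball (0 : mpoly.mpoly m C) = 0 :> (V -> C^o).
Proof.
by apply/funext => z; rewrite /poly_on_ball /on_ball mpoly.meval0; case: ifP.
Qed.

Lemma monomial_ideal0 : monomial_ideal R alpha 0.
Proof. by exists (fun=> 0); rewrite big1 // => i _; rewrite mul0r. Qed.

Lemma monomial_idealD (a : C) n q : in_ideal n -> monomial_ideal R alpha q ->
  monomial_ideal R alpha (a *: mpoly.mpolyX C n + q).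
Proof.
move=> /existsP[i /forallP ni] [g ->].
exists (fun j => g j + (if j == i then a *: mpoly.mpolyX C (mpoly.mnm_sub n (alpha i)) else 0)).
under [RHS]eq_bigr do rewrite mulrDl; rewrite big_split addrC; congr (_ + _).
rewrite (bigD1 i) //= eqxx big1 ?addr0 => [|j ji]; last by rewrite (negbTE ji) mul0r.
rewrite -scalerAl -mpoly.mpolyXD mpoly.submK //; exact/mpoly.mnm_lepP.
Qed.

(** Polynomials in I have their exponents above some generator, and I contains the monomials with
    such exponents; [closure_supp_in] does the rest. The analysis of the closure is thereby reduced
    to a condition on coefficients. *)
Lemma ideal_closureE :
  closure_in (H := H) (@poly_on_ball R m @` monomial_ideal R alpha) = supp_in (R := R) in_ideal.
Proof.
apply: closure_supp_in => [_ [_ [g ->] <-]||a n _ nI [f If <-]].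
- pose Q (q : mpoly.mpoly m C) := supp_in in_ideal (poly_on_ball q).
  have QD q r : Q q -> Q r -> Q (q + r).
    by move=> Qq Qr; rewrite -[q]scale1r /Q poly_on_ball_linear; exact: supp_in_linear.
  have Q0 : Q 0 by rewrite /Q poly_on_ball0; exact: supp_in0.
  elim/big_ind: _ => // i _; rewrite [g i]mpoly.mpolyE mulr_suml.
  elim/big_ind: _ => // n _; rewrite -scalerAl -mpoly.mpolyXD -[_ *: _]addr0 poly_on_ball_linear.
  apply: supp_in_linear; last exact: Q0.
  rewrite poly_on_ballX; apply: mono_supp; apply/existsP; exists i; apply/forallP => j.
  by rewrite mpoly.mnmDE leq_addl.
- by exists 0; [exact: monomial_ideal0|exact: poly_on_ball0].
- exists (a *: mpoly.mpolyX C n + f); first exact: monomial_idealD.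
  by rewrite poly_on_ball_linear poly_on_ballX.
Qed.

Lemma coord_mul_supp (D : pred J) p f : (forall n, D n -> D (succ n p)) ->
  supp_in D f -> supp_in D (coord_mul p f).
Proof.
move=> Du [bf fD]; split=> [|n Dn]; first exact: coord_mul_dom.
by apply: (coef_coord_mul bf) => n' E; apply: fD; apply: contra Dn => /Du; rewrite E.
Qed.

Lemma in_ideal_succ n p : in_ideal n -> in_ideal (succ n p).
Proof.
move=> /existsP[i /forallP ni]; apply/existsP; exists i; apply/forallP => j.
by rewrite mpoly.mnmDE (leq_trans (ni j)) // leq_addr.
Qed.

Lemma coord_mul_bounded_on (D : set (V -> C^o)) p : D `<=` @bergman_set R m ->
  (forall f, D f -> D (coord_mul p f)) ->
  @bounded_linear R (Defs.subspace (H := H) D) (Defs.subspace (H := H) D) (coord_mul p).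
Proof.
move=> Db Dp; split=> [f|a f g _ _|]; [exact: Dp|exact: coord_mul_linear|].
by exists 1 => f Df; rewrite mul1r; exact: (coord_mul_norm p (Db f Df)).
Qed.

Lemma ideal_module : is_hilbert_module (ideal_closure (monomial_ideal R alpha)).
Proof.
rewrite /ideal_closure [closure_in _]ideal_closureE; split.
- exact: supp_in_hilbert.
- move=> p; apply: coord_mul_bounded_on => [f []//|f].
  by apply: coord_mul_supp => n; exact: in_ideal_succ.
- by move=> p q f _; apply/funext => z; exact: mulrCA.
Qed.

Lemma bergman_is_module : is_hilbert_module (bergman_module R m).
Proof.
split; first exact: bergman_is_hilbert.
- by move=> p; apply: coord_mul_bounded_on => // f; exact: coord_mul_dom.
- by move=> p q f _; apply/funext => z; exact: mulrCA.
Qed.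

End ideals.

Section boxes.
Variables (m : nat).
Local Notation J := (mpoly.multinom m).
Implicit Types (n : J) (cs : seq ('I_m * nat)).

(** The index sequence of a box is strictly increasing, so it has one bound per coordinate; several
    bounds on the same coordinate are merged into their minimum. *)
Fixpoint tightest cs (j : 'I_m) : option nat :=
  if cs is (i, b) :: cs' then
    if j == i then Some (if tightest cs' j is Some b' then minn b' b else b)
    else tightest cs' j
  else None.

Definition below (o : option nat) k := if o is Some b then (k <= b)%N else true.

Lemma tightestP cs n :
  (forall j, below (tightest cs j) (n j)) <-> all (fun c => n c.1 <= c.2)%N cs.
Proof.
elim: cs => [|[i b] cs IH] //=; split=> [h|/andP[h /IH h'] j].
  have := h i; rewrite eqxx; case E: (tightest cs i) => [b'|] /= nb; last first.
    rewrite nb; apply/IH => j; have := h j; case: eqP => // -> _.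
    by rewrite E.
  move: nb; rewrite leq_min => /andP[nb' ->]; apply/IH => j; have := h j.
  by case: eqP => // -> _; rewrite E.
case: eqP => [->|//]; have := h' i; case: tightest => [b'|] //= nb'.
by rewrite leq_min nb'.
Qed.

Lemma enum_val_ltn (A : {set 'I_m}) (r s : 'I_#|A|) : (r < s)%N -> (enum_val r < enum_val s)%N.
Proof.
move=> rs; have [x0 _] : exists x, x \in A by exists (enum_val r); exact: enum_valP.
rewrite !(enum_val_nth x0).
have srt : sorted (fun i j : 'I_m => (i < j)%N) (enum A).
  rewrite /enum_mem; apply: sorted_filter => [y x z|]; first exact: ltn_trans.
  have := iota_ltn_sorted 0 m; rewrite -val_enum_ord sorted_map -enumT; exact.
apply: (sorted_ltn_nth _ x0 srt) => //; rewrite ?inE -?cardE //.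
by move=> y x z; exact: ltn_trans.
Qed.

Lemma constraints_box cs : (0 < size cs)%N ->
  exists B : box m, forall n, in_box B n = all (fun c => n c.1 <= c.2)%N cs.
Proof.
move=> cs0; pose A : {set 'I_m} := finset (fun j => tightest cs j != None).
have A0 : (0 < #|A|)%N.
  have [j jA] : exists j, j \in A.
    by case: cs @A cs0 => [//|[i b] cs] A _; exists i; rewrite finset.inE /= eqxx.
  by apply/card_gt0P; exists j.
exists (@Box m #|A| (fun r => enum_val r) (fun r => odflt 0%N (tightest cs (enum_val r))) A0
  (@enum_val_ltn A)).
move=> n; apply/forallP/idP => /= [h|/tightestP h r]; last first.
  have := h (enum_val r); have := enum_valP r; rewrite finset.inE.
  by case: (tightest _ _).
apply/tightestP => j; case E: (tightest cs j) => [b|//] /=.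
have jA : j \in A by rewrite finset.inE E.
by have := h (enum_rank_in jA j); rewrite enum_rankK_in // E.
Qed.

(** The index set consists of the maps phi that choose for each generator a coordinate in which n
    falls short of it. Every nonempty intersection of the resulting sets is given by finitely many
    upper bounds on coordinates, hence is a box; l > 0 provides at least one bound. *)
Lemma ideal_covering (l : nat) (alpha : 'I_l -> J) : (0 < l)%N ->
  exists (N : nat) (base : 'I_N -> pred J),
    (forall n, in_ideal alpha n = ~~ [exists k, base k n]) /\
    (forall S : {set 'I_N}, S != finset.set0 ->
      exists B : box m, forall n, in_box B n = [forall (k | k \in S), base k n]).
Proof.
(* Only phi with positive alpha_i (phi i) are kept, so that n < alpha_i can be written n <= alpha_i
   - 1. If some generator is 1, Phi is empty and so is the covering. *)
move=> l0; pose Phi : {set {ffun 'I_l -> 'I_m}} := finset (fun phi : {ffun 'I_l -> 'I_m} =>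
  [forall i, (0 < alpha i (phi i))%N]).
pose phi_ (k : 'I_#|Phi|) : {ffun 'I_l -> 'I_m} := enum_val k.
exists #|Phi|, (fun k n => [forall i, (n (phi_ k i) < alpha i (phi_ k i))%N]); split.
  move=> n; apply/idP/existsPn => [/existsP[i /forallP ni] k|h].
    by apply/negP => /forallP/(_ i); rewrite ltnNge ni.
  apply: contraT => /existsPn nI.
  have /choice[phi phiP] i : exists j, (n j < alpha i j)%N.
    by have /forallPn[j] := nI i; rewrite -ltnNge; exists j.
  pose psi := [ffun i => phi i]; have psiP : psi \in Phi.
    by rewrite finset.inE; apply/forallP => i; rewrite ffunE (leq_trans _ (phiP i)).
  have /negP[] := h (enum_rank_in psiP psi).
  by apply/forallP => i; rewrite /phi_ enum_rankK_in // ffunE.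
move=> S /finset.set0Pn[k0 k0S].
pose cs := [seq (phi_ k i, (alpha i (phi_ k i)).-1)
             | k <- enum S, i <- enum 'I_l].
have kS k i : k \in S -> (phi_ k i, (alpha i (phi_ k i)).-1) \in cs.
  by move=> h; apply/allpairsP; exists (k, i); rewrite !mem_enum.
have pos (k : 'I_#|Phi|) i : (0 < alpha i (phi_ k i))%N.
  by have := enum_valP k; rewrite finset.inE => /forallP.
have [|B BP] := @constraints_box cs; first by have := kS k0 (Ordinal l0) k0S; case: (cs).
exists B => n; rewrite BP; apply/allP/forall_inP => [h k kS'|h c /allpairsP[[k i]]].
  by apply/forallP => i; have := h _ (kS k i kS'); rewrite /= -ltnS prednK.
rewrite !mem_enum => -[/= kS' _ ->] /=.
by have /forallP/(_ i) := h k kS'; rewrite -[X in (_ < X)%N]prednK.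
Qed.

End boxes.

(** * The Cech complex *)

Section simplex.
Variables (R : realType) (N : nat).
Local Notation C := (R[i]).
Implicit Types (S : {set 'I_N}) (t r v : 'I_N) (x : {set 'I_N} -> C).

Definition rank_in S t : nat := #|finset (fun s => (s \in S) && (s < t)%N)|.

Definition sgn S t : C := (-1) ^+ rank_in S t.

Definition coboundary x S : C := \sum_(t in S) sgn S t * x (S :\ t).

Lemma rank_inD1 S t r : r \in S -> (r < t)%N -> rank_in S t = (rank_in (S :\ r) t).+1.
Proof.
move=> rS rt; rewrite /rank_in (cardsD1 r) finset.inE rS rt add1n; congr _.+1.
by apply: eq_card => s; rewrite !finset.inE; case: (s == r).
Qed.

Lemma rank_inD1_ge S t r : (t <= r)%N -> rank_in (S :\ r) t = rank_in S t.
Proof.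
move=> tr; apply: eq_card => s; rewrite !finset.inE; case: eqP => [->|] //=.
by rewrite ltnNge tr andbF.
Qed.

(** Deleting the smaller of two elements lowers the rank of the larger by one, while deleting the
    larger leaves the rank of the smaller unchanged. *)
Lemma sgnD1 S t r : t \in S -> r \in S -> t != r ->
  sgn S t * sgn (S :\ t) r = - (sgn S r * sgn (S :\ r) t).
Proof.
wlog rt : t r / (r < t)%N => [W|] tS rS tr.
  have [h|h] : (r < t)%N \/ (t < r)%N by apply/orP; rewrite -neq_ltn eq_sym.
    exact: W.
  by rewrite [in RHS]W ?opprK // eq_sym.
rewrite /sgn (rank_inD1 rS rt) (rank_inD1_ge S (ltnW rt)) exprS mulN1r.
by rewrite mulNr [in RHS]mulrC.
Qed.

(** The summand F t r is antisymmetric in the two deleted elements, so the double sum equals its own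
    negative. *)
Lemma coboundaryK x S : coboundary (coboundary x) S = 0.
Proof.
pose F t r := sgn S t * sgn (S :\ t) r * x ((S :\ t) :\ r).
have E : coboundary (coboundary x) S = \sum_(t in S) \sum_(r in S :\ t) F t r.
  by apply: eq_bigr => t _; rewrite mulr_sumr; apply: eq_bigr => r _; rewrite mulrA.
have E' : \sum_(t in S) \sum_(r in S :\ t) F t r = - \sum_(t in S) \sum_(r in S :\ t) F t r.
  rewrite [LHS](exchange_big_dep (mem S)) /=; last by move=> t r _; rewrite finset.inE => /andP[].
  rewrite -sumrN; apply: eq_bigr => r rS; rewrite -sumrN.
  rewrite (eq_bigl (fun t => t \in S :\ r)) => [|t]; last first.
    by rewrite !finset.inE rS andbT andbC eq_sym.
  apply: eq_bigr => t; rewrite !finset.inE => /andP[tr tS].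
  by rewrite /F (sgnD1 tS rS tr) mulNr !finset.setDDl [_ :|: _]finset.setUC.
have /eqP := E'; rewrite -E -subr_eq0 opprK -mulr2n -mulr_natl mulf_eq0 pnatr_eq0 /=.
by move/eqP.
Qed.

(** Being minimal, v carries the sign +1. If v is in S, only the term deleting v survives; otherwise
    the cocycle condition on v |: S expresses x S by the remaining faces. *)
Lemma coboundary_contraction x v S : (forall s, s \in S -> (v <= s)%N) ->
  (v \notin S -> coboundary x (v |: S) = 0) ->
  coboundary (fun S' => if v \in S' then 0 else x (v |: S')) S = x S.
Proof.
move=> vmin dx; have sgn_v S' : (forall s, s \in S' -> (v <= s)%N) -> sgn S' v = 1.
  move=> vm; rewrite /sgn /rank_in (_ : finset _ = finset.set0) ?finset.cards0 //.
  apply/finset.setP => s; rewrite !finset.inE; apply/negP => /andP[/vm vs].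
  by rewrite ltnNge vs.
rewrite /coboundary; have [vS|vS] := boolP (v \in S).
  rewrite (bigD1 v) //= finset.setD11 finset.setD1K // sgn_v // mul1r.
  rewrite big1 ?addr0 // => t /andP[_ tv].
  by rewrite !finset.inE eq_sym tv vS mulr0.
have := dx vS; rewrite /coboundary big_setU1 //= finset.setU1K // sgn_v; last first.
  by move=> s; rewrite !finset.inE => /orP[/eqP ->|/vmin].
rewrite mul1r => /eqP; rewrite addr_eq0 => /eqP ->; rewrite -sumrN.
apply: eq_bigr => t tS; have vt : v != t by apply: contraNneq vS => ->.
have vt' : (v < t)%N by rewrite ltn_neqAle vmin // andbT.
rewrite !finset.inE (negbTE vS) andbF /sgn (rank_inD1 (S := v |: S) (finset.setU11 v S) vt').
rewrite finset.setU1K // exprS mulN1r mulNr opprK; congr (_ * x _).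
apply/finset.setP => s; rewrite !finset.inE.
by case: eqP => [->|_] //=; rewrite ?vt ?andbT.
Qed.

End simplex.

Section cech.
Variables (R : realType) (m N : nat) (base : 'I_N -> pred (mpoly.multinom m)).
Variable Bx : {set 'I_N} -> box m.
Hypothesis BxP : forall S, S != finset.set0 ->
  forall n, in_box (Bx S) n = [forall (k | k \in S), base k n].
Local Notation C := (R[i]).
Local Notation V := (Cn R m).
Local Notation H := (bergman_space R m).
Local Notation J := (mpoly.multinom m).
Local Notation norm := (@inorm R H).
Local Notation sgn := (@sgn R N).
Implicit Types (f g : V -> C^o) (n : J) (p : 'I_m) (S : {set 'I_N}) (t v : 'I_N)
  (X Y : {set 'I_N} -> V -> C^o).

Definition inB S : pred J := fun n => [forall (k | k \in S), base k n].

(** S ranges over all sets of indices. The value of X at the empty set is the augmentation by the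
    Bergman space, where [inB] holds for every exponent. *)
Definition cech_d X S : V -> C^o := \sum_(t in S) sgn S t *: trunc (inB S) (X (S :\ t)).

Lemma inB_sub S S' n : S' \subset S -> inB S n -> inB S' n.
Proof.
by move=> SS /forall_inP h; apply/forall_inP => k /(fintype.subsetP SS)/h.
Qed.

(** Each [base k] is itself a box, that of the singleton of k. *)
Lemma inB_down S : down_closed (inB S).
Proof.
move=> n p /forall_inP h; apply/forall_inP => k kS.
have k0 : finset.set1 k != finset.set0 by apply/finset.set0Pn; exists k; rewrite !finset.inE.
have E n' : base k n' = in_box (Bx (finset.set1 k)) n'.
  rewrite (BxP k0); apply/idP/forall_inP => [kn k'|]; last by apply; rewrite finset.inE.
  by rewrite finset.inE => /eqP ->.
by rewrite E; apply: (in_box_down (p := p)); rewrite -E; exact: h.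
Qed.

(** T is linear on the Bergman space only, so the induction also carries the membership of the
    partial sums. *)
Lemma trunc_sum_linear (T : (V -> C^o) -> V -> C^o) (P : pred 'I_N) (c : 'I_N -> C)
    (F : 'I_N -> V -> C^o) :
  (forall a f g, bergman_set f -> bergman_set g -> T (a *: f + g) = a *: T f + T g) ->
  (forall t, bergman_set (F t)) ->
  T (\sum_(t | P t) c t *: F t) = \sum_(t | P t) c t *: T (F t).
Proof.
move=> lin bF; have T0 : T 0 = 0.
  have := lin (-1) 0 0 (bergman_set0 R m) (bergman_set0 R m).
  by rewrite scaler0 addr0 scaleN1r addNr.
have : T (\sum_(t | P t) c t *: F t) = \sum_(t | P t) c t *: T (F t) /\
    bergman_set (\sum_(t | P t) c t *: F t); last by case.
elim: (index_enum _) => [|t r [IH bIH]]; first by rewrite !big_nil; split; [exact: T0|exact: bergman_set0].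
rewrite !big_cons; case: (P t); last by split.
split; last exact: (bergman_set_linear _ (bF t) bIH).
by rewrite (lin _ _ _ (bF t) bIH) IH.
Qed.

Section cochain.
Variable X : {set 'I_N} -> V -> C^o.
Hypothesis bX : forall S, bergman_set (X S).

Lemma cech_d_supp S : supp_in (inB S) (cech_d X S).
Proof.
rewrite /cech_d; elim/big_ind: _ => [|f g Sf Sg|t _]; first exact: supp_in0.
  by rewrite -[f]scale1r; exact: supp_in_linear.
rewrite -[_ *: _]addr0; apply: supp_in_linear; last exact: supp_in0.
exact: trunc_supp.
Qed.

Lemma coef_cech_d S n : inB S n ->
  coef (cech_d X S) n = coboundary (fun S' => coef (X S') n) S.
Proof.
move=> Sn; have bt t := trunc_bergman (inB S) (bX (S :\ t)).
rewrite /cech_d coef_sum => [|t _]; last exact: (domZ (bergman_is_hilbert R m) _ (bt t)).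
apply: eq_bigr => t _.
by rewrite (coefZ (sgn S t) n (bt t)) (coef_trunc (inB S) n (bX (S :\ t))) Sn.
Qed.

Lemma cech_d_norm S (M : R) : (forall S', norm (X S') <= M) ->
  norm (cech_d X S) <= \sum_(t in S) M.
Proof.
move=> XM; have hH := bergman_is_hilbert R m.
have bt t := trunc_bergman (inB S) (bX (S :\ t)).
have h := @norm_sum R H hH _ (index_enum 'I_N) (mem S)
  (fun t => sgn S t *: trunc (inB S) (X (S :\ t))) (fun t _ => domZ hH (sgn S t) (bt t)).
apply: (le_trans h).
apply: ler_sum => t _; rewrite (normZ hH (sgn S t) (bt t)).
have -> : normc (sgn S t) = 1 by rewrite /sgn normcX normcN normc1 expr1n.
by rewrite mul1r (le_trans (trunc_norm _ (bX _))).
Qed.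

Lemma cech_d_act p S :
  cech_d (fun S' => trunc (inB S') (coord_mul p (X S'))) S =
  trunc (inB S) (coord_mul p (cech_d X S)).
Proof.
have bt t := trunc_bergman (inB S) (bX (S :\ t)).
rewrite {2}/cech_d (@trunc_sum_linear (fun f => trunc (inB S) (coord_mul p f))) //; last first.
  move=> a f g bf bg; rewrite coord_mul_linear.
  exact: (trunc_linear _ a (coord_mul_dom p bf) (coord_mul_dom p bg)).
apply: eq_bigr => t _; congr (_ *: _).
rewrite (trunc_coord_mul p (@inB_down S) (bX (S :\ t))).
apply: trunc_trunc (coord_mul_dom p (bX (S :\ t))) => n.
exact/inB_sub/finset.subD1set.
Qed.

End cochain.

Lemma cech_d_linear X Y (a : C) S : (forall S', bergman_set (X S')) ->
  (forall S', bergman_set (Y S')) ->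
  cech_d (fun S' => a *: X S' + Y S') S = a *: cech_d X S + cech_d Y S.
Proof.
move=> bX bY; rewrite /cech_d scaler_sumr -big_split; apply: eq_bigr => t _ /=.
rewrite (trunc_linear _ a (bX (S :\ t)) (bY (S :\ t))) scalerDr !scalerA.
by rewrite [_ * a]mulrC.
Qed.

Lemma eq_cech_d X Y S : (forall t, t \in S -> X (S :\ t) = Y (S :\ t)) ->
  cech_d X S = cech_d Y S.
Proof. by move=> XY; apply: eq_bigr => t /XY ->. Qed.

Lemma cech_dK X S : (forall S', bergman_set (X S')) -> cech_d (cech_d X) S = 0.
Proof.
move=> bX; have bd S' : bergman_set (cech_d X S') by have [] := cech_d_supp bX S'.
have [bdd ddS] := cech_d_supp bd S.
apply: (coef_ext bdd (bergman_set0 R m)) => n; rewrite coef0.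
have [Sn|/ddS //] := boolP (inB S n).
rewrite (coef_cech_d bd Sn) -[RHS](coboundaryK (fun S' => coef (X S') n) S).
apply: eq_bigr => t _; rewrite coef_cech_d //.
by apply: inB_sub Sn; exact: finset.subD1set.
Qed.

(* The index of the simplex vertex that contracts the complex at n. *)
Definition least v n := base v n && [forall w, base w n ==> (v <= w)%N].

(** On the coefficient at n this is the contraction of the simplex towards its least vertex v. As v
    varies with n, the operator is glued from truncations to the disjoint sets of exponents with a
    given least vertex. *)
Definition contraction X S : V -> C^o :=
  \sum_(v in 'I_N) trunc (fun n => [&& inB S n, v \notin S & least v n]) (X (v |: S)).

Lemma contraction_supp X S : (forall S', bergman_set (X S')) -> supp_in (inB S) (contraction X S).
Proof.
move=> bX; rewrite /contraction; elim/big_ind: _ => [|f g Sf Sg|t _]; first exact: supp_in0.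
  by rewrite -[f]scale1r; exact: supp_in_linear.
have [bt ht] := trunc_supp (fun n => [&& inB S n, t \notin S & least t n]) (bX (t |: S)).
by split=> // n Sn; apply: ht; rewrite (negbTE Sn).
Qed.

Lemma coef_contraction X S n v : (forall S', bergman_set (X S')) -> inB S n -> least v n ->
  coef (contraction X S) n = if v \in S then 0 else coef (X (v |: S)) n.
Proof.
move=> bX Sn vn; rewrite /contraction coef_sum => [|t _]; last exact: trunc_bergman.
rewrite (bigD1 v) //= big1 ?addr0 => [|w wv].
  by rewrite coef_trunc // Sn vn andbT; case: (v \in S).
rewrite coef_trunc //; case: ifP => // /and3P[_ _ /andP[bw /forallP wl]].
move: vn => /andP[bv /forallP vl]; case/negP: wv; rewrite -val_eqE eqn_leq.
by have := wl v; have := vl w; rewrite bw bv /= => -> ->.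
Qed.

(** Equality is checked on coefficients: outside [inB S] both sides vanish, and at n in [inB S] it
    is [coboundary_contraction] for the least v with [base v n]. *)
Lemma cech_d_contraction X S : (forall S', bergman_set (X S')) -> S != finset.set0 ->
  supp_in (inB S) (X S) ->
  (forall S', #|S'| = #|S|.+1 -> cech_d X S' = 0) ->
  cech_d (contraction X) S = X S.
Proof.
move=> bX S0 [bXS XSs] dX0.
have bY S' : bergman_set (contraction X S') by have [] := contraction_supp S' bX.
have [bd ds] := cech_d_supp bY S.
apply: (coef_ext bd bXS) => n; have [Sn|Sn] := boolP (inB S n); last by rewrite ds ?XSs.
have [k kS] := finset.set0Pn _ S0.
have [v bv vmin] : exists2 v, base v n & forall w, base w n -> (v <= w)%N.
  have bk : base k n by have /forall_inP := Sn; apply.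
  by case: (@arg_minnP _ k (fun w => base w n) (fun w => val w) bk) => v bv vmin; exists v.
have lv : least v n by rewrite /least bv; apply/forallP => w; apply/implyP => /vmin.
rewrite (coef_cech_d bY Sn).
rewrite -(@coboundary_contraction _ _ (fun S' => coef (X S') n) v S) => [|s sS|vS].
- apply: eq_bigr => t tS; rewrite (coef_contraction bX _ lv) //.
  by apply: inB_sub Sn; exact: finset.subD1set.
- by apply: vmin; have /forall_inP := Sn; apply.
- have vSn : inB (v |: S) n.
    apply/forall_inP => w; rewrite !finset.inE => /orP[/eqP ->//|wS].
    by have /forall_inP := Sn; apply.
  rewrite -(coef_cech_d bX vSn) dX0 ?coef0 //.
  by rewrite finset.cardsU1 vS.
Qed.

End cech.

(** * The Cech complex as a sequence of Hilbert modules *)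

Section cech_modules.
Variables (R : realType) (m N : nat) (base : 'I_N -> pred (mpoly.multinom m)).
Variable Bx : {set 'I_N} -> box m.
Hypothesis BxP : forall S, S != finset.set0 ->
  forall n, in_box (Bx S) n = [forall (k | k \in S), base k n].
Local Notation C := (R[i]).
Local Notation V := (Cn R m).
Local Notation H := (bergman_space R m).
Local Notation J := (mpoly.multinom m).
Local Notation norm := (@inorm R H).
Local Notation inB := (@inB m N base).
Local Notation cech_d := (@cech_d R m N base).
Implicit Types (f g : V -> C^o) (n : J) (p : 'I_m) (S : {set 'I_N})
  (X Y : {set 'I_N} -> V -> C^o).

Definition faces (i : nat) : {set {set 'I_N}} := finset (fun S => #|S| == i).

Definition face (i : nat) (r : 'I_#|faces i|) : {set 'I_N} := enum_val r.

Definition cech_module (i : nat) : hmodule R m :=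
  box_sum_shift R (fun r : 'I_#|faces i| => Bx (face r)).

Lemma card_face i (r : 'I_#|faces i|) : #|face r| = i.
Proof. by have := enum_valP r; rewrite finset.inE => /eqP. Qed.

Lemma face_of i S : #|S| = i -> exists r : 'I_#|faces i|, face r = S.
Proof.
move=> Si; have SF : S \in faces i by rewrite finset.inE Si.
by exists (enum_rank_in SF S); rewrite /face enum_rankK_in.
Qed.

Lemma face_neq0 i (r : 'I_#|faces i.+1|) : face r != finset.set0.
Proof. by rewrite -finset.card_gt0 card_face. Qed.

Lemma face_supp i (r : 'I_#|faces i.+1|) :
  supp_in (R := R) (in_box (Bx (face r))) = supp_in (inB (face r)).
Proof. by congr supp_in; apply/funext => n; rewrite (BxP (face_neq0 r)). Qed.

(** Extends an element of the i-th module by 0 to all sets of indices. An element of the Bergman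
    space is placed at the empty set, so that one formula covers every differential, the first
    included. *)
Definition cochain (i : nat) : modules cech_module i -> {set 'I_N} -> V -> C^o :=
  match i return modules cech_module i -> {set 'I_N} -> V -> C^o with
  | 0 => fun f S => if S == finset.set0 then f else 0
  | j.+1 => fun x S => if [pick r : 'I_#|faces j.+1| | face r == S] is Some r then x r else 0
  end.

Lemma cochain_face i (x : modules cech_module i.+1) (r : 'I_#|faces i.+1|) :
  cochain x (face r) = x r.
Proof.
rewrite /cochain; case: pickP => [r' /eqP/enum_val_inj -> //|/(_ r)].
by rewrite eqxx.
Qed.

Lemma cochain_eq0 i (x : modules cech_module i) S : #|S| != i -> cochain x S = 0.
Proof.
case: i x => [|i] x Si /=; first by rewrite -finset.cards_eq0 (negbTE Si).
by case: pickP => // r /eqP rS; rewrite -rS card_face eqxx in Si.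
Qed.

Lemma cochain_supp i (x : modules cech_module i) S : is_dom x -> supp_in (inB S) (cochain x S).
Proof.
have [Si|Si] := eqVneq #|S| i; last by rewrite (cochain_eq0 x Si) => _; exact: supp_in0.
case: i x Si => [|i] x Si dx.
  have /eqP S0 : S == finset.set0 by rewrite -finset.cards_eq0 Si.
  rewrite S0 /cochain eqxx; split=> // n /negP[]; apply/forall_inP => k.
  by rewrite finset.inE.
have [r <-] := face_of Si; rewrite cochain_face -face_supp.
exact: (box_sum_domE _ _).1 dx r.
Qed.

Lemma cochain_bergman i (x : modules cech_module i) S : is_dom x -> bergman_set (cochain x S).
Proof. by move=> dx; have [] := cochain_supp S dx. Qed.

Lemma cochain_linear i (a : C) (x y : modules cech_module i) S :
  cochain (a *: x + y) S = a *: cochain x S + cochain y S.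
Proof.
case: i x y => [|i] x y /=; first by case: eqP => // _; rewrite scaler0 addr0.
by case: pickP => // _; rewrite scaler0 addr0.
Qed.

Lemma cochain_norm i (x : modules cech_module i) S : is_dom x -> norm (cochain x S) <= inorm x.
Proof.
have n0 : norm 0 = 0 := norm0 (bergman_is_hilbert R m).
case: i x => [|i] x dx /=; first by case: eqP => // _; rewrite n0 norm_ge0.
case: pickP => [r _|_]; last by rewrite n0 norm_ge0.
exact: (sum_norm_coord (fun r => box_hilbert R (Bx (face r))) r dx).
Qed.

(** At the empty set [inB] holds everywhere and the truncation is the identity, so the Bergman
    module obeys the formula of the box modules. *)
Lemma cochain_act i p (x : modules cech_module i) S : is_dom x ->
  cochain (hm_act p x) S = trunc (inB S) (coord_mul p (cochain x S)).
Proof.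
move=> dx; have [Si|Si] := eqVneq #|S| i; last first.
  have -> : cochain x S = 0 by exact: cochain_eq0.
  have -> : coord_mul p 0 = 0 :> (V -> C^o) by apply/funext => z; exact: mulr0.
  by rewrite cochain_eq0 // trunc_id //; exact: supp_in0.
case: i x dx Si => [|i] x dx Si.
  have /eqP S0 : S == finset.set0 by rewrite -finset.cards_eq0 Si.
  rewrite S0 /cochain eqxx trunc_id //; split; first exact: coord_mul_dom dx.
  by move=> n /negP[]; apply/forall_inP => k; rewrite finset.inE.
have [r <-] := face_of Si; rewrite !cochain_face.
rewrite -[LHS]/(trunc (in_box (Bx (face r))) (coord_mul p (x r))).
by congr trunc; apply/funext => n; exact: (BxP (face_neq0 r)).
Qed.

Definition cech_map (i : nat) (x : modules cech_module i) : modules cech_module i.+1 :=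
  fun r => cech_d (cochain x) (face r).

Lemma cech_map_dom i (x : modules cech_module i) : is_dom x -> is_dom (cech_map x).
Proof.
move=> dx; apply/box_sum_domE => r; rewrite face_supp.
by apply: cech_d_supp => S; exact: cochain_bergman.
Qed.

Lemma cochain_cech_map i (x : modules cech_module i) S : #|S| = i.+1 ->
  cochain (cech_map x) S = cech_d (cochain x) S.
Proof. by move=> Si; have [r <-] := face_of Si; rewrite cochain_face. Qed.

Lemma cech_map_morphism i : bounded_morphism (@cech_map i).
Proof.
split; last first.
  move=> p x dx; apply/funext => r; have bx S := cochain_bergman S dx.
  rewrite -[RHS]/(trunc (in_box (Bx (face r))) (coord_mul p (cech_d (cochain x) (face r)))).
  have -> : in_box (Bx (face r)) = inB (face r).
    by apply/funext => n; exact: (BxP (face_neq0 r)).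
  rewrite -(cech_d_act BxP bx); apply: eq_cech_d => t _; exact: cochain_act.
split=> [x|a x y dx dy|]; first exact: cech_map_dom.
  apply/funext => r; have bx S := cochain_bergman S dx; have bY S := cochain_bergman S dy.
  rewrite -[RHS]/(a *: cech_d (cochain x) (face r) + cech_d (cochain y) (face r)).
  by rewrite -(cech_d_linear _ a _ bx bY); apply: eq_cech_d => t _; exact: cochain_linear.
exists (\sum_(r < #|faces i.+1|) \sum_(t in face r) 1) => x dx.
have hB r := box_hilbert R (Bx (@face i.+1 r)).
apply: (le_trans (sum_norm_le hB (cech_map_dom dx))).
rewrite mulr_suml; apply: ler_sum => r _; rewrite mulr_suml.
under [leRHS]eq_bigr do rewrite mul1r.
apply: cech_d_norm => S; [exact: cochain_bergman|exact: cochain_norm].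
Qed.

Lemma cochain_onto i Y : (forall S, supp_in (inB S) (Y S)) ->
  exists2 x : modules cech_module i, is_dom x & forall S, #|S| = i -> cochain x S = Y S.
Proof.
move=> SY; case: i => [|i].
  exists (Y finset.set0); first by have [] := SY finset.set0.
  by move=> S /eqP; rewrite finset.cards_eq0 => /eqP -> /=; rewrite eqxx.
exists (fun r => Y (face r)).
  by apply/box_sum_domE => r; rewrite face_supp; exact: SY.
by move=> S Si; have [r <-] := face_of Si; rewrite cochain_face.
Qed.

(** The preimage of a cocycle is its contraction, restricted to the sets of i indices. For i = 0 it
    is an element of the Bergman space. *)
Lemma cech_exact i : mor_im (@cech_map i) = mor_ker (@cech_map i.+1).
Proof.
apply/seteqP; split=> [_ [x dx <-]|y [dy y0]].
  have bx S := cochain_bergman S dx.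
  split; first exact: cech_map_dom.
  apply/funext => r; rewrite -[RHS](cech_dK base (face r) bx); apply: eq_cech_d => t tr.
  apply: cochain_cech_map; have := card_face r; rewrite (cardsD1 t) tr.
  by rewrite add1n => -[].
have by_ S := cochain_bergman S dy.
have [x dx xE] := @cochain_onto i (contraction base (cochain y))
  (fun S => contraction_supp base S by_).
exists x => //; apply/funext => r; rewrite -(cochain_face y).
have cr : #|face r| = i.+1 := card_face r.
rewrite -(cech_d_contraction by_ (face_neq0 r) (cochain_supp (face r) dy)).
  apply: eq_cech_d => t tr; apply: xE; move: cr; rewrite (cardsD1 t) tr.
  by rewrite add1n => -[].
move=> S; rewrite cr => Si; have [r' <-] := face_of Si.
by rewrite -[LHS]/(cech_map y r') y0.
Qed.

(** On the singleton of k the differential of f has, up to sign, the coefficients of f at the n with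
    [base k n]. *)
Lemma cech_map0_ker (D : pred J) : (forall n, D n = ~~ [exists k, base k n]) ->
  mor_ker (@cech_map 0) = supp_in D.
Proof.
move=> DE; have cE f S : cochain (i := 0) f S = if S == finset.set0 then f else 0 by [].
have d1 f n k : bergman_set f -> base k n ->
    coef (cech_d (cochain (i := 0) f) (finset.set1 k)) n = 0 -> coef f n = 0.
  move=> bf kn; have bx S := @cochain_bergman 0 f S bf.
  have kB : inB (finset.set1 k) n.
    by apply/forall_inP => k'; rewrite finset.inE => /eqP ->.
  rewrite (coef_cech_d bx kB) /coboundary finset.big_set1 cE.
  rewrite finset.setDv eqxx => /eqP; rewrite mulf_eq0 /sgn signr_eq0 /=; exact/eqP.
apply/seteqP; split=> [f [bf f0]|f [bf fD]]; split=> //.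
  move=> n; rewrite DE negbK => /existsP[k kn]; apply: (d1 f n k bf kn).
  have [r rk] := @face_of 1 (finset.set1 k) (finset.cards1 k).
  by rewrite -rk -[cech_d _ _]/(cech_map (i := 0) f r) f0; exact: coef0.
have bx S := @cochain_bergman 0 f S bf.
apply/funext => r; have [bd ds] := cech_d_supp base bx (face r).
apply: (coef_ext bd (bergman_set0 R m)) => n; rewrite coef0.
have [rn|/ds //] := boolP (inB (face r) n).
rewrite (coef_cech_d bx rn) /coboundary big1 // => t tr; rewrite cE; case: eqP => _; last first.
  by rewrite coef0 mulr0.
rewrite fD ?mulr0 // DE negbK; apply/existsP; exists t.
by have /forall_inP := rn; apply.
Qed.

End cech_modules.

Theorem theorem1p1 (R : realType) (m l : nat) (hm : (0 < m)%N) (hl : (0 < l)%N)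
    (alpha : 'I_l -> mpoly.multinom m) :
  exists (k : nat) (A : nat -> hmodule R m)
         (Psi : forall i, modules A i -> modules A i.+1),
    let Ibar := ideal_closure (monomial_ideal R alpha) in
    let iota : Ibar -> modules A 0%N := idfun in
    [/\ (1 <= k)%N,
        (forall i, (1 <= i <= k)%N -> bergman_like (modules A i)),
        is_hilbert_module Ibar /\
          (forall i, (i <= k)%N -> is_hilbert_module (modules A i)),
        bounded_morphism iota /\
          (forall i, (i < k)%N -> bounded_morphism (Psi i)) &
        [/\ mor_ker iota = [set 0],
            mor_im iota = mor_ker (Psi 0%N),
            (forall i, (i.+1 < k)%N -> mor_im (Psi i) = mor_ker (Psi i.+1)) &
            (forall i, i.+1 = k ->
               mor_im (Psi i) = [set y | is_dom y])]].
Proof.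
have [N [base [DE baseP]]] := ideal_covering alpha hl.
have /choice[Bx BxP] S : exists B : box m, S != finset.set0 ->
    forall n, in_box B n = [forall (k | k \in S), base k n].
  have [->|S0] := eqVneq S finset.set0; last by have [B BP] := baseP S S0; exists B.
  (* The empty set indexes no box of the complex; any box serves as default, here the one bounding
     the exponent of the variable with index 0 by 0. *)
  by have [B _] := @constraints_box m [:: (Ordinal hm, 0%N)] isT; exists B.
(* N may be 0, namely when I is the whole ring. With k = N + 1 one has k >= 1 in all cases, and the
   last module is an empty sum, since no set of N + 1 indices exists. *)
exists N.+1, (cech_module R Bx), (@cech_map R m N base Bx) => Ibar iota.
have domI : [set f : Ibar | is_dom f] = supp_in (R := R) (in_ideal alpha).
  exact: ideal_closureE.
split; first exact: isT.
- move=> [//|i] _; exists #|faces N i.+1|, (fun r => Bx (face r)).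
  exists (fun r => @box_shift R m (Bx (face r))).
  by split; [move=> r p; exact: box_shiftP|].
- split; first exact: ideal_module.
  by move=> [|i] _; [exact: bergman_is_module|exact: box_sum_module].
- split; last by move=> i _; exact: cech_map_morphism.
  split; last by move=> p f _.
  split; [|by move=> a f g _ _|by exists 1 => x _; rewrite mul1r].
  by move=> f df; have [] : supp_in (in_ideal alpha) f by rewrite -domI.
split.
- apply/seteqP; split=> [f [_ f0]|_ ->]; [exact: f0|split; last by []].
  have : supp_in (in_ideal alpha) (0 : Cn R m -> (R[i])^o) by exact: supp_in0.
  by rewrite -domI.
- rewrite (cech_map0_ker R BxP DE) /mor_im domI.
  by apply/seteqP; split=> [_ [f df <-]|f df]; [exact: df|exists f].
- by move=> i _; exact: (cech_exact R BxP).
(* Surjectivity of the last map is exactness one place further on: the next differential ends in an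
   empty sum, so its kernel is everything. *)
- move=> i [iN]; rewrite (cech_exact R BxP); apply/seteqP.
  split=> [y [dy _]|y dy]; [exact: dy|split; first exact: dy].
  apply/funext => r; have := max_card (mem (face r)).
  by rewrite card_face card_ord => h; move: (h); lia.
Qed.
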